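(* Let $f$ be the generator of a continuous one-parameter semigroup of holomorphic self-mappings of the open unit disk $\mathbb{D}$ with the Denjoy-Wolff point $a=1$. Assume that $f$ has pairwise distinct boundary regular null points $\zeta_1,\dots,\zeta_N\in\partial\mathbb{D}$ different from $1$ (each $f'(\zeta_n)$ being negative). Then there exist a number $r\ge 0$ and a holomorphic generator $h$ on $\mathbb{D}$ such that $$\frac{1}{f(z)}=\sum_{n=1}^{N}\frac{1}{|f'(\zeta_n)|}\Big(\frac{1}{z-1}-\frac{1}{z-\zeta_n}\Big)+\frac{r}{h(z)},\qquad z\in\mathbb{D},$$ where $h$ satisfies $h'(1)=f'(1)$ and $$\angle\lim_{z\to\zeta_n}\frac{h(z)}{z-\zeta_n}=\infty\quad\text{for all } n=1,\dots,N.$$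
   Context: $\mathbb{D}$ is the open unit disk in $\mathbb{C}$. A (continuous one-parameter) semigroup on $\mathbb{D}$ is a family $\{F_t\}_{t\ge0}$ of holomorphic self-mappings of $\mathbb{D}$ with $F_{s+t}=F_s\circ F_t$, $F_0(z)=z$, continuous in $t$. Its (infinitesimal) generator is the holomorphic function $f(z)=\lim_{t\to0^+}\frac1t(z-F_t(z))$ on $\mathbb{D}$; a ''holomorphic generator on $\mathbb{D}$'' is a function arising in this way. For a semigroup that is nontrivial (not reduced to the identity) and contains no elliptic automorphisms of $\mathbb{D}$, the Denjoy-Wolff point is the unique $a\in\overline{\mathbb{D}}$ with $F_t(z)\to a$ as $t\to\infty$ for all $z\in\mathbb{D}$. The symbol $\angle\lim$ denotes the angular (nontangential) limit; for $\zeta\in\partial\mathbb{D}$, $f(\zeta)$ denotes the angular limit of $f$ at $\zeta$, and, when this is $0$, $f'(\zeta)=\angle\lim_{z\to\zeta}\frac{f(z)}{z-\zeta}$ is the angular derivative. A boundary regular null point of $f$ is a point $\zeta\in\partial\mathbb{D}$ at which the angular limit of $f$ exists and equals $0$ and the angular derivative exists and is finite. If $a=1$ is the Denjoy-Wolff point, then $f(1)=0$ and $f'(1)$ exists and is a nonnegative real number; at boundary regular null points $\zeta\neq a$ the number $f'(\zeta)$ is real and negative. *)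

(* Defs.v *)
(* Real numbers of the Stdlib, complex analysis in Coquelicot.  Functions on the
   open unit disk are total functions C -> C of which only the values on the
   disk matter. *)
From Stdlib Require Import Reals.
From Coquelicot Require Import Coquelicot.
Open Scope C_scope.

Definition in_disk (z : C) : Prop := (Cmod z < 1)%R.

(* [ex_derive] is over the field [C_AbsRing], so this is complex
   differentiability. *)
Definition holomorphic_on_disk (f : C -> C) : Prop :=
  forall z : C, in_disk z -> ex_derive (K := C_AbsRing) (V := C_NormedModule) f z.

(* Only the times [t >= 0] matter. *)
Record is_semigroup (F : R -> C -> C) : Prop := {
  semigroup_holomorphic :
    forall t : R, (0 <= t)%R -> holomorphic_on_disk (F t);
  semigroup_self_map :
    forall (t : R) (z : C), (0 <= t)%R -> in_disk z -> in_disk (F t z);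
  semigroup_add :
    forall (s t : R) (z : C), (0 <= s)%R -> (0 <= t)%R -> in_disk z ->
      F (s + t)%R z = F s (F t z);
  semigroup_zero : forall z : C, in_disk z -> F 0%R z = z;
  semigroup_continuous :
    forall (t : R) (z : C), (0 <= t)%R -> in_disk z ->
      filterlim (fun s : R => F s z) (within (Rle 0) (locally t))
        (locally (F t z))
}.

Definition is_generator_of (f : C -> C) (F : R -> C -> C) : Prop :=
  holomorphic_on_disk f /\
  forall z : C, in_disk z ->
    filterlim (fun t : R => (z - F t z) / RtoC t) (at_right 0%R)
      (locally (f z)).

Definition is_holomorphic_generator (f : C -> C) : Prop :=
  exists F : R -> C -> C, is_semigroup F /\ is_generator_of f F.

(* A semigroup that is trivial or contains an elliptic automorphism does not
   converge to one point from every starting point, so these two exclusions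
   need not be repeated here. *)
Definition is_Denjoy_Wolff_point (F : R -> C -> C) (a : C) : Prop :=
  (Cmod a <= 1)%R /\
  forall z : C, in_disk z ->
    filterlim (fun t : R => F t z) (Rbar_locally p_infty) (locally a).

(* Nontangential approach region at a boundary point [zeta], of aperture
   [K > 1]. *)
Definition Stolz_region (zeta : C) (K : R) (z : C) : Prop :=
  in_disk z /\ (Cmod (z - zeta) < K * (1 - Cmod z))%R.

Definition angular_lim (f : C -> C) (zeta l : C) : Prop :=
  forall K : R, (1 < K)%R ->
    filterlim f (within (Stolz_region zeta K) (locally zeta)) (locally l).

Definition angular_lim_infty (f : C -> C) (zeta : C) : Prop :=
  forall K : R, (1 < K)%R ->
    filterlim (fun z : C => Cmod (f z))
      (within (Stolz_region zeta K) (locally zeta)) (Rbar_locally p_infty).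

(* [f(zeta) = 0] and [f'(zeta) = c], both in the angular sense. *)
Definition is_angular_derivative (f : C -> C) (zeta c : C) : Prop :=
  angular_lim f zeta 0 /\
  angular_lim (fun z : C => f z / (z - zeta)) zeta c.

Definition boundary_regular_null_point (f : C -> C) (zeta : C) : Prop :=
  Cmod zeta = 1%R /\ exists c : C, is_angular_derivative f zeta c.

(* Main.v *)
(* In the half-plane coordinate [cayley z = (1 + z) / (1 - z)] a semigroup with
   Denjoy-Wolff point 1 does not decrease the real part (Wolff), so
   [f z = - (1 - z)^2 * p z] with [Re p >= 0] and [p] without zeros.  Then
   [q = 1 / p] also has nonnegative real part, and the null point [zeta_n]
   shows up as an atom of [q]: [q z * (z - zeta_n)] has the angular limit
   [(1 - zeta_n)^2 / |d_n|].  Julia's inequality allows one to subtract the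
   corresponding multiple of the Herglotz kernel without destroying
   [Re q >= 0].  After subtracting all of them one is left with [k],
   [Re k >= 0], and [h = - (1 - z)^2 * r / k] satisfies the formula; the constant
   [r] is forced by [h'(1) = f'(1)] to be [1 - f'(1) * sum 1 / |d_n|], which is
   nonnegative by the Julia-Wolff-Caratheodory theorem for [1 / k] at 1.  If [k]
   vanishes, then [r = 0] and [h z = f'(1) * (z - 1)] will do.

   That [h] generates a semigroup is seen in the half-plane.  There the vector
   field is [P] with [Re P >= 0]; its Koenigs function [sigma], a primitive of
   [1 / P], is injective since its derivative has (up to a rotation) positive
   real part.  The Euler maps [w + eta * P w] contract the hyperbolic metric, so
   the Euler polygons stay in a compact set and converge to the solution [w'] of
   [sigma w' = sigma w + t].

   The Schwarz-Pick lemma and the primitive rest on Goursat's theorem for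
   rectangles, transported to circles by the exponential. *)
Require Import Defs.
From Stdlib Require Import ZArith Reals Lra Lia Psatz Classical ClassicalEpsilon.
From Coquelicot Require Import Coquelicot.
Open Scope C_scope.

(** * Complex derivatives *)

(** Singularities are never removed here. In the Schwarz lemma the quotient [S w / w] is only known
    to be continuous at 0, so the mean value argument tolerates one exceptional point: it lies on a
    single circle, and the means pass across that circle by continuity. The Schwarz-Pick and Harnack
    inequalities are stated without denominators, so they allow vanishing real parts and pass to
    limits. That [p] has no zeros is a rigidity statement: a zero would make [p], hence [f], vanish
    identically. The orbit of 0 would then be constant, by the same estimate on hyperbolic steps
    that controls the Euler polygons, against convergence to 1. The sign of [r] comes from two
    limits at 1. If [b = f'(1)] and [B] is the angular limit of [(1 - z) / k z], then [k * p] tends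
    to [r], so [B * r = b] with [B >= 0]. This gives [r > 0] when [b > 0], while [b = 0] gives
    [r = 1]. *)

Ltac lt_Rmin H := first
  [ exact (Rlt_le_trans _ _ _ H (Rmin_l _ _)) | exact (Rlt_le_trans _ _ _ H (Rmin_r _ _))
  | exact (Rlt_le_trans _ _ _ H (Rle_trans _ _ _ (Rmin_l _ _) (Rmin_l _ _)))
  | exact (Rlt_le_trans _ _ _ H (Rle_trans _ _ _ (Rmin_l _ _) (Rmin_r _ _)))
  | exact (Rlt_le_trans _ _ _ H (Rle_trans _ _ _ (Rmin_r _ _) (Rmin_l _ _)))
  | exact (Rlt_le_trans _ _ _ H (Rle_trans _ _ _ (Rmin_r _ _) (Rmin_r _ _))) ].

Ltac cancel_div := unfold Rdiv; rewrite Rmult_assoc, Rinv_l, Rmult_1_r by lra.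

Lemma Cminus_diag (z : C) : z - z = 0.
Proof. ring. Qed.

Lemma Cconj_RtoC (r : R) : Cconj (RtoC r) = RtoC r.
Proof. unfold Cconj, RtoC; simpl. now rewrite Ropp_0. Qed.

Lemma locally_C_Cmod (z : C) (P : C -> Prop) :
  locally z P <-> exists d : R, (0 < d)%R /\ forall y, (Cmod (y - z) < d)%R -> P y.
Proof.
  split.
  - intros H. apply locally_C in H. destruct H as [d Hd].
    exists d. split. apply cond_pos. intros y Hy. apply Hd. exact Hy.
  - intros [d [Hd H]]. apply locally_C. exists (mkposreal d Hd). intros y Hy. apply H. exact Hy.
Qed.

Lemma filterlim_C_Cmod {T : Type} (F : (T -> Prop) -> Prop) {FF : Filter F} (f : T -> C) (l : C) :
  filterlim f F (locally l) <-> forall e : R, (0 < e)%R -> F (fun x => (Cmod (f x - l) < e)%R).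
Proof.
  split.
  - intros H e He. apply (H (fun y => (Cmod (y - l) < e)%R)).
    apply locally_C_Cmod. exists e. split; auto.
  - intros H P HP. apply locally_C_Cmod in HP. destruct HP as [d [Hd HP]].
    unfold filtermap. generalize (H d Hd). apply filter_imp. intros x Hx. apply HP, Hx.
Qed.

(** Multiplied out, so that [y = z] needs no exception and no quotient appears. *)
Definition has_cderiv (f : C -> C) (z l : C) : Prop :=
  forall e : R, (0 < e)%R -> exists d : R, (0 < d)%R /\
    forall y, (Cmod (y - z) < d)%R -> (Cmod (f y - f z - l * (y - z)) <= e * Cmod (y - z))%R.

Lemma is_derive_C_Cmod (f : C -> C) (z l : C) :
  is_derive (K := C_AbsRing) (V := C_NormedModule) f z l <-> has_cderiv f z l.
Proof.
  split.
  - intros [_ H] e He.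
    specialize (H z (fun P HP => HP) (mkposreal e He)).
    destruct H as [d Hd]. exists d. split. apply cond_pos.
    intros y Hy. specialize (Hd y Hy).
    change (norm (minus (minus (f y) (f z)) (scal (minus y z) l)))
      with (Cmod (f y - f z - (y - z) * l)) in Hd.
    change (norm (minus y z)) with (Cmod (y - z)) in Hd. simpl in Hd.
    rewrite (Cmult_comm l). exact Hd.
  - intros H. split. apply is_linear_scal_l.
    intros x Hx.
    apply (is_filter_lim_locally_unique (K := C_AbsRing) (V := AbsRing_NormedModule C_AbsRing)) in Hx.
    subst x.
    intros e. destruct (H e (cond_pos e)) as [d [Hd H']].
    exists (mkposreal d Hd). intros y Hy. specialize (H' y Hy).
    rewrite (Cmult_comm l) in H'. exact H'.
Qed.

(** Coquelicot states its product and chain rules for this module structure on [C], whereas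
    [holomorphic_on_disk] uses [C_NormedModule]; both reduce to the same estimate. *)
Lemma is_derive_CC_Cmod (f : C -> C) (z l : C) :
  is_derive (K := C_AbsRing) (V := AbsRing_NormedModule C_AbsRing) f z l <-> has_cderiv f z l.
Proof.
  split.
  - intros [_ H] e He.
    specialize (H z (fun P HP => HP) (mkposreal e He)).
    destruct H as [d Hd]. exists d. split. apply cond_pos.
    intros y Hy. specialize (Hd y Hy).
    rewrite (Cmult_comm l). exact Hd.
  - intros H. split. apply is_linear_scal_l.
    intros x Hx.
    apply (is_filter_lim_locally_unique (K := C_AbsRing) (V := AbsRing_NormedModule C_AbsRing)) in Hx.
    subst x.
    intros e. destruct (H e (cond_pos e)) as [d [Hd H']].
    exists (mkposreal d Hd). intros y Hy. specialize (H' y Hy).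
    rewrite (Cmult_comm l) in H'. exact H'.
Qed.

Lemma has_cderiv_const (c z : C) : has_cderiv (fun _ => c) z 0.
Proof.
  intros e He. exists 1%R. split; [lra|]. intros y _.
  replace (c - c - 0 * (y - z)) with (RtoC 0) by ring. rewrite Cmod_0.
  apply Rmult_le_pos; [lra | apply Cmod_ge_0].
Qed.

Lemma has_cderiv_id (z : C) : has_cderiv (fun x => x) z 1.
Proof.
  intros e He. exists 1%R. split; [lra|]. intros y _.
  replace (y - z - 1 * (y - z)) with (RtoC 0) by ring. rewrite Cmod_0.
  apply Rmult_le_pos; [lra | apply Cmod_ge_0].
Qed.

Lemma has_cderiv_plus (f g : C -> C) (z a b : C) :
  has_cderiv f z a -> has_cderiv g z b -> has_cderiv (fun x => f x + g x) z (a + b).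
Proof.
  rewrite <- !is_derive_CC_Cmod.
  exact (is_derive_plus (K := C_AbsRing) (V := AbsRing_NormedModule C_AbsRing) f g z a b).
Qed.

Lemma has_cderiv_mult (f g : C -> C) (z a b : C) :
  has_cderiv f z a -> has_cderiv g z b -> has_cderiv (fun x => f x * g x) z (a * g z + f z * b).
Proof.
  rewrite <- !is_derive_CC_Cmod. intros Hf Hg.
  exact (is_derive_mult (K := C_AbsRing) f g z a b Hf Hg Cmult_comm).
Qed.

Lemma has_cderiv_comp (f g : C -> C) (z a b : C) :
  has_cderiv f (g z) a -> has_cderiv g z b -> has_cderiv (fun x => f (g x)) z (a * b).
Proof.
  rewrite <- !is_derive_CC_Cmod. intros Hf Hg. rewrite Cmult_comm.
  exact (is_derive_comp (K := C_AbsRing) (V := AbsRing_NormedModule C_AbsRing) f g z a b Hf Hg).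
Qed.

Lemma has_cderiv_ext_locally (f g : C -> C) (z a : C) (r : R) :
  (0 < r)%R -> (forall y, (Cmod (y - z) < r)%R -> f y = g y) ->
  has_cderiv f z a -> has_cderiv g z a.
Proof.
  intros Hr Hfg Hf e He. destruct (Hf e He) as [d [Hd H]].
  exists (Rmin d r). split. { apply Rmin_pos; auto. }
  intros y Hy. rewrite <- !Hfg.
  - apply H. lt_Rmin Hy.
  - rewrite Cminus_diag. rewrite Cmod_0. lra.
  - lt_Rmin Hy.
Qed.

Lemma has_cderiv_ext (f g : C -> C) (z a : C) :
  (forall y, f y = g y) -> has_cderiv f z a -> has_cderiv g z a.
Proof. intros H. apply (has_cderiv_ext_locally f g z a 1); [lra | auto]. Qed.

Definition ccont (f : C -> C) (z : C) : Prop :=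
  forall e : R, (0 < e)%R -> exists d : R, (0 < d)%R /\
    forall y, (Cmod (y - z) < d)%R -> (Cmod (f y - f z) < e)%R.

Lemma Cmod_minus_sym (a b : C) : Cmod (a - b) = Cmod (b - a).
Proof. rewrite <- Cmod_opp. f_equal. ring. Qed.

Lemma Cmod_triangle_minus (a b c : C) : (Cmod (a - c) <= Cmod (a - b) + Cmod (b - c))%R.
Proof. replace (a - c) with ((a - b) + (b - c)) by ring. apply Cmod_triangle. Qed.

Lemma Cmod_rev_triangle (a b : C) : (Cmod a - Cmod b <= Cmod (a - b))%R.
Proof.
  generalize (Cmod_triangle (a - b) b). replace (a - b + b) with a by ring. lra.
Qed.

Lemma has_cderiv_ccont (f : C -> C) (z a : C) : has_cderiv f z a -> ccont f z.
Proof.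
  intros H e He. destruct (H 1%R Rlt_0_1) as [d [Hd Hf]].
  pose proof (Cmod_ge_0 a) as Ha.
  exists (Rmin d (e / (2 + Cmod a))). split.
  { apply Rmin_pos; auto. apply Rdiv_lt_0_compat; lra. }
  intros y Hy.
  assert (H1 : (Cmod (y - z) < d)%R) by (lt_Rmin Hy).
  assert (H2 : (Cmod (y - z) < e / (2 + Cmod a))%R) by (lt_Rmin Hy).
  specialize (Hf y H1).
  replace (f y - f z) with ((f y - f z - a * (y - z)) + a * (y - z)) by ring.
  eapply Rle_lt_trans; [apply Cmod_triangle|]. rewrite Cmod_mult.
  apply Rle_lt_trans with ((1 + Cmod a) * Cmod (y - z))%R. lra.
  pose proof (Cmod_ge_0 (y - z)) as H0.
  apply Rmult_lt_compat_r with (r := (2 + Cmod a)%R) in H2; [|lra].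
  unfold Rdiv in H2. rewrite Rmult_assoc, Rinv_l, Rmult_1_r in H2 by lra. nra.
Qed.

Lemma has_cderiv_Cinv (z : C) : z <> 0 -> has_cderiv (fun x => / x) z (- / (z * z)).
Proof.
  intros Hz e He. pose proof Hz as Hm. apply Cmod_gt_0 in Hm.
  set (m := Cmod z) in *.
  (* The remainder equals [(y - z)^2 / (y * z^2)]. The first radius keeps [|y| > m / 2], the second
     then makes the remainder at most [e * |y - z|]. *)
  exists (Rmin (m / 2) (e * m ^ 3 / 2)). split.
  { apply Rmin_pos. lra. apply Rdiv_lt_0_compat; [|lra].
    apply Rmult_lt_0_compat; [lra | now apply pow_lt]. }
  intros y Hy.
  assert (H1 : (Cmod (y - z) < m / 2)%R) by (lt_Rmin Hy).
  assert (H2 : (Cmod (y - z) < e * m ^ 3 / 2)%R) by (lt_Rmin Hy).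
  assert (Hy2 : (m / 2 < Cmod y)%R).
  { rewrite Cmod_minus_sym in H1. generalize (Cmod_rev_triangle z y). fold m. lra. }
  assert (Hy0 : y <> 0). { apply Cmod_gt_0. lra. }
  replace (/ y - / z - - / (z * z) * (y - z)) with ((y - z) * (y - z) / (y * z * z)).
  2: { field. split; auto. }
  assert (Hd : y * z * z <> 0) by (repeat apply Cmult_neq_0; auto).
  rewrite Cmod_div, !Cmod_mult by auto. fold m.
  set (u := Cmod (y - z)) in *. pose proof (Cmod_ge_0 (y - z)) as Hu. fold u in Hu.
  assert (Hp : (0 < Cmod y * m * m)%R) by (repeat apply Rmult_lt_0_compat; lra).
  apply Rmult_le_reg_r with (Cmod y * m * m)%R; auto.
  cancel_div.
  rewrite (Rmult_comm e u), Rmult_assoc. apply Rmult_le_compat_l; auto.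
  apply Rle_trans with (e * (m / 2 * m * m))%R. nra.
  apply Rmult_le_compat_l; [lra|]. apply Rmult_le_compat_r; [lra|]. apply Rmult_le_compat_r; lra.
Qed.

Lemma has_cderiv_inv (f : C -> C) (z a : C) : has_cderiv f z a -> f z <> 0 ->
  has_cderiv (fun x => / f x) z (- / (f z * f z) * a).
Proof.
  intros Hf Hz. apply (has_cderiv_comp (fun x => / x) f); auto. now apply has_cderiv_Cinv.
Qed.

Definition cdiff (f : C -> C) (z : C) : Prop := exists l, has_cderiv f z l.

Lemma cdiff_ccont f z : cdiff f z -> ccont f z.
Proof. intros [l H]. eapply has_cderiv_ccont, H. Qed.
Lemma cdiff_const c z : cdiff (fun _ => c) z.
Proof. eexists. apply has_cderiv_const. Qed.
Lemma cdiff_id z : cdiff (fun x => x) z.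
Proof. eexists. apply has_cderiv_id. Qed.
Lemma cdiff_plus f g z : cdiff f z -> cdiff g z -> cdiff (fun x => f x + g x) z.
Proof. intros [a Ha] [b Hb]. eexists. apply has_cderiv_plus; eauto. Qed.
Lemma cdiff_mult f g z : cdiff f z -> cdiff g z -> cdiff (fun x => f x * g x) z.
Proof. intros [a Ha] [b Hb]. eexists. apply has_cderiv_mult; eauto. Qed.
Lemma cdiff_opp f z : cdiff f z -> cdiff (fun x => - f x) z.
Proof.
  intros [a Ha]. exists (0 * f z + -1 * a).
  apply has_cderiv_ext with (fun x => (-1) * f x). intros; ring.
  apply (has_cderiv_mult (fun _ => -1)); auto. apply has_cderiv_const.
Qed.
Lemma cdiff_minus f g z : cdiff f z -> cdiff g z -> cdiff (fun x => f x - g x) z.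
Proof. intros Hf Hg. apply cdiff_plus; auto. now apply cdiff_opp. Qed.
Lemma cdiff_inv f z : cdiff f z -> f z <> 0 -> cdiff (fun x => / f x) z.
Proof. intros [a Ha] H. eexists. apply has_cderiv_inv; eauto. Qed.
Lemma cdiff_div f g z : cdiff f z -> cdiff g z -> g z <> 0 -> cdiff (fun x => f x / g x) z.
Proof. intros. apply cdiff_mult; auto. now apply cdiff_inv. Qed.
Lemma cdiff_comp f g z : cdiff f (g z) -> cdiff g z -> cdiff (fun x => f (g x)) z.
Proof. intros [a Ha] [b Hb]. eexists. apply (has_cderiv_comp f g); eauto. Qed.
Lemma cdiff_ext_locally f g z r : (0 < r)%R ->
  (forall y, (Cmod (y - z) < r)%R -> f y = g y) -> cdiff f z -> cdiff g z.
Proof. intros Hr H [a Ha]. exists a. eapply has_cderiv_ext_locally; eauto. Qed.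

Lemma cdiff_ex_derive (f : C -> C) (z : C) :
  ex_derive (K := C_AbsRing) (V := C_NormedModule) f z <-> cdiff f z.
Proof.
  split; intros [l H]; exists l; now apply is_derive_C_Cmod.
Qed.

Ltac cdiff_auto := repeat first
  [ apply cdiff_id | apply cdiff_const | assumption
  | apply cdiff_minus | apply cdiff_plus | apply cdiff_opp | apply cdiff_div | apply cdiff_mult |
    apply cdiff_inv ].

(** * Goursat's theorem *)

(** Bisection: a rectangle violating [P] has a quarter violating it, and the nested bad quarters
    shrink to a point [(p, q)], near which the local hypothesis makes them good. *)
Lemma rect_induction (P : R -> R -> R -> R -> Prop) (x1 x2 y1 y2 : R) :
  (x1 <= x2)%R -> (y1 <= y2)%R ->
  (forall a b c d, (x1 <= a <= b)%R -> (b <= x2)%R -> (y1 <= c <= d)%R -> (d <= y2)%R ->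
     P a ((a + b) / 2)%R c ((c + d) / 2)%R -> P ((a + b) / 2)%R b c ((c + d) / 2)%R ->
     P a ((a + b) / 2)%R ((c + d) / 2)%R d -> P ((a + b) / 2)%R b ((c + d) / 2)%R d ->
     P a b c d) ->
  (forall p q, (x1 <= p <= x2)%R -> (y1 <= q <= y2)%R -> exists eta, (0 < eta)%R /\
     forall a b c d, (x1 <= a <= p)%R -> (p <= b <= x2)%R -> (y1 <= c <= q)%R -> (q <= d <= y2)%R ->
       (b - a < eta)%R -> (d - c < eta)%R -> P a b c d) ->
  P x1 x2 y1 y2.
Proof.
  intros Hx Hy Hsub Hloc. apply NNPP. intros Hbad.
  pose (Q := fun s : (R * R) * (R * R) => P (fst (fst s)) (snd (fst s)) (fst (snd s)) (snd (snd s))).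
  pose (step := fun s : (R * R) * (R * R) =>
    let a := fst (fst s) in let b := snd (fst s) in let c := fst (snd s) in let d := snd (snd s) in
    let m := ((a + b) / 2)%R in let n := ((c + d) / 2)%R in
    (* Keep the first bad quarter. If the first three are good the fourth is taken untested: were it
       good too, the whole rectangle would be good. *)
    if excluded_middle_informative (Q ((a, m), (c, n))) then
    if excluded_middle_informative (Q ((m, b), (c, n))) then
    if excluded_middle_informative (Q ((a, m), (n, d))) then ((m, b), (n, d))
    else ((a, m), (n, d)) else ((m, b), (c, n)) else ((a, m), (c, n))).
  pose (st := fun n => Nat.iter n step ((x1, x2), (y1, y2))).
  pose (A := fun n => fst (fst (st n))). pose (B := fun n => snd (fst (st n))).
  pose (C' := fun n => fst (snd (st n))). pose (D := fun n => snd (snd (st n))).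
  assert (Hinv : forall n, (x1 <= A n <= B n)%R /\ (B n <= x2)%R /\ (y1 <= C' n
    <= D n)%R /\ (D n <= y2)%R /\ ~ Q (st n)).
  { induction n as [|n IH].
    - unfold A, B, C', D, st; simpl. repeat split; try lra. exact Hbad.
    - destruct IH as (H1 & H2 & H3 & H4 & H5).
      unfold A, B, C', D in *. unfold st in *. simpl.
      set (s := Nat.iter n step (x1, x2, (y1, y2))) in *.
      unfold step.
      destruct (excluded_middle_informative _) as [q1|q1]; [|simpl; repeat split; try lra; exact q1].
      destruct (excluded_middle_informative _) as [q2|q2]; [|simpl; repeat split; try lra; exact q2].
      destruct (excluded_middle_informative _) as [q3|q3]; [|simpl; repeat split; try lra; exact q3].
      simpl; repeat split; try lra. intros q4. apply H5. apply Hsub; auto; try lra. }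
  assert (Hstep : forall n, (A n <= A (S n))%R /\ (B (S n) <= B n)%R /\ (C' n
    <= C' (S n))%R /\ (D (S n) <= D n)%R
     /\ (B (S n) - A (S n) = (B n - A n) / 2)%R /\ (D (S n) - C' (S n) = (D n - C' n) / 2)%R).
  { intros n. destruct (Hinv n) as (H1 & H2 & H3 & H4 & H5).
    unfold A, B, C', D in *. unfold st in *. simpl.
    set (s := Nat.iter n step (x1, x2, (y1, y2))) in *.
    unfold step.
    repeat destruct (excluded_middle_informative _); simpl; repeat split; lra. }
  assert (HA : forall n m, (n <= m)%nat -> (A n <= A m)%R /\ (B m <= B n)%R /\ (C' n
    <= C' m)%R /\ (D m <= D n)%R).
  { intros n m H; induction H as [|m H IH]; [lra|]. destruct (Hstep m). lra. }
  assert (HAB : forall n m, (A n <= B m)%R /\ (C' n <= D m)%R).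
  { intros n m. destruct (HA n (max n m)) as (a1 & a2 & a3 & a4); [lia|].
    destruct (HA m (max n m)) as (b1 & b2 & b3 & b4); [lia|].
    destruct (Hinv (max n m)). lra. }
  assert (Hw : forall n, (B n - A n = (x2 - x1) / 2 ^ n)%R /\ (D n - C' n = (y2 - y1) / 2 ^ n)%R).
  { induction n as [|n [I1 I2]]. { unfold A, B, C', D, st; simpl; lra. }
    destruct (Hstep n) as (_ & _ & _ & _ & E1 & E2). rewrite E1, E2, I1, I2. simpl.
    assert (2 ^ n <> 0)%R by (apply pow_nonzero; lra). split; field; auto. }
  assert (Hlub : forall u v : nat -> R, (forall n m, (u n <= v m)%R) -> exists l, forall n, (u n
    <= l <= v n)%R).
  { intros u v Huv. destruct (completeness (fun x => exists n, x = u n)) as [l [Hl1 Hl2]].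
    - exists (v O). intros x [n ->]. auto.
    - exists (u O), O; auto.
    - exists l. intros n. split; [apply Hl1; eauto|]. apply Hl2. intros x [m ->]; auto. }
  destruct (Hlub A B) as [p Hp]; [intros; apply HAB|].
  destruct (Hlub C' D) as [q Hq]; [intros; apply HAB|].
  assert (Hp0 := Hp O). assert (Hq0 := Hq O).
  destruct (Hloc p q) as [eta [He Hl]]; try (unfold A, B, C', D, st in *; simpl in *; lra).
  assert (Hn : exists n, (((x2 - x1) + (y2 - y1)) / 2 ^ n < eta)%R).
  (* Dividing by [w + 1] instead of [w] covers degenerate rectangles. *)
  { set (w := ((x2 - x1) + (y2 - y1))%R).
    destruct (pow_lt_1_zero (/ 2) ltac:(rewrite Rabs_pos_eq; lra) (eta / (w + 1))) as [n Hn].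
    { apply Rdiv_lt_0_compat; unfold w; lra. }
    exists n. specialize (Hn n (le_n n)). rewrite Rabs_pos_eq in Hn by (apply pow_le; lra).
    rewrite pow_inv in Hn.
    assert (Hpos : (0 < / 2 ^ n)%R) by (apply Rinv_0_lt_compat, pow_lt; lra).
    assert (Hw1 : (0 < w + 1)%R) by (unfold w; lra).
    apply Rmult_lt_compat_r with (r := (w + 1)%R) in Hn; auto.
    unfold Rdiv in Hn. rewrite Rmult_assoc, Rinv_l, Rmult_1_r in Hn by lra. unfold Rdiv. nra. }
  destruct Hn as [n Hn]. destruct (Hinv n) as (H1 & H2 & H3 & H4 & H5).
  destruct (Hw n) as [W1 W2]. destruct (Hp n), (Hq n).
  assert (0 < / 2 ^ n)%R by (apply Rinv_0_lt_compat, pow_lt; lra).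
  unfold Rdiv in *. rewrite Rmult_plus_distr_r in Hn.
  assert (0 <= (x2 - x1) * / 2 ^ n)%R by (apply Rmult_le_pos; lra).
  assert (0 <= (y2 - y1) * / 2 ^ n)%R by (apply Rmult_le_pos; lra).
  apply H5. unfold Q. change (P (A n) (B n) (C' n) (D n)). apply Hl; lra.
Qed.

(** * Complex-valued integrals and boundary integrals of rectangles *)

Definition CInt (f : R -> C) (a b : R) : C :=
  (RInt (fun t => fst (f t)) a b, RInt (fun t => snd (f t)) a b).

Definition ex_CInt (f : R -> C) (a b : R) : Prop :=
  ex_RInt (fun t => fst (f t)) a b /\ ex_RInt (fun t => snd (f t)) a b.

Lemma CInt_Chasles f a b c : ex_CInt f a b -> ex_CInt f b c ->
  CInt f a b + CInt f b c = CInt f a c.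
Proof.
  intros [H1 H2] [H3 H4]. unfold CInt, Cplus; simpl. f_equal.
  - exact (RInt_Chasles (fun t => fst (f t)) a b c H1 H3).
  - exact (RInt_Chasles (fun t => snd (f t)) a b c H2 H4).
Qed.

Lemma CInt_minus f g a b : ex_CInt f a b -> ex_CInt g a b ->
  CInt (fun t => f t - g t) a b = CInt f a b - CInt g a b.
Proof.
  intros [H1 H2] [H3 H4]. unfold CInt, Cminus, Cplus, Copp; simpl. f_equal.
  - exact (RInt_minus (fun t => fst (f t)) (fun t => fst (g t)) a b H1 H3).
  - exact (RInt_minus (fun t => snd (f t)) (fun t => snd (g t)) a b H2 H4).
Qed.

Lemma Rabs_fst_le_Cmod (z : C) : (Rabs (fst z) <= Cmod z)%R.
Proof. apply re_le_Cmod. Qed.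
Lemma Rabs_snd_le_Cmod (z : C) : (Rabs (snd z) <= Cmod z)%R.
Proof. generalize (Rmax_Cmod z). generalize (Rmax_r (Rabs (fst z)) (Rabs (snd z))). lra. Qed.

Lemma Cmod_le_abs (z : C) : (Cmod z <= Rabs (fst z) + Rabs (snd z))%R.
Proof.
  destruct z as [x y].
  replace (Cmod (x, y)) with (Cmod (RtoC x + Ci * RtoC y)).
  2: { f_equal. unfold Cplus, Cmult, Ci, RtoC; simpl. f_equal; ring. }
  eapply Rle_trans; [apply Cmod_triangle|]. rewrite Cmod_mult, Cmod_Ci, !Cmod_R, Rmult_1_l.
  apply Rle_refl.
Qed.

(** The factor 2 comes from bounding the real and the imaginary part separately. *)
Lemma CInt_bound f a b M : (a <= b)%R -> ex_CInt f a b ->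
  (forall t, (a <= t <= b)%R -> (Cmod (f t) <= M)%R) -> (Cmod (CInt f a b) <= 2 * (b - a) * M)%R.
Proof.
  intros Hab [H1 H2] HM. eapply Rle_trans; [apply Cmod_le_abs|]. unfold CInt; simpl.
  assert (HR : (Rabs (RInt (fun t => fst (f t)) a b) <= (b - a) * M)%R).
  { apply (norm_RInt_le_const (fun t => fst (f t)) a b); auto.
    - intros x Hx. eapply Rle_trans; [apply Rabs_fst_le_Cmod|]. auto.
    - apply (RInt_correct (V := R_CompleteNormedModule)); auto. }
  assert (HI : (Rabs (RInt (fun t => snd (f t)) a b) <= (b - a) * M)%R).
  { apply (norm_RInt_le_const (fun t => snd (f t)) a b); auto.
    - intros x Hx. eapply Rle_trans; [apply Rabs_snd_le_Cmod|]. auto.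
    - apply (RInt_correct (V := R_CompleteNormedModule)); auto. }
  lra.
Qed.

Lemma ccont_path_continuous (k : C -> C) (g : R -> C) (x : R) : ccont k (g x) ->
  (forall t, (Cmod (g t - g x) <= Rabs (t - x))%R) ->
  continuous (fun t => fst (k (g t))) x /\ continuous (fun t => snd (k (g t))) x.
Proof.
  intros Hk Hg.
  split; apply (filterlim_locally (U := R_UniformSpace)); intros e;
    destruct (Hk e (cond_pos e)) as [d [Hd H]]; exists (mkposreal d Hd); intros y Hy;
    assert (H' : (Cmod (k (g y) - k (g x)) < e)%R) by
      (apply H; eapply Rle_lt_trans; [apply Hg | exact Hy]).
  - eapply Rle_lt_trans; [apply (Rabs_fst_le_Cmod (k (g y) - k (g x))) | exact H'].
  - eapply Rle_lt_trans; [apply (Rabs_snd_le_Cmod (k (g y) - k (g x))) | exact H'].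
Qed.

Lemma ex_CInt_path (k : C -> C) (g : R -> C) a b :
  (forall t, (Rmin a b <= t <= Rmax a b)%R -> ccont k (g t)) ->
  (forall s t, (Cmod (g t - g s) <= Rabs (t - s))%R) ->
  ex_CInt (fun t => k (g t)) a b.
Proof.
  intros Hk Hg.
  split; apply (ex_RInt_continuous (V := R_CompleteNormedModule)); intros t Ht;
  apply (ccont_path_continuous k g t); auto.
Qed.

Lemma Cmod_horizontal (y s t : R) : (Cmod (((t, y) : C) - (s, y)) <= Rabs (t - s))%R.
Proof.
  eapply Rle_trans; [apply Cmod_le_abs|]. simpl.
  replace (y + - y)%R with 0%R by ring. rewrite Rabs_R0. unfold Rminus. lra.
Qed.
Lemma Cmod_vertical (x s t : R) : (Cmod (((x, t) : C) - (x, s)) <= Rabs (t - s))%R.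
Proof.
  eapply Rle_trans; [apply Cmod_le_abs|]. simpl.
  replace (x + - x)%R with 0%R by ring. rewrite Rabs_R0. unfold Rminus. lra.
Qed.

Lemma ex_CInt_hor (k : C -> C) y a b : (a <= b)%R ->
  (forall t, (a <= t <= b)%R -> ccont k (t, y)) -> ex_CInt (fun t => k (t, y)) a b.
Proof.
  intros Hab H. apply (ex_CInt_path k (fun t => (t, y))).
  - rewrite Rmin_left, Rmax_right by auto. auto.
  - intros; apply Cmod_horizontal.
Qed.
Lemma ex_CInt_ver (k : C -> C) x a b : (a <= b)%R ->
  (forall t, (a <= t <= b)%R -> ccont k (x, t)) -> ex_CInt (fun t => k (x, t)) a b.
Proof.
  intros Hab H. apply (ex_CInt_path k (fun t => (x, t))).
  - rewrite Rmin_left, Rmax_right by auto. auto.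
  - intros; apply Cmod_vertical.
Qed.

Definition rect_int (k : C -> C) (x1 x2 y1 y2 : R) : C :=
  CInt (fun x => k (x, y1)) x1 x2 + Ci * CInt (fun y => k (x2, y)) y1 y2
  - CInt (fun x => k (x, y2)) x1 x2 - Ci * CInt (fun y => k (x1, y)) y1 y2.

Definition in_rect (x1 x2 y1 y2 : R) (z : C) : Prop :=
  (x1 <= fst z <= x2)%R /\ (y1 <= snd z <= y2)%R.

Lemma rect_int_quarters k a m b c n d :
  (a <= m <= b)%R -> (c <= n <= d)%R ->
  (forall z, in_rect a b c d z -> ccont k z) ->
  rect_int k a b c d = rect_int k a m c n + rect_int k m b c n + rect_int k a m n d + rect_int k m b n d.
Proof.
  intros H1 H2 Hk. unfold rect_int.
  assert (Hh : forall y u v, (c <= y <= d)%R -> (a <= u <= v)%R -> (v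
    <= b)%R -> ex_CInt (fun x => k (x, y)) u v).
  { intros y u v Hy Hu Hv. apply ex_CInt_hor; [lra|]. intros t Ht. apply Hk. split; simpl; lra. }
  assert (Hv : forall x u v, (a <= x <= b)%R -> (c <= u <= v)%R -> (v
    <= d)%R -> ex_CInt (fun y => k (x, y)) u v).
  { intros y u v Hy Hu Hv. apply ex_CInt_ver; [lra|]. intros t Ht. apply Hk. split; simpl; lra. }
  rewrite <- (CInt_Chasles (fun x => k (x, c)) a m b) by (apply Hh; lra).
  rewrite <- (CInt_Chasles (fun x => k (x, d)) a m b) by (apply Hh; lra).
  rewrite <- (CInt_Chasles (fun x => k (b, x)) c n d) by (apply Hv; lra).
  rewrite <- (CInt_Chasles (fun x => k (a, x)) c n d) by (apply Hv; lra).
  ring.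
Qed.

Lemma RInt_affine (u v a b : R) : RInt (fun t => u + v * t)%R a b = (u * (b - a) + v * (b * b - a * a) / 2)%R.
Proof.
  apply (is_RInt_unique (V := R_CompleteNormedModule)).
  replace (u * (b - a) + v * (b * b - a * a) / 2)%R with
    (minus (u * b + v * b * b / 2) (u * a + v * a * a / 2))%R.
  2: { unfold minus, plus, opp; simpl. field. }
  apply (is_RInt_derive (V := R_CompleteNormedModule) (fun t => u * t + v * t * t / 2)%R).
  - intros x _. auto_derive; auto. field.
  - intros x _. apply (ex_derive_continuous (K := R_AbsRing) (V := R_NormedModule)).
    auto_derive; auto.
Qed.

Lemma RInt_affine_ext (f : R -> R) (u v a b : R) : (forall t, f t = u + v * t)%R ->
   RInt f a b = (u * (b - a) + v * (b * b - a * a) / 2)%R.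
Proof. intros H. rewrite <- RInt_affine. apply (RInt_ext (V := R_CompleteNormedModule)).
intros; apply H. Qed.

(** An affine function has a polynomial primitive; here the four sides are simply computed. *)
Lemma rect_int_affine (c l : C) x1 x2 y1 y2 : rect_int (fun z => c + l * z) x1 x2 y1 y2 = 0.
Proof.
  destruct c as [c1 c2], l as [l1 l2]. unfold rect_int, CInt. simpl.
  rewrite (RInt_affine_ext (fun t => c1 + (l1 * t - l2 * y1))%R (c1 - l2 * y1) l1 x1 x2) by (intros; ring).
  rewrite (RInt_affine_ext (fun t => c2 + (l1 * y1 + l2 * t))%R (c2 + l1 * y1) l2 x1 x2) by (intros; ring).
  rewrite (RInt_affine_ext (fun t => c1 + (l1 * t - l2 * y2))%R (c1 - l2 * y2) l1 x1 x2) by (intros; ring).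
  rewrite (RInt_affine_ext (fun t => c2 + (l1 * y2 + l2 * t))%R (c2 + l1 * y2) l2 x1 x2) by (intros; ring).
  rewrite (RInt_affine_ext (fun t => c1 + (l1 * x1 - l2 * t))%R (c1 + l1 * x1) (- l2) y1 y2)
    by (intros; ring).
  rewrite (RInt_affine_ext (fun t => c2 + (l1 * t + l2 * x1))%R (c2 + l2 * x1) l1 y1 y2) by (intros; ring).
  rewrite (RInt_affine_ext (fun t => c1 + (l1 * x2 - l2 * t))%R (c1 + l1 * x2) (- l2) y1 y2)
    by (intros; ring).
  rewrite (RInt_affine_ext (fun t => c2 + (l1 * t + l2 * x2))%R (c2 + l2 * x2) l1 y1 y2) by (intros; ring).
  unfold Cminus, Cplus, Cmult, Copp, Ci, RtoC; simpl. f_equal; field.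
Qed.

Lemma rect_int_bound k x1 x2 y1 y2 M : (x1 <= x2)%R -> (y1 <= y2)%R ->
  (forall z, in_rect x1 x2 y1 y2 z -> ccont k z) ->
  (forall z, in_rect x1 x2 y1 y2 z -> (Cmod (k z) <= M)%R) ->
  (Cmod (rect_int k x1 x2 y1 y2) <= 4 * ((x2 - x1) + (y2 - y1)) * M)%R.
Proof.
  intros Hx Hy Hk HM. unfold rect_int.
  assert (Hh : forall y, (y1 <= y <= y2)%R -> (Cmod (CInt (fun x => k (x, y)) x1 x2) <= 2 * (x2 - x1) * M)%R).
  { intros y Hy'. apply CInt_bound; auto.
    - apply ex_CInt_hor; [lra|]. intros t Ht. apply Hk. split; simpl; lra.
    - intros t Ht. apply HM. split; simpl; lra. }
  assert (Hv : forall x, (x1 <= x <= x2)%R -> (Cmod (Ci * CInt (fun y => k (x, y)) y1 y2)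
    <= 2 * (y2 - y1) * M)%R).
  { intros y Hy'. rewrite Cmod_mult, Cmod_Ci, Rmult_1_l. apply CInt_bound; auto.
    - apply ex_CInt_ver; [lra|]. intros t Ht. apply Hk. split; simpl; lra.
    - intros t Ht. apply HM. split; simpl; lra. }
  unfold Cminus.
  eapply Rle_trans; [apply Cmod_triangle|]. rewrite Cmod_opp.
  eapply Rle_trans; [apply Rplus_le_compat_r, Cmod_triangle|]. rewrite Cmod_opp.
  eapply Rle_trans; [apply Rplus_le_compat_r, Rplus_le_compat_r, Cmod_triangle|].
  generalize (Hh y1 ltac:(lra)) (Hh y2 ltac:(lra)) (Hv x1 ltac:(lra)) (Hv x2 ltac:(lra)). lra.
Qed.

Lemma rect_int_minus k g x1 x2 y1 y2 : (x1 <= x2)%R -> (y1 <= y2)%R ->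
  (forall z, in_rect x1 x2 y1 y2 z -> ccont k z) ->
  (forall z, in_rect x1 x2 y1 y2 z -> ccont g z) ->
  rect_int (fun z => k z - g z) x1 x2 y1 y2 = rect_int k x1 x2 y1 y2 - rect_int g x1 x2 y1 y2.
Proof.
  intros Hx Hy Hk Hg.
  assert (Hh : forall f, (forall z, in_rect x1 x2 y1 y2 z -> ccont f z) -> forall y, (y1 <= y
    <= y2)%R -> ex_CInt (fun x => f (x, y)) x1 x2).
  { intros f Hf y Hy'. apply ex_CInt_hor; [lra|]. intros t Ht. apply Hf. split; simpl; lra. }
  assert (Hv : forall f, (forall z, in_rect x1 x2 y1 y2 z -> ccont f z) -> forall y, (x1 <= y
    <= x2)%R -> ex_CInt (fun x => f (y, x)) y1 y2).
  { intros f Hf y Hy'. apply ex_CInt_ver; [lra|]. intros t Ht. apply Hf. split; simpl; lra. }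
  unfold rect_int.
  rewrite (CInt_minus (fun x => k (x, y1)) (fun x => g (x, y1))) by (apply Hh; auto; lra).
  rewrite (CInt_minus (fun x => k (x, y2)) (fun x => g (x, y2))) by (apply Hh; auto; lra).
  rewrite (CInt_minus (fun x => k (x1, x)) (fun x => g (x1, x))) by (apply Hv; auto; lra).
  rewrite (CInt_minus (fun x => k (x2, x)) (fun x => g (x2, x))) by (apply Hv; auto; lra).
  ring.
Qed.

(** The bound [4 * e * (side sum)^2] is stable under quartering, because four quarters with half the
    side sum give the same total; so only small rectangles about a point matter. There [k] differs
    from its affine part, whose integral is 0, by at most [e] times the side sum. *)
Lemma Goursat k x1 x2 y1 y2 : (x1 <= x2)%R -> (y1 <= y2)%R ->
  (forall z, in_rect x1 x2 y1 y2 z -> cdiff k z) -> rect_int k x1 x2 y1 y2 = 0.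
Proof.
  intros Hx Hy Hk. apply Cmod_eq_0. apply Rle_antisym; [|apply Cmod_ge_0].
  apply le_epsilon. intros e0 He0. rewrite Rplus_0_l.
  set (w := ((x2 - x1) + (y2 - y1))%R).
  (* Makes [4 * e * w^2 <= e0]; the [+ 1] covers [w = 0]. *)
  set (e := (e0 / (4 * (w * w + 1)))%R).
  assert (He : (0 < e)%R) by (apply Rdiv_lt_0_compat; nra).
  assert (Hc : forall z, in_rect x1 x2 y1 y2 z -> ccont k z) by (intros; now apply cdiff_ccont, Hk).
  apply Rle_trans with (4 * e * (w * w))%R.
  2: { unfold e. apply Rmult_le_reg_r with (w * w + 1)%R; [nra|].
       replace (4 * (e0 / (4 * (w * w + 1))) * (w * w) * (w * w + 1))%R with (e0 * (w * w))%R by (field; nra).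
       nra. }
  unfold w.
  apply (rect_induction (fun a b c d => (Cmod (rect_int k a b c d)
    <= 4 * e * (((b - a) + (d - c)) * ((b - a) + (d - c))))%R)); auto.
  - intros a b c d H1 H2 H3 H4 Q1 Q2 Q3 Q4.
    rewrite (rect_int_quarters k a ((a + b) / 2) b c ((c + d) / 2) d); try lra.
    2: { intros z [? ?]; apply Hc; split; lra. }
    eapply Rle_trans; [apply Cmod_triangle|].
    eapply Rle_trans; [apply Rplus_le_compat_r, Cmod_triangle|].
    eapply Rle_trans; [apply Rplus_le_compat_r, Rplus_le_compat_r, Cmod_triangle|].
    eapply Rle_trans; [apply Rplus_le_compat; [apply Rplus_le_compat; [apply Rplus_le_compat;
      [apply Q1|apply Q2]|apply Q3]|apply Q4]|].
    apply Req_le. field.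
  - intros p q Hp Hq. destruct (Hk (p, q)) as [l Hl]; [split; simpl; lra|].
    destruct (Hl e He) as [dl [Hd Hl']].
    exists (dl / 2)%R. split; [lra|]. intros a b c d Ha Hb Hc' Hd' Hw1 Hw2.
    set (g := fun z : C => (k (p, q) - l * (p, q)) + l * z).
    assert (Hg : forall z, cdiff g z) by (intros z; unfold g; cdiff_auto).
    replace (rect_int k a b c d) with (rect_int (fun z => k z - g z) a b c d).
    2: { rewrite rect_int_minus; try lra.
         - unfold g at 1. rewrite rect_int_affine. ring.
         - intros z [? ?]; apply Hc; split; lra.
         - intros z _; now apply cdiff_ccont. }
    replace (4 * e * (((b - a) + (d - c)) * ((b - a) + (d - c))))%R with
      (4 * ((b - a) + (d - c)) * (e * ((b - a) + (d - c))))%R by ring.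
    apply rect_int_bound; try lra.
    + intros z [? ?]. apply cdiff_ccont, cdiff_minus; auto. apply Hk; split; lra.
    + intros z [? ?].
      assert (Hz : (Cmod (z - (p, q)) <= (b - a) + (d - c))%R).
      { eapply Rle_trans; [apply Cmod_le_abs|]. simpl.
        apply Rplus_le_compat; apply Rabs_le; lra. }
      replace (k z - g z) with (k z - k (p, q) - l * (z - (p, q))) by (unfold g; ring).
      eapply Rle_trans; [apply Hl'; lra|]. apply Rmult_le_compat_l; lra.
Qed.

(** * Mean values over circles *)

Lemma Cminus_0_r (z : C) : z - 0 = z.
Proof. ring. Qed.

Definition cexp (z : C) : C := (exp (fst z) * cos (snd z), exp (fst z) * sin (snd z))%R.

Lemma cexp_plus z w : cexp (z + w) = cexp z * cexp w.
Proof.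
  destruct z as [a b], w as [c d]. unfold cexp, Cplus, Cmult; simpl.
  rewrite exp_plus, cos_plus, sin_plus. f_equal; ring.
Qed.

Lemma Cmod_cexp z : Cmod (cexp z) = exp (fst z).
Proof.
  unfold Cmod, cexp; simpl.
  replace (_ + _)%R with ((exp (fst z)) ^ 2 * (Rsqr (sin (snd z)) + Rsqr (cos (snd z))))%R
    by (unfold Rsqr; ring).
  rewrite sin2_cos2, Rmult_1_r. apply sqrt_pow2. left; apply exp_pos.
Qed.

Lemma is_derive_eps (f : R -> R) (x l : R) : is_derive f x l ->
  forall e, (0 < e)%R -> exists d, (0 < d)%R /\ forall h, (Rabs h < d)%R ->
    (Rabs (f (x + h) - f x - l * h) <= e * Rabs h)%R.
Proof.
  intros H e He. apply is_derive_Reals in H. destruct (H e He) as [d Hd].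
  exists d. split; [apply cond_pos|]. intros h Hh.
  destruct (Req_dec h 0) as [->|Hh0].
  - rewrite Rplus_0_r, Rabs_R0. replace (f x - f x - l * 0)%R with 0%R by ring. rewrite Rabs_R0.
    lra.
  - specialize (Hd h Hh0 Hh).
    replace (f (x + h) - f x - l * h)%R with (((f (x + h) - f x) / h - l) * h)%R by (field; auto).
    rewrite Rabs_mult. apply Rmult_le_compat_r; [apply Rabs_pos | lra].
Qed.

(** Only the real derivatives of [exp], [cos] and [sin] at 0 enter; the functional equation carries
    the result to all other points. *)
Lemma has_cderiv_cexp_0 : has_cderiv cexp 0 1.
Proof.
  (* The estimates below add up to [8 * e * v]: three parts from the real component, five from the
     imaginary one. *)
  intros e' He'. set (e := (Rmin 1 (e' / 8))%R).
  assert (He : (0 < e)%R) by (apply Rmin_pos; lra).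
  assert (He1 : (e <= 1)%R) by apply Rmin_l. assert (He2 : (e <= e' / 8)%R) by apply Rmin_r.
  clearbody e.
  pose proof (derivable_pt_lim_exp 0) as D1. rewrite exp_0 in D1. apply is_derive_Reals in D1.
  pose proof (derivable_pt_lim_cos 0) as D2. rewrite sin_0, Ropp_0 in D2.
  apply is_derive_Reals in D2.
  pose proof (derivable_pt_lim_sin 0) as D3. rewrite cos_0 in D3. apply is_derive_Reals in D3.
  destruct (is_derive_eps exp 0 1 D1 e He) as [d1 [Hd1 E1]].
  destruct (is_derive_eps cos 0 0 D2 e He) as [d2 [Hd2 E2]].
  destruct (is_derive_eps sin 0 1 D3 e He) as [d3 [Hd3 E3]].
  exists (Rmin (Rmin d1 d2) (Rmin d3 e)). split; [repeat apply Rmin_pos; auto|].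
  intros [x y] Hv.
  rewrite Cminus_0_r in Hv |- *.
  assert (Hx : (Rabs x <= Cmod (x, y))%R) by apply (Rabs_fst_le_Cmod (x, y)).
  assert (Hy : (Rabs y <= Cmod (x, y))%R) by apply (Rabs_snd_le_Cmod (x, y)).
  set (v := Cmod (x, y)) in *.
  assert (Hv1 : (v < d1)%R). { lt_Rmin Hv. }
  assert (Hv2 : (v < d2)%R). { lt_Rmin Hv. }
  assert (Hv3 : (v < d3)%R). { lt_Rmin Hv. }
  assert (Hv4 : (v < e)%R). { lt_Rmin Hv. }
  specialize (E1 x ltac:(lra)). specialize (E2 y ltac:(lra)). specialize (E3 y ltac:(lra)).
  rewrite Rplus_0_l, exp_0 in E1. rewrite Rplus_0_l, cos_0 in E2. rewrite Rplus_0_l, sin_0 in E3.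
  rewrite Rmult_1_l in E1. rewrite Rmult_0_l, Rminus_0_r in E2. rewrite Rmult_1_l, Rminus_0_r in E3.
  eapply Rle_trans; [apply Cmod_le_abs|].
  unfold cexp; simpl. rewrite exp_0, cos_0, sin_0.
  pose proof (Rabs_pos x) as Px. pose proof (Rabs_pos y) as Py.
  match goal with |- (Rabs ?a + Rabs ?b <= _)%R =>
    replace a with ((exp x - 1 - x) * cos y + (1 + x) * (cos y - 1))%R by ring;
    replace b with ((exp x - 1) * sin y + (sin y - y))%R by ring end.
  assert (F1 : (Rabs ((exp x - 1 - x) * cos y + (1 + x) * (cos y - 1)) <= e * v + 2 * (e * v))%R).
  { eapply Rle_trans; [apply Rabs_triang|]. rewrite !Rabs_mult. apply Rplus_le_compat.
    - rewrite <- (Rmult_1_r (e * v)). apply Rmult_le_compat; try apply Rabs_pos; [nra|].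
      apply Rabs_le, COS_bound.
    - apply Rmult_le_compat; try apply Rabs_pos; [|nra].
      eapply Rle_trans; [apply Rabs_triang|]. rewrite Rabs_R1. lra. }
  assert (F2 : (Rabs ((exp x - 1) * sin y + (sin y - y)) <= 4 * (e * v) + e * v)%R).
  { eapply Rle_trans; [apply Rabs_triang|]. rewrite Rabs_mult. apply Rplus_le_compat; [|nra].
    assert (G1 : (Rabs (exp x - 1) <= 2 * e)%R).
    { replace (exp x - 1)%R with ((exp x - 1 - x) + x)%R by ring.
      eapply Rle_trans; [apply Rabs_triang|]. nra. }
    assert (G2 : (Rabs (sin y) <= 2 * v)%R).
    { replace (sin y)%R with ((sin y - y) + y)%R by ring. eapply Rle_trans; [apply Rabs_triang|].
      nra. }
    replace (4 * (e * v))%R with ((2 * e) * (2 * v))%R by ring.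
    apply Rmult_le_compat; auto; apply Rabs_pos. }
  nra.
Qed.

Lemma cdiff_cexp z : cdiff cexp z.
Proof.
  apply (cdiff_ext_locally (fun w => cexp z * cexp (w - z)) _ z 1 Rlt_0_1).
  - intros y _. rewrite <- cexp_plus. f_equal. ring.
  - apply cdiff_mult; [apply cdiff_const|]. apply (cdiff_comp cexp (fun w => w - z)); [|cdiff_auto].
    exists 1. rewrite Cminus_diag. apply has_cderiv_cexp_0.
Qed.

(** [x] is the logarithm of the radius, and the integral is not divided by [2 * PI]. *)
Definition circle_mean (u : C -> C) (x : R) : R :=
  RInt (fun y => fst (u (cexp (x, y)))) 0 (2 * PI).

Lemma two_PI_pos : (0 < 2 * PI)%R.
Proof. generalize PI_RGT_0; lra. Qed.

(** Goursat for [u] composed with [cexp] on [[x1, x2] x [0, 2 PI]]: the horizontal sides cancel by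
    periodicity, and the factor [Ci] on the vertical sides puts the real part of [u] into the
    imaginary part of the identity. *)
Lemma circle_mean_const u x1 x2 : (x1 <= x2)%R ->
  (forall x y, (x1 <= x <= x2)%R -> cdiff u (cexp (x, y))) -> circle_mean u x1 = circle_mean u x2.
Proof.
  intros Hx Hu.
  assert (HG : rect_int (fun z => u (cexp z)) x1 x2 0 (2 * PI) = 0).
  { apply Goursat; auto. generalize two_PI_pos; lra.
    intros [x y] [? ?]; simpl in *. apply (cdiff_comp u cexp); [|apply cdiff_cexp]. auto. }
  unfold rect_int in HG.
  replace (CInt (fun x => u (cexp (x, 2 * PI)%R)) x1 x2) with (CInt (fun x => u (cexp (x, 0%R))) x1 x2) in HG.
  2: { assert (E : forall x, cexp (x, (2 * PI)%R) = cexp (x, 0%R)).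
       { intros x. unfold cexp; simpl. rewrite cos_2PI, sin_2PI, cos_0, sin_0. reflexivity. }
       unfold CInt. f_equal; apply (RInt_ext (V := R_CompleteNormedModule)); intros; now rewrite E.
       }
  apply (f_equal snd) in HG. simpl in HG.
  change (RInt (fun t => fst (u (cexp (x1, t)))) 0 (2 * PI)) with (circle_mean u x1) in HG.
  change (RInt (fun t => fst (u (cexp (x2, t)))) 0 (2 * PI)) with (circle_mean u x2) in HG.
  lra.
Qed.

Lemma ex_circle_mean u x : (forall y, ccont u (cexp (x, y))) ->
  ex_RInt (fun y => fst (u (cexp (x, y)))) 0 (2 * PI).
Proof.
  intros Hu. destruct (ex_CInt_ver (fun z => u (cexp z)) x 0 (2 * PI)) as [H _]; auto.
  - generalize two_PI_pos; lra.
  - intros t _ e He. destruct (Hu t e He) as [d [Hd H]].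
    destruct (cdiff_ccont _ _ (cdiff_cexp (x, t)) d Hd) as [d' [Hd' H']].
    exists d'. split; auto.
Qed.

Lemma circle_mean_near u x a e : (forall y, ccont u (cexp (x, y))) ->
  (forall y, (Rabs (fst (u (cexp (x, y))) - a y) <= e)%R) -> ex_RInt a 0 (2 * PI) ->
  (Rabs (circle_mean u x - RInt a 0 (2 * PI)) <= 2 * PI * e)%R.
Proof.
  intros Hu H Ha. unfold circle_mean.
  pose proof (ex_circle_mean u x Hu) as Hex.
  assert (E := RInt_minus (V := R_CompleteNormedModule) (fun y => fst (u (cexp (x, y)))) a 0 (2 * PI) Hex Ha).
  change (minus (RInt (fun y => fst (u (cexp (x, y)))) 0 (2 * PI)) (RInt a 0 (2 * PI))) with
    (RInt (fun y => fst (u (cexp (x, y)))) 0 (2 * PI) - RInt a 0 (2 * PI))%R in E.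
  rewrite <- E. replace (2 * PI * e)%R with ((2 * PI - 0) * e)%R by ring.
  apply (norm_RInt_le_const (V := R_NormedModule) (fun y => minus (fst (u (cexp (x, y)))) (a y)) 0 (2 * PI)).
  - generalize two_PI_pos; lra.
  - intros y _. apply H.
  - apply (RInt_correct (V := R_CompleteNormedModule)).
    now apply (ex_RInt_minus (V := R_NormedModule)).
Qed.

(** The integrands are uniformly close because the angle ranges over a compact interval; [d < - x0]
    keeps the neighbouring circles inside the disk. *)
Lemma circle_mean_continuous u x0 : (x0 < 0)%R -> (forall z, in_disk z -> ccont u z) ->
  forall e, (0 < e)%R -> exists d, (0 < d)%R /\ (d < - x0)%R /\
    forall x, (Rabs (x - x0) < d)%R -> (Rabs (circle_mean u x - circle_mean u x0) <= e)%R.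
Proof.
  intros Hx0 Hu e He.
  assert (Hin : forall x y, (x < 0)%R -> in_disk (cexp (x, y))).
  { intros x y H. unfold in_disk. rewrite Cmod_cexp. simpl. rewrite <- exp_0.
    now apply exp_increasing. }
  assert (Hp := two_PI_pos).
  destruct (uniform_continuity_2d_1d' (fun x y => fst (u (cexp (x, y)))) 0 (2 * PI) x0)
    with (eps := mkposreal (e / (2 * PI)) ltac:(apply Rdiv_lt_0_compat; lra)) as [d Hd].
  { intros y Hy eps. destruct (Hu (cexp (x0, y)) (Hin _ _ Hx0) eps (cond_pos eps)) as [d [Hd H]].
    destruct (cdiff_ccont _ _ (cdiff_cexp (x0, y)) d Hd) as [d' [Hd' H']].
    assert (Hd2 : (0 < d' / 2)%R) by lra.
    exists (mkposreal _ Hd2). simpl. intros a b Ha Hb.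
    eapply Rle_lt_trans; [apply (Rabs_fst_le_Cmod (u (cexp (a, b)) - u (cexp (x0, y))))|].
    apply H, H'. eapply Rle_lt_trans; [apply Cmod_le_abs|]. simpl. unfold Rminus in *. lra. }
  simpl in Hd. exists (Rmin d (- x0 / 2)). split; [|split].
  - apply Rmin_pos; [apply cond_pos|lra].
  - eapply Rle_lt_trans; [apply Rmin_r|]. lra.
  - intros x Hx.
    assert (H1 : (Rabs (x - x0) < d)%R) by (lt_Rmin Hx).
    assert (H2 : (Rabs (x - x0) < - x0 / 2)%R) by (lt_Rmin Hx).
    apply Rabs_def2 in H1. apply Rabs_def2 in H2.
    assert (Hc1 : forall y, ccont u (cexp (x, y))) by (intros y; apply Hu, Hin; lra).
    assert (Hc0 : forall y, ccont u (cexp (x0, y))) by (intros y; apply Hu, Hin; lra).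
    pose proof (ex_circle_mean u x Hc1) as X1. pose proof (ex_circle_mean u x0 Hc0) as X0.
    assert (E := RInt_minus (V := R_CompleteNormedModule) _ _ 0 (2 * PI) X1 X0).
    change (circle_mean u x - circle_mean u x0)%R
      with (minus (RInt (fun y => fst (u (cexp (x, y)))) 0 (2 * PI))
        (RInt (fun y => fst (u (cexp (x0, y)))) 0 (2 * PI))).
    rewrite <- E. replace e with ((2 * PI - 0) * (e / (2 * PI)))%R by (field; lra).
    apply (norm_RInt_le_const (V := R_NormedModule) (fun y => minus (fst (u (cexp (x, y))))
      (fst (u (cexp (x0, y))))) 0 (2 * PI)).
    + lra.
    + intros y Hy. left. apply (Hd y x0 y x); try lra. 
      replace (y - y)%R with 0%R by ring. rewrite Rabs_R0. lra.
    + apply (RInt_correct (V := R_CompleteNormedModule)).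
      now apply (ex_RInt_minus (V := R_NormedModule)).
Qed.

(** A maximum principle tolerating one point [b] where [u] is only continuous. The means are
    constant for radii below and above [|b|] and cannot jump at [|b|]; hence the value at 0, their
    limit over small circles, is bounded by a mean near the boundary. *)
Lemma Re_bound_mean (u : C -> C) (b : C) (M rho : R) :
  b <> 0 -> in_disk b ->
  (forall z, in_disk z -> ccont u z) ->
  (forall z, in_disk z -> z <> b -> cdiff u z) ->
  (rho < 1)%R -> (forall z, (rho < Cmod z < 1)%R -> (fst (u z) <= M)%R) ->
  (fst (u 0) <= M)%R.
Proof.
  intros Hb0 Hb Hc Hd Hrho HM.
  assert (Hin : forall x y, (x < 0)%R -> in_disk (cexp (x, y))).
  { intros x y H. unfold in_disk. rewrite Cmod_cexp. simpl. rewrite <- exp_0.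
    now apply exp_increasing. }
  assert (Hp := two_PI_pos).
  apply Cmod_gt_0 in Hb0. set (be := ln (Cmod b)).
  assert (Hbe : (be < 0)%R) by (unfold be; rewrite <- ln_1; apply ln_increasing; auto).
  assert (Hbe' : exp be = Cmod b) by (apply exp_ln; auto).
  assert (Hne : forall x y, x <> be -> cexp (x, y) <> b).
  { intros x y H E. apply H. apply (f_equal Cmod) in E. rewrite Cmod_cexp in E. simpl in E.
    rewrite <- Hbe' in E. now apply exp_inv. }
  assert (HC : forall x, (x < 0)%R -> circle_mean u x = circle_mean u be).
  { intros x Hx. apply Rminus_diag_uniq.
    destruct (Req_dec (circle_mean u x - circle_mean u be) 0) as [|Hn]; auto. exfalso.
    apply Rabs_pos_lt in Hn. set (e := Rabs (circle_mean u x - circle_mean u be)) in *.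
    destruct (circle_mean_continuous u be Hbe Hc (e / 2)) as [d [Hd0 [Hd1 Hd2]]]; [lra|].
    (* From [x] one moves through regular radii, on the same side of [be], to some [x'] within [d]
       of it. The means at [x] and [x'] agree, and the latter is within [e / 2] of the mean at
       [be]. *)
    destruct (Rtotal_order x be) as [H|[H|H]].
    - set (x' := (Rmax x (be - d / 2))%R).
      assert (E : circle_mean u x = circle_mean u x').
      { apply circle_mean_const; [apply Rmax_l|]. intros s y Hs. apply Hd.
        - apply Hin. unfold x' in Hs.
          assert (Rmax x (be - d / 2) < be)%R by (apply Rmax_lub_lt; lra). lra.
        - apply Hne. unfold x' in Hs.
          assert (Rmax x (be - d / 2) < be)%R by (apply Rmax_lub_lt; lra). lra. }
      assert (Hx' : (Rabs (x' - be) < d)%R).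
      { unfold x'. assert (Rmax x (be - d / 2) < be)%R by (apply Rmax_lub_lt; lra).
        generalize (Rmax_r x (be - d / 2)). intros. apply Rabs_def1; lra. }
      specialize (Hd2 x' Hx'). rewrite <- E in Hd2. fold e in Hd2. lra.
    - subst x. unfold e in Hn. rewrite Rminus_diag, Rabs_R0 in Hn. lra.
    - set (x' := (Rmin x (be + d / 2))%R).
      assert (E : circle_mean u x' = circle_mean u x).
      { apply circle_mean_const; [apply Rmin_l|]. intros s y Hs. apply Hd.
        - apply Hin. lra.
        - apply Hne. unfold x' in Hs.
          assert (be < Rmin x (be + d / 2))%R by (apply Rmin_glb_lt; lra). lra. }
      assert (Hx' : (Rabs (x' - be) < d)%R).
      { unfold x'. assert (be < Rmin x (be + d / 2))%R by (apply Rmin_glb_lt; lra).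
        generalize (Rmin_r x (be + d / 2)). intros. apply Rabs_def1; lra. }
      specialize (Hd2 x' Hx'). rewrite E in Hd2. fold e in Hd2. lra. }
  assert (HRc : forall a, RInt (fun _ => a) 0 (2 * PI) = (2 * PI * a)%R).
  { intros a. rewrite RInt_const. unfold scal; simpl. unfold mult; simpl. ring. }
  assert (Hexc : forall a, ex_RInt (fun _ => a) 0 (2 * PI)) by (intros;
    apply (ex_RInt_const (V := R_NormedModule))).
  assert (Hinside : (circle_mean u be = 2 * PI * fst (u 0)%C)%R).
  { apply Rminus_diag_uniq.
    destruct (Req_dec (circle_mean u be - 2 * PI * fst (u 0)) 0) as [|Hn]; auto. exfalso.
    apply Rabs_pos_lt in Hn. set (e := Rabs (circle_mean u be - 2 * PI * fst (u 0))) in *.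
    destruct (Hc 0 ltac:(unfold in_disk; rewrite Cmod_0; lra) (e / (4 * PI))%R) as [d [Hd0 Hd1]].
    { apply Rdiv_lt_0_compat; lra. }
    (* A radius strictly below both [d] and [1 / 2]. *)
    set (x := (ln (Rmin d (1 / 2)) - 1)%R).
    assert (Hm : (0 < Rmin d (1 / 2))%R) by (apply Rmin_pos; lra).
    assert (Hx : (x < 0)%R).
    { unfold x. assert (ln (Rmin d (1 / 2)) < 0)%R; [|lra]. rewrite <- ln_1.
      apply ln_increasing; auto.
      eapply Rle_lt_trans; [apply Rmin_r|lra]. }
    assert (Hxd : (exp x < d)%R).
    { apply Rlt_le_trans with (Rmin d (1 / 2)); [|apply Rmin_l].
      rewrite <- (exp_ln (Rmin d (1 / 2))) by auto. apply exp_increasing. unfold x; lra. }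
    assert (HH := circle_mean_near u x (fun _ => fst (u 0)) (e / (4 * PI))).
    rewrite HRc, (HC x Hx) in HH. fold e in HH.
    assert (e <= 2 * PI * (e / (4 * PI)))%R.
    { apply HH; auto. intros y.
      eapply Rle_trans; [apply (Rabs_fst_le_Cmod (u (cexp (x, y)) - u 0))|]. left. apply Hd1.
      replace (cexp (x, y) - 0) with (cexp (x, y)) by ring. rewrite Cmod_cexp. exact Hxd. }
    replace (2 * PI * (e / (4 * PI)))%R with (e / 2)%R in H by (field; lra). lra. }
  set (r := ((Rmax rho (1/2) + 1) / 2)%R).
  assert (Hr : (rho < r < 1 /\ 0 < r)%R).
  { unfold r. generalize (Rmax_l rho (1/2)) (Rmax_r rho (1/2)).
    assert (Rmax rho (1/2) < 1)%R by (apply Rmax_lub_lt; lra). lra. }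
  assert (Hx : (ln r < 0)%R) by (rewrite <- ln_1; apply ln_increasing; lra).
  assert (HF : (circle_mean u (ln r) <= 2 * PI * M)%R).
  { rewrite <- HRc. apply RInt_le; auto; [lra| |].
    - apply ex_circle_mean. intros y. apply Hc, Hin; lra.
    - intros y _. apply HM. rewrite Cmod_cexp. simpl. rewrite exp_ln by lra. lra. }
  rewrite (HC _ Hx), Hinside in HF. apply Rmult_le_reg_l with (2 * PI)%R; lra.
Qed.

Lemma Cmod_unit_dir (D : C) : D <> 0 -> exists c, Cmod c = 1%R /\ fst (c * D) = Cmod D.
Proof.
  intros E. apply Cmod_gt_0 in E as Em. set (m := Cmod D) in *.
  assert (Hm : RtoC m <> 0) by (intros X; apply RtoC_inj in X; lra).
  exists (Cconj D / RtoC m). split.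
  - rewrite Cmod_div, Cmod_conj, Cmod_R, Rabs_pos_eq by (auto; lra). fold m. field. lra.
  - replace (Cconj D / RtoC m * D) with (RtoC m); [reflexivity|].
    replace (Cconj D / RtoC m * D) with (D * Cconj D / RtoC m) by (field; auto).
    rewrite <- Cmod2_conj. fold m. rewrite RtoC_pow. field. auto.
Qed.

(** A rotation makes [u 0] real and positive, so the bound on real parts is enough. *)
Lemma Cmod_bound_mean (u : C -> C) (b : C) (M rho : R) :
  b <> 0 -> in_disk b ->
  (forall z, in_disk z -> ccont u z) ->
  (forall z, in_disk z -> z <> b -> cdiff u z) ->
  (rho < 1)%R -> (forall z, (rho < Cmod z < 1)%R -> (Cmod (u z) <= M)%R) ->
  (Cmod (u 0) <= M)%R.
Proof.
  intros Hb0 Hb Hc Hd Hrho HM.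
  destruct (Ceq_dec (u 0) 0) as [E|E].
  (* What remains is [0 <= M], seen at any point of the annulus where the bound holds. *)
  - rewrite E, Cmod_0.
    set (s := ((Rmax rho (1/2) + 1) / 2)%R).
    assert (Hs : (rho < s < 1 /\ 0 < s)%R).
    { unfold s. generalize (Rmax_l rho (1/2)) (Rmax_r rho (1/2)).
      assert (Rmax rho (1/2) < 1)%R by (apply Rmax_lub_lt; lra). lra. }
    eapply Rle_trans; [|apply (HM (RtoC s))]. apply Cmod_ge_0. rewrite Cmod_R, Rabs_pos_eq; lra.
  - destruct (Cmod_unit_dir _ E) as [la [Hla <-]].
    apply (Re_bound_mean (fun z => la * u z) b M rho); auto.
    + intros z Hz e He. destruct (Hc z Hz e He) as [d [Hd0 H]]. exists d; split; auto. intros y Hy.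
      replace (la * u y - la * u z) with (la * (u y - u z)) by ring.
      rewrite Cmod_mult, Hla, Rmult_1_l. auto.
    + intros z Hz Hzb. apply cdiff_mult; [apply cdiff_const|auto].
    + intros z Hz. eapply Rle_trans; [apply Rle_abs|]. eapply Rle_trans; [apply Rabs_fst_le_Cmod|].
      rewrite Cmod_mult, Hla, Rmult_1_l. auto.
Qed.

(** * Schwarz-Pick inequalities *)

Lemma Cmod_sq (z : C) : (Cmod z ^ 2 = fst z ^ 2 + snd z ^ 2)%R.
Proof. apply Cmod2_alt. Qed.

Lemma Cmod_lt_sq (z : C) (r : R) : (0 <= r)%R -> (Cmod z < r)%R <-> (Cmod z ^ 2 < r ^ 2)%R.
Proof. intros Hr. pose proof (Cmod_ge_0 z). split; intros; nra. Qed.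

Lemma Cmod_le_sq (z : C) (r : R) : (0 <= r)%R -> (Cmod z <= r)%R <-> (Cmod z ^ 2 <= r ^ 2)%R.
Proof. intros Hr. pose proof (Cmod_ge_0 z). split; intros; nra. Qed.

Lemma in_disk_sq z : in_disk z <-> (Cmod z ^ 2 < 1)%R.
Proof.
  unfold in_disk. rewrite Cmod_lt_sq by lra. rewrite pow1. tauto.
Qed.

(** The identity behind the pseudo-hyperbolic distance of the disk; the next one plays the same role
    for the half-plane. *)
Lemma Cmod_one_minus (z w : C) :
  (Cmod (1 - Cconj w * z) ^ 2 - Cmod (z - w) ^ 2 = (1 - Cmod z ^ 2) * (1 - Cmod w ^ 2))%R.
Proof. rewrite !Cmod_sq. destruct z, w; simpl. ring. Qed.

Lemma Cmod_plus_conj (z w : C) :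
  (Cmod (z + Cconj w) ^ 2 - Cmod (z - w) ^ 2 = 4 * fst z * fst w)%R.
Proof. rewrite !Cmod_sq. destruct z, w; simpl. ring. Qed.

Lemma disk_denom z w : in_disk z -> in_disk w -> 1 - Cconj w * z <> 0.
Proof.
  intros Hz Hw E. apply in_disk_sq in Hz. apply in_disk_sq in Hw.
  generalize (Cmod_one_minus z w). rewrite E, Cmod_0.
  assert (0 < (1 - Cmod z ^ 2) * (1 - Cmod w ^ 2))%R by (apply Rmult_lt_0_compat; lra).
  generalize (pow2_ge_0 (Cmod (z - w))). simpl. lra.
Qed.

Definition moebius (c z : C) : C := (z - c) / (1 - Cconj c * z).

Lemma moebius_sq c z : in_disk c -> in_disk z ->
  (1 - Cmod (moebius c z) ^ 2 = (1 - Cmod z ^ 2) * (1 - Cmod c ^ 2) / Cmod (1 - Cconj c * z) ^ 2)%R.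
Proof.
  intros Hc Hz. pose proof (disk_denom z c Hz Hc) as Hd. unfold moebius.
  rewrite Cmod_div by auto. rewrite <- Cmod_one_minus.
  apply Cmod_gt_0 in Hd. field. lra.
Qed.

Lemma moebius_in_disk c z : in_disk c -> in_disk z -> in_disk (moebius c z).
Proof.
  intros Hc Hz. apply in_disk_sq.
  pose proof (moebius_sq c z Hc Hz) as E. pose proof (disk_denom z c Hz Hc) as Hd.
  apply in_disk_sq in Hz. apply in_disk_sq in Hc. apply Cmod_gt_0 in Hd.
  assert (0 < (1 - Cmod z ^ 2) * (1 - Cmod c ^ 2) / Cmod (1 - Cconj c * z) ^ 2)%R.
  { apply Rdiv_lt_0_compat; [apply Rmult_lt_0_compat; lra|]. now apply pow_lt. }
  lra.
Qed.

Lemma in_disk_opp c : in_disk c -> in_disk (- c).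
Proof. unfold in_disk. now rewrite Cmod_opp. Qed.

Lemma moebius_inv c z : in_disk c -> in_disk z -> moebius (- c) (moebius c z) = z.
Proof.
  intros Hc Hz. pose proof (disk_denom z c Hz Hc) as Hd.
  pose proof (disk_denom _ _ (moebius_in_disk c z Hc Hz) (in_disk_opp c Hc)) as Hd'.
  pose proof (disk_denom c c Hc Hc) as Hcc.
  unfold moebius in *.
  assert (E : Cconj (- c) = - Cconj c) by (destruct c; unfold Cconj, Copp; simpl; f_equal; ring).
  rewrite E in *. 
  assert (E2 : 1 - - Cconj c * ((z - c) / (1 - Cconj c * z))
    = (1 - Cconj c * c) / (1 - Cconj c * z)) by (field; auto).
  rewrite E2. field. split; auto.
Qed.

Lemma cdiff_moebius c z : in_disk c -> in_disk z -> cdiff (moebius c) z.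
Proof. intros Hc Hz. unfold moebius. cdiff_auto. now apply disk_denom. Qed.

Lemma disk_open z : in_disk z -> exists r, (0 < r)%R /\ forall y, (Cmod (y - z) < r)%R -> in_disk y.
Proof.
  intros H. exists (1 - Cmod z)%R. unfold in_disk in *. split; [lra|]. intros y Hy.
  generalize (Cmod_rev_triangle y z). lra.
Qed.

Lemma ccont_comp f g z : ccont f (g z) -> ccont g z -> ccont (fun x => f (g x)) z.
Proof.
  intros Hf Hg e He. destruct (Hf e He) as [d [Hd H]]. destruct (Hg d Hd) as [d' [Hd' H']].
  exists d'; split; auto.
Qed.

(** The quotient [S w / w], completed by [S'(0)], is only known to be continuous at 0. Composing
    with [moebius (- c)], which sends 0 to [c], moves this defect to [- c], the exceptional point of
    [Cmod_bound_mean]. Near the unit circle the quotient is at most [1 / |w|], which is close to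
    1. *)
Lemma Schwarz_lemma (S : C -> C) :
  (forall z, in_disk z -> cdiff S z) -> (forall z, in_disk z -> (Cmod (S z) <= 1)%R) ->
  S 0 = 0 -> forall c, in_disk c -> (Cmod (S c) <= Cmod c)%R.
Proof.
  intros HS HS1 HS0 c Hc.
  assert (H0 : in_disk 0) by (unfold in_disk; rewrite Cmod_0; lra).
  destruct (Ceq_dec c 0) as [->|Hc0]. { rewrite HS0. lra. }
  destruct (HS 0 H0) as [l Hl].
  set (T := fun w => if Ceq_dec w 0 then l else S w / w).
  assert (HTd : forall w, in_disk w -> w <> 0 -> cdiff T w).
  { intros w Hw Hw0. pose proof Hw0 as Hm. apply Cmod_gt_0 in Hm.
    apply (cdiff_ext_locally (fun w => S w / w) T w (Cmod w)); auto.
    - intros y Hy. unfold T. destruct (Ceq_dec y 0) as [->|]; auto.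
      rewrite Cmod_minus_sym, Cminus_0_r in Hy. lra.
    - apply cdiff_div; auto. apply cdiff_id. }
  assert (HTc : forall w, in_disk w -> ccont T w).
  { intros w Hw. destruct (Ceq_dec w 0) as [->|Hw0]; [|now apply cdiff_ccont, HTd].
    intros e He. destruct (Hl (e / 2)%R ltac:(lra)) as [d [Hd H]]. exists d; split; auto.
    intros y Hy. unfold T at 2. destruct (Ceq_dec 0 0) as [_|n]; [|now destruct n].
    unfold T. destruct (Ceq_dec y 0) as [->|Hy0].
    - rewrite Cminus_diag. rewrite Cmod_0; lra.
    - specialize (H y Hy). rewrite HS0, !Cminus_0_r in H.
      replace (S y / y - l) with ((S y - l * y) / y) by (field; auto).
      apply Cmod_gt_0 in Hy0 as Hm. rewrite Cmod_div by auto.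
      apply Rle_lt_trans with (e / 2)%R; [|lra].
      apply Rmult_le_reg_r with (Cmod y); auto. unfold Rdiv at 1.
      rewrite Rmult_assoc, Rinv_l, Rmult_1_r by lra.
      lra. }
  set (b := - c). assert (Hb : in_disk b) by now apply in_disk_opp.
  assert (Hbz : forall z, in_disk z -> moebius b z = 0 -> z = b).
  { intros z Hz E. rewrite <- (moebius_inv b z Hb Hz), E. unfold moebius. rewrite Cmult_0_r. field.
    }
  assert (Hb0 : moebius b 0 = c).
  { unfold moebius, b. rewrite Cmult_0_r. field. }
  assert (HM : forall M, (1 < M)%R -> (Cmod (T (moebius b 0)) <= M)%R).
  { intros M HM.
    (* With [m = moebius b z] one has [1 - |m|^2 <= 2 * (1 - |z|) * K]; [eta] is the value of
       [1 - |m|^2] when [|m| = 1 / M]. *)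
    set (K := ((1 + Cmod c) / (1 - Cmod c))%R).
    assert (Hc1 : (0 < 1 - Cmod c)%R) by (unfold in_disk in Hc; lra).
    pose proof (Cmod_ge_0 c) as Hcp.
    assert (HK : (0 < K)%R) by (apply Rdiv_lt_0_compat; lra).
    set (eta := (1 - / M ^ 2)%R).
    assert (Heta : (0 < eta)%R).
    { unfold eta. assert (/ M ^ 2 < 1)%R; [|lra]. rewrite <- Rinv_1. apply Rinv_lt_contravar; nra. }
    apply (Cmod_bound_mean (fun z => T (moebius b z)) b M (Rmax 0 (1 - eta / (2 * K)))); auto.
    - unfold b. intros E. apply Hc0. replace c with (- - c) by ring. rewrite E. ring.
    - intros z Hz. apply (ccont_comp T (moebius b)).
      + apply HTc, moebius_in_disk; auto.
      + apply cdiff_ccont, cdiff_moebius; auto.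
    - intros z Hz Hzb. apply (cdiff_comp T (moebius b)).
      + apply HTd. now apply moebius_in_disk. intros E. apply Hzb. auto.
      + apply cdiff_moebius; auto.
    - apply Rmax_lub_lt; [lra|]. assert (0 < eta / (2 * K))%R; [|lra]. apply Rdiv_lt_0_compat; lra.
    - intros z [Hz1 Hz2]. 
      assert (Hz0 : (0 <= Cmod z)%R) by apply Cmod_ge_0.
      assert (Hz3 : (1 - eta / (2 * K) < Cmod z)%R) by (eapply Rle_lt_trans; [apply Rmax_r | exact Hz1]).
      assert (Hz : in_disk z) by exact Hz2.
      pose proof (moebius_sq b z Hb Hz) as E.
      pose proof (moebius_in_disk b z Hb Hz) as Hmd.
      set (m := moebius b z) in *.
      assert (HD : (1 - Cmod c <= Cmod (1 - Cconj b * z))%R).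
      { generalize (Cmod_rev_triangle 1 (Cconj b * z)). rewrite Cmod_1, Cmod_mult, Cmod_conj.
        unfold b. rewrite Cmod_opp. nra. }
      assert (Hmsq : (1 - Cmod m ^ 2 <= eta)%R).
      { rewrite E. unfold b at 1. rewrite Cmod_opp.
        apply Rle_trans with ((2 * (1 - Cmod z)) * (1 - Cmod c ^ 2) / (1 - Cmod c) ^ 2)%R.
        - apply Rmult_le_compat.
          + apply Rmult_le_pos; nra.
          + left. apply Rinv_0_lt_compat. apply pow_lt. lra.
          + apply Rmult_le_compat_r; nra.
          + apply Rinv_le_contravar; [apply pow_lt; lra|]. apply pow_incr. lra.
        - replace (2 * (1 - Cmod z) * (1 - Cmod c ^ 2) / (1 - Cmod c) ^ 2)%R
          with (2 * (1 - Cmod z) * K)%R by (unfold K; field; lra).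
          apply Rle_trans with (2 * (eta / (2 * K)) * K)%R; [|apply Req_le; field; lra].
          apply Rmult_le_compat_r; lra. }
      assert (HmM : (1 <= Cmod m * M)%R).
      { pose proof (Cmod_ge_0 m). unfold eta in Hmsq.
        assert (/ M ^ 2 <= Cmod m ^ 2)%R by lra.
        assert (1 <= Cmod m ^ 2 * M ^ 2)%R.
        { apply Rmult_le_reg_r with (/ M ^ 2)%R. apply Rinv_0_lt_compat, pow_lt; lra.
          rewrite Rmult_assoc, Rinv_r by (apply pow_nonzero; lra). lra. }
        assert (0 <= Cmod m * M)%R by (apply Rmult_le_pos; lra). nra. }
      assert (Hm0 : m <> 0). { intros E0. rewrite E0, Cmod_0 in HmM. lra. }
      unfold T. destruct (Ceq_dec m 0) as [|_]; [contradiction|].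
      apply Cmod_gt_0 in Hm0 as Hmp. rewrite Cmod_div by auto.
      apply Rmult_le_reg_r with (Cmod m); auto. cancel_div.
      specialize (HS1 m Hmd). lra. }
  rewrite Hb0 in HM. unfold T in HM. destruct (Ceq_dec c 0) as [|_]; [contradiction|].
  apply Cmod_gt_0 in Hc0 as Hcp. rewrite Cmod_div in HM by auto.
  assert (H1 : (Cmod (S c) / Cmod c <= 1)%R).
  { apply le_epsilon. intros e He. apply HM. lra. }
  apply Rmult_le_compat_r with (r := Cmod c) in H1; [|lra].
  unfold Rdiv in H1. rewrite Rmult_assoc, Rinv_l, Rmult_1_r in H1; lra.
Qed.

Lemma Re_pos_nz (z : C) : (0 < fst z)%R -> z <> 0.
Proof. intros H E. rewrite E in H. simpl in H. lra. Qed.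

(** Schwarz's lemma for [(g - g w) / (g + Cconj (g w))], composed with the disk automorphism that
    sends 0 to [w], then cleared of denominators. *)
Lemma Schwarz_Pick_pos (g : C -> C) :
  (forall z, in_disk z -> cdiff g z) -> (forall z, in_disk z -> (0 < fst (g z))%R) ->
  forall z w, in_disk z -> in_disk w ->
  (Cmod (g z + Cconj (g w)) ^ 2 * ((1 - Cmod z ^ 2) * (1 - Cmod w ^ 2))
   <= 4 * Cmod (1 - Cconj w * z) ^ 2 * (fst (g z) * fst (g w)))%R.
Proof.
  intros Hg Hp z w Hz Hw.
  pose proof (in_disk_opp w Hw) as Hmw.
  assert (Hden : forall a, in_disk a -> g a + Cconj (g w) <> 0).
  { intros a Ha. apply Re_pos_nz. simpl. generalize (Hp a Ha) (Hp w Hw). unfold Cconj; simpl. lra. }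
  pose (S := fun x => (g (moebius (- w) x) - g w) / (g (moebius (- w) x) + Cconj (g w))).
  assert (HSc : (Cmod (S (moebius w z)) <= Cmod (moebius w z))%R).
  { apply Schwarz_lemma.
    - intros x Hx. unfold S.
      assert (H : cdiff (fun x => g (moebius (- w) x)) x).
      { apply (cdiff_comp g (moebius (- w))). apply Hg, moebius_in_disk; auto.
        now apply cdiff_moebius. }
      cdiff_auto. now apply Hden, moebius_in_disk.
    - intros x Hx. unfold S. pose proof (moebius_in_disk _ _ Hmw Hx) as Hx'. 
      pose proof (Hden _ Hx') as Hd. rewrite Cmod_div by auto. apply Cmod_gt_0 in Hd.
      set (a := g (moebius (- w) x)) in *.
      apply Rmult_le_reg_r with (Cmod (a + Cconj (g w))); auto.
      unfold Rdiv. rewrite Rmult_assoc, Rinv_l, Rmult_1_r, Rmult_1_l by lra.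
      apply Cmod_le_sq; [lra|]. generalize (Cmod_plus_conj a (g w)) (Hp _ Hx') (Hp w Hw). fold a.
      intros.
      assert (0 < fst a * fst (g w))%R by (apply Rmult_lt_0_compat; auto). lra.
    - unfold S. replace (moebius (- w) 0) with w.
      2: { unfold moebius. rewrite Cmult_0_r. field. }
      field. auto.
    - now apply moebius_in_disk. }
  unfold S in HSc. rewrite moebius_inv in HSc by auto.
  pose proof (Hden z Hz) as Hd1. pose proof (disk_denom z w Hz Hw) as Hd2.
  unfold moebius in HSc. rewrite !Cmod_div in HSc by auto.
  apply Cmod_gt_0 in Hd1. apply Cmod_gt_0 in Hd2.
  pose proof (Cmod_plus_conj (g z) (g w)) as E1. pose proof (Cmod_one_minus z w) as E2.
  set (A := Cmod (g z + Cconj (g w))) in *. set (B := Cmod (1 - Cconj w * z)) in *.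
  set (a := Cmod (g z - g w)) in *. set (b := Cmod (z - w)) in *.
  assert (Ha : (0 <= a)%R) by apply Cmod_ge_0. assert (Hb : (0 <= b)%R) by apply Cmod_ge_0.
  assert (H : (a * B <= b * A)%R).
  { apply Rmult_le_compat_r with (r := (A * B)%R) in HSc; [|nra].
    replace (a / A * (A * B))%R with (a * B)%R in HSc by (field; lra).
    replace (b / B * (A * B))%R with (b * A)%R in HSc by (field; lra). auto. }
  assert (H2 : ((a * B) ^ 2 <= (b * A) ^ 2)%R) by (apply pow_incr; split; auto; nra).
  (* The claim now reads [A^2 * (B^2 - b^2) <= B^2 * (A^2 - a^2)], which is
     [(a * B)^2 <= (b * A)^2]. *)
  rewrite <- E2.
  replace (4 * B ^ 2 * (fst (g z) * fst (g w)))%R with (B ^ 2 * (4 * fst (g z) * fst (g w)))%R by ring.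
  rewrite <- E1. nra.
Qed.

(** Apply the strict case to [g + e] and let [e] tend to 0. On the left, adding [e] only increases
    the modulus because both real parts are nonnegative. *)
Lemma Schwarz_Pick_disk (g : C -> C) :
  (forall z, in_disk z -> cdiff g z) -> (forall z, in_disk z -> (0 <= fst (g z))%R) ->
  forall z w, in_disk z -> in_disk w ->
  (Cmod (g z + Cconj (g w)) ^ 2 * ((1 - Cmod z ^ 2) * (1 - Cmod w ^ 2))
   <= 4 * Cmod (1 - Cconj w * z) ^ 2 * (fst (g z) * fst (g w)))%R.
Proof.
  intros Hg Hp z w Hz Hw.
  assert (HA : (0 <= (1 - Cmod z ^ 2) * (1 - Cmod w ^ 2))%R).
  { apply in_disk_sq in Hz. apply in_disk_sq in Hw. apply Rmult_le_pos; lra. }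
  assert (H : forall e, (0 < e)%R ->
   (Cmod (g z + Cconj (g w)) ^ 2 * ((1 - Cmod z ^ 2) * (1 - Cmod w ^ 2))
   <= 4 * Cmod (1 - Cconj w * z) ^ 2 * ((fst (g z) + e) * (fst (g w) + e)))%R).
  { intros e He.
    assert (X := Schwarz_Pick_pos (fun x => g x + RtoC e)).
    specialize (X ltac:(intros; cdiff_auto; auto) ltac:(intros x Hx; simpl; specialize (Hp x Hx);
      lra) z w Hz Hw).
    eapply Rle_trans; [|exact X]. apply Rmult_le_compat_r; auto.
    rewrite !Cmod_sq. simpl. specialize (Hp z Hz) as P1. specialize (Hp w Hw) as P2. nra. }
  set (L := (Cmod (g z + Cconj (g w)) ^ 2 * ((1 - Cmod z ^ 2) * (1 - Cmod w ^ 2)))%R) in *.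
  set (B := (4 * Cmod (1 - Cconj w * z) ^ 2)%R) in *.
  assert (HB : (0 <= B)%R) by (unfold B; generalize (pow2_ge_0 (Cmod (1 - Cconj w * z))); lra).
  specialize (Hp z Hz) as P1. specialize (Hp w Hw) as P2.
  set (x := fst (g z)) in *. set (y := fst (g w)) in *.
  apply le_epsilon. intros e He.
  (* As [d <= 1], replacing [x] and [y] by [x + d] and [y + d] costs at most
     [B * d * (x + y + 1)]. *)
  set (d := (Rmin 1 (e / (B * (x + y + 1) + 1)))%R).
  assert (HD : (0 < B * (x + y + 1) + 1)%R) by nra.
  assert (Hd : (0 < d)%R) by (apply Rmin_pos; [lra | apply Rdiv_lt_0_compat; lra]).
  assert (Hd1 : (d <= 1)%R) by apply Rmin_l.
  assert (Hd2 : (d * (B * (x + y + 1) + 1) <= e)%R).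
  { apply Rle_trans with (e / (B * (x + y + 1) + 1) * (B * (x + y + 1) + 1))%R.
    - apply Rmult_le_compat_r; [lra|apply Rmin_r].
    - apply Req_le; field; lra. }
  eapply Rle_trans; [apply (H d Hd)|].
  assert (B * (d * d) <= B * d)%R by (apply Rmult_le_compat_l; nra). nra.
Qed.

(** * The right half-plane and the Cayley transform *)

Definition in_H (z : C) : Prop := (0 < fst z)%R.

Definition cayley (z : C) : C := (1 + z) / (1 - z).
Definition cayley_inv (w : C) : C := (w - 1) / (w + 1).

Lemma disk_neq_1 z : in_disk z -> 1 - z <> 0.
Proof.
  intros Hz E. assert (z = 1) by (replace z with (1 - (1 - z)) by ring; rewrite E; ring).
  subst z. unfold in_disk in Hz. rewrite Cmod_1 in Hz. lra.
Qed.

Lemma H_plus_1 w : in_H w -> w + 1 <> 0.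
Proof. intros H. apply Re_pos_nz. unfold in_H in H. simpl. lra. Qed.

Lemma fst_cayley z : 1 - z <> 0 -> (fst (cayley z) = (1 - Cmod z ^ 2) / Cmod (1 - z) ^ 2)%R.
Proof.
  intros Hz. apply Cmod_gt_0 in Hz.
  assert (H : (0 < Cmod (1 - z) ^ 2)%R) by now apply pow_lt.
  rewrite !Cmod_sq in *. destruct z as [x y].
  unfold cayley, Cdiv, Cinv, Cmult, Cplus, Cminus, Copp in *; simpl in *. field. lra.
Qed.

Lemma cayley_in_H z : in_disk z -> in_H (cayley z).
Proof.
  intros Hz. unfold in_H. pose proof (disk_neq_1 z Hz) as H. rewrite fst_cayley by auto.
  apply Cmod_gt_0 in H. apply in_disk_sq in Hz. apply Rdiv_lt_0_compat; [lra|now apply pow_lt].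
Qed.

Lemma cayley_inv_sq w : in_H w -> (1 - Cmod (cayley_inv w) ^ 2 = 4 * fst w / Cmod (w + 1) ^ 2)%R.
Proof.
  intros Hw. pose proof (H_plus_1 w Hw) as H. unfold cayley_inv. rewrite Cmod_div by auto.
  apply Cmod_gt_0 in H. 
  assert (E : (Cmod (w + 1) ^ 2 - Cmod (w - 1) ^ 2 = 4 * fst w)%R) by (rewrite !Cmod_sq;
    destruct w; simpl; ring).
  rewrite <- E. field. lra.
Qed.

Lemma cayley_inv_in_disk w : in_H w -> in_disk (cayley_inv w).
Proof.
  intros Hw. apply in_disk_sq. pose proof (cayley_inv_sq w Hw) as E.
  pose proof (H_plus_1 w Hw) as H. apply Cmod_gt_0 in H.
  assert (0 < 4 * fst w / Cmod (w + 1) ^ 2)%R; [|lra].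
  unfold in_H in Hw. apply Rdiv_lt_0_compat; [lra|now apply pow_lt].
Qed.

Lemma cayley_inv_cayley z : in_disk z -> cayley_inv (cayley z) = z.
Proof.
  intros Hz. pose proof (disk_neq_1 z Hz). unfold cayley, cayley_inv.
  replace ((1 + z) / (1 - z) + 1) with ((1 + 1) / (1 - z)) by (field; auto).
  field; auto.
Qed.

Lemma cayley_cayley_inv w : in_H w -> cayley (cayley_inv w) = w.
Proof.
  intros Hw. pose proof (H_plus_1 w Hw). unfold cayley, cayley_inv.
  replace (1 - (w - 1) / (w + 1)) with ((1 + 1) / (w + 1)) by (field; auto).
  field; auto.
Qed.

Lemma cdiff_cayley z : in_disk z -> cdiff cayley z.
Proof. intros. unfold cayley. cdiff_auto. now apply disk_neq_1. Qed.

Lemma cdiff_cayley_inv z : in_H z -> cdiff cayley_inv z.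
Proof. intros. unfold cayley_inv. cdiff_auto. now apply H_plus_1. Qed.

(** The disk inequality in the Cayley coordinate; the factors [|z + 1|] and [|w + 1|] occur equally
    on both sides and cancel. *)
Lemma Schwarz_Pick_H (g : C -> C) :
  (forall z, in_H z -> cdiff g z) -> (forall z, in_H z -> (0 <= fst (g z))%R) ->
  forall z w, in_H z -> in_H w ->
  (Cmod (g z + Cconj (g w)) ^ 2 * (fst z * fst w) <= Cmod (z + Cconj w) ^ 2 * (fst (g z) * fst (g w)))%R.
Proof.
  intros Hg Hp z w Hz Hw.
  assert (X := Schwarz_Pick_disk (fun x => g (cayley x))).
  specialize (X ltac:(intros x Hx; apply (cdiff_comp g cayley);
    [apply Hg, cayley_in_H | apply cdiff_cayley]; auto)).
  specialize (X ltac:(intros x Hx; apply Hp, cayley_in_H;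
    auto) _ _ (cayley_inv_in_disk z Hz) (cayley_inv_in_disk w Hw)).
  cbv beta in X. rewrite !cayley_cayley_inv in X by auto. rewrite !cayley_inv_sq in X by auto.
  pose proof (H_plus_1 z Hz) as D1. pose proof (H_plus_1 w Hw) as D2.
  assert (D3 : Cconj w + 1 <> 0) by (apply Re_pos_nz; unfold in_H in Hw; simpl; lra).
  assert (E : 1 - Cconj (cayley_inv w) * cayley_inv z = (1 + 1) * (z + Cconj w) / ((Cconj w + 1) * (z + 1))).
  { unfold cayley_inv. rewrite Cdiv_conj, Cminus_conj, Cplus_conj by auto.
    rewrite (Cconj_RtoC 1).
    field. split; auto. }
  rewrite E in X. rewrite Cmod_div in X by (apply Cmult_neq_0; auto). rewrite !Cmod_mult in X.
  replace (Cmod (Cconj w + 1)) with (Cmod (w + 1)) in X.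
  2: { rewrite <- (Cmod_conj (w + 1)), Cplus_conj. f_equal. f_equal. unfold Cconj; simpl.
       now rewrite Ropp_0. }
  replace (Cmod (1 + 1)) with 2%R in X by (rewrite <- RtoC_plus, Cmod_R, Rabs_pos_eq; lra).
  apply Cmod_gt_0 in D1. apply Cmod_gt_0 in D2.
  set (a := Cmod (z + 1)) in *. set (b := Cmod (w + 1)) in *.
  set (G := Cmod (g z + Cconj (g w))) in *. set (N := Cmod (z + Cconj w)) in *.
  set (K := (16 / (a ^ 2 * b ^ 2))%R).
  assert (HK : (0 < K)%R) by (apply Rdiv_lt_0_compat; [lra|apply Rmult_lt_0_compat; now apply pow_lt]).
  apply Rmult_le_reg_l with K; auto.
  replace (K * (G ^ 2 * (fst z * fst w)))%R
    with (G ^ 2 * (4 * fst z / a ^ 2 * (4 * fst w / b ^ 2)))%R by (unfold K; field; lra).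
  eapply Rle_trans; [exact X|]. apply Req_le. unfold K. field. lra.
Qed.

(** By [Cmod_plus_conj] both sides of [Schwarz_Pick_H] exceed the sides here by the same term [4 *
    fst z * fst w * fst (g z) * fst (g w)]. *)
Lemma Schwarz_Pick_H_minus (g : C -> C) :
  (forall z, in_H z -> cdiff g z) -> (forall z, in_H z -> (0 <= fst (g z))%R) ->
  forall z w, in_H z -> in_H w ->
  (Cmod (g z - g w) ^ 2 * (fst z * fst w) <= Cmod (z - w) ^ 2 * (fst (g z) * fst (g w)))%R.
Proof.
  intros Hg Hp z w Hz Hw. generalize (Schwarz_Pick_H g Hg Hp z w Hz Hw).
  generalize (Cmod_plus_conj z w) (Cmod_plus_conj (g z) (g w)). intros E1 E2.
  replace (Cmod (z + Cconj w) ^ 2)%R with (Cmod (z - w) ^ 2 + 4 * fst z * fst w)%R by lra.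
  replace (Cmod (g z + Cconj (g w)) ^ 2)%R with (Cmod (g z - g w) ^ 2 + 4 * fst (g z) * fst (g w))%R by lra.
  lra.
Qed.

(** * Primitives in the half-plane *)

Lemma CInt_swap f a b : ex_CInt f a b -> CInt f b a = - CInt f a b.
Proof.
  intros [H1 H2]. unfold CInt, Copp; simpl. f_equal.
  - symmetry. exact (opp_RInt_swap (V := R_CompleteNormedModule) (fun t => fst (f t)) a b H1).
  - symmetry. exact (opp_RInt_swap (V := R_CompleteNormedModule) (fun t => snd (f t)) a b H2).
Qed.

Lemma ex_CInt_swap f a b : ex_CInt f a b -> ex_CInt f b a.
Proof. intros [H1 H2]. split; now apply (ex_RInt_swap (V := R_NormedModule)). Qed.

Lemma CInt_near_const f a b c M : ex_CInt f a b ->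
  (forall t, (Rmin a b <= t <= Rmax a b)%R -> (Cmod (f t - c) <= M)%R) ->
  (Cmod (CInt f a b - c * RtoC (b - a)) <= 2 * Rabs (b - a) * M)%R.
Proof.
  assert (Hle : forall a b, (a <= b)%R -> ex_CInt f a b ->
    (forall t, (Rmin a b <= t <= Rmax a b)%R -> (Cmod (f t - c) <= M)%R) ->
    (Cmod (CInt f a b - c * RtoC (b - a)) <= 2 * Rabs (b - a) * M)%R).
  { clear a b. intros a b Hab Hex HM. rewrite Rmin_left, Rmax_right in HM by auto.
    assert (Hc : ex_CInt (fun _ => c) a b) by (split; apply (ex_RInt_const (V := R_NormedModule))).
    replace (c * RtoC (b - a)) with (CInt (fun _ => c) a b).
    2: { unfold CInt. rewrite !RInt_const. unfold scal; simpl; unfold mult; simpl.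
         destruct c; unfold Cmult, RtoC; simpl. f_equal; ring. }
    rewrite <- CInt_minus by auto. rewrite Rabs_pos_eq by lra. apply CInt_bound; auto.
    destruct Hex, Hc. split; apply (ex_RInt_minus (V := R_NormedModule)); auto. }
  intros Hex HM. destruct (Rle_dec a b) as [H|H]; [now apply Hle|].
  replace (CInt f a b - c * RtoC (b - a)) with (- (CInt f b a - c * RtoC (a - b))).
  2: { rewrite (CInt_swap f a b) by auto. rewrite !RtoC_minus. ring. }
  rewrite Cmod_opp, Rabs_minus_sym. apply Hle; [lra|now apply ex_CInt_swap|].
  intros t Ht. apply HM. rewrite Rmin_comm, Rmax_comm. auto.
Qed.

Lemma ex_CInt_H_hor Q y a b : (forall z, in_H z -> cdiff Q z) -> (0 < a)%R -> (0 < b)%R ->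
  ex_CInt (fun t => Q (t, y)) a b.
Proof.
  intros HQ Ha Hb. apply (ex_CInt_path Q (fun t => (t, y))).
  - intros t Ht. apply cdiff_ccont, HQ. unfold in_H; simpl. generalize (Rmin_glb_lt _ _ _ Ha Hb).
    lra.
  - intros; apply Cmod_horizontal.
Qed.
Lemma ex_CInt_H_ver Q x a b : (forall z, in_H z -> cdiff Q z) -> (0 < x)%R -> ex_CInt (fun t => Q (x, t)) a b.
Proof.
  intros HQ Hx. apply (ex_CInt_path Q (fun t => (x, t))).
  - intros t Ht. apply cdiff_ccont, HQ. exact Hx.
  - intros; apply Cmod_vertical.
Qed.

(** Exchanging two opposite sides changes the sign of the boundary integral, so the corners may come
    in any order; this spares the primitive a case distinction. *)
Lemma Goursat_H Q x1 x2 y1 y2 : (forall z, in_H z -> cdiff Q z) -> (0 < x1)%R -> (0 < x2)%R ->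
  rect_int Q x1 x2 y1 y2 = 0.
Proof.
  intros HQ.
  assert (Ho : forall x1 x2 y1 y2, (0 < x1)%R -> (x1 <= x2)%R -> (y1 <= y2)%R -> rect_int Q x1 x2 y1 y2 = 0).
  { intros a b c d Ha Hab Hcd. apply Goursat; auto. intros [x y] [Hx Hy]. apply HQ.
    unfold in_H; simpl in *. lra. }
  assert (Hx : forall x1 x2 y1 y2, (0 < x1)%R -> (0 < x2)%R -> rect_int Q x2 x1 y1 y2
    = - rect_int Q x1 x2 y1 y2).
  { intros a b c d Ha Hb. unfold rect_int.
    rewrite (CInt_swap (fun x => Q (x, c)) a b), (CInt_swap (fun x => Q (x, d)) a b)
      by (apply ex_CInt_H_hor; auto).
    ring. }
  assert (Hy : forall x1 x2 y1 y2, (0 < x1)%R -> (0 < x2)%R -> rect_int Q x1 x2 y2 y1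
    = - rect_int Q x1 x2 y1 y2).
  { intros a b c d Ha Hb. unfold rect_int.
    rewrite (CInt_swap (fun x => Q (a, x)) c d), (CInt_swap (fun x => Q (b, x)) c d)
      by (apply ex_CInt_H_ver; auto).
    ring. }
  intros H1 H2.
  destruct (Rle_dec x1 x2), (Rle_dec y1 y2).
  - apply Ho; auto.
  - rewrite Hy by auto. rewrite Ho; try lra. ring.
  - rewrite Hx by auto. rewrite Ho; try lra. ring.
  - rewrite Hx, Hy by auto. rewrite Ho; try lra. ring.
Qed.

(** The path runs from 1 along the real axis and then vertically, so it stays in the half-plane. *)
Definition primitive_H (Q : C -> C) (w : C) : C :=
  CInt (fun t => Q (t, 0%R)) 1 (fst w) + Ci * CInt (fun t => Q (fst w, t)) 0 (snd w).

(** Goursat on the rectangle between the real axis and height [y0] turns the increment into an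
    integral over an L-shaped path starting at [w], along which [Q] is within [e / 4] of [Q w]. Two
    legs and the factor 2 of [CInt_near_const] make up [e]. *)
Lemma primitive_H_deriv Q w : (forall z, in_H z -> cdiff Q z) -> in_H w -> has_cderiv (primitive_H Q) w (Q w).
Proof.
  intros HQ Hw e He.
  destruct (cdiff_ccont _ _ (HQ w Hw) (e / 4)%R ltac:(lra)) as [d [Hd H]].
  destruct w as [x0 y0]. unfold in_H in Hw; simpl in Hw.
  exists (Rmin (x0 / 2) (d / 2)). split; [apply Rmin_pos; lra|]. intros [x y] Hy.
  assert (H1 : (Cmod (((x, y) : C) - (x0, y0)) < x0 / 2)%R) by (lt_Rmin Hy).
  assert (H2 : (Cmod (((x, y) : C) - (x0, y0)) < d / 2)%R) by (lt_Rmin Hy).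
  assert (Hdx : (Rabs (x - x0) <= Cmod (((x, y) : C) - (x0, y0)))%R)
    by apply (Rabs_fst_le_Cmod (((x, y) : C) - (x0, y0))).
  assert (Hdy : (Rabs (y - y0) <= Cmod (((x, y) : C) - (x0, y0)))%R)
    by apply (Rabs_snd_le_Cmod (((x, y) : C) - (x0, y0))).
  assert (Ew : ((x, y) : C) - (x0, y0) = RtoC (x - x0) + Ci * RtoC (y - y0)).
  { unfold Cminus, Cplus, Copp, Cmult, RtoC, Ci; simpl. f_equal; ring. }
  rewrite Ew. rewrite <- Ew. set (D := Cmod (((x, y) : C) - (x0, y0))) in *.
  assert (Hx : (0 < x)%R) by (apply Rabs_le_between in Hdx; lra).
  assert (E : primitive_H Q (x, y) - primitive_H Q (x0, y0)
     = CInt (fun t => Q (t, y0)) x0 x + Ci * CInt (fun t => Q (x, t)) y0 y).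
  { unfold primitive_H; simpl.
    rewrite <- (CInt_Chasles (fun t => Q (t, 0%R)) 1 x0 x) by (apply ex_CInt_H_hor; auto; lra).
    rewrite <- (CInt_Chasles (fun t => Q (x, t)) 0 y0 y) by (apply ex_CInt_H_ver; auto).
    generalize (Goursat_H Q x0 x 0 y0 HQ Hw Hx). unfold rect_int. intros G.
    replace (CInt (fun t => Q (t, y0)) x0 x) with (CInt (fun t => Q (t, y0)) x0 x + 0) by ring.
    rewrite <- G. ring. }
  rewrite E, Ew.
  replace (CInt (fun t => Q (t, y0)) x0 x + Ci * CInt (fun t => Q (x, t)) y0 y - Q (x0, y0)
    * (RtoC (x - x0) + Ci * RtoC (y - y0)))
    with ((CInt (fun t => Q (t, y0)) x0 x - Q (x0, y0) * RtoC (x - x0))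
      + Ci * (CInt (fun t => Q (x, t)) y0 y - Q (x0, y0) * RtoC (y - y0))) by ring.
  eapply Rle_trans; [apply Cmod_triangle|]. rewrite Cmod_mult, Cmod_Ci, Rmult_1_l.
  assert (B1 : (Cmod (CInt (fun t => Q (t, y0)) x0 x - Q (x0, y0) * RtoC (x - x0))
    <= 2 * Rabs (x - x0) * (e / 4))%R).
  { apply CInt_near_const; [apply ex_CInt_H_hor; auto|]. intros t Ht. left. apply H.
    eapply Rle_lt_trans; [apply Cmod_horizontal|]. 
    assert (Rabs (t - x0) <= Rabs (x - x0))%R; [|lra].
    unfold Rmin, Rmax in Ht. destruct (Rle_dec x0 x); unfold Rabs; repeat destruct Rcase_abs; lra. }
  assert (B2 : (Cmod (CInt (fun t => Q (x, t)) y0 y - Q (x0, y0) * RtoC (y - y0))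
    <= 2 * Rabs (y - y0) * (e / 4))%R).
  { apply CInt_near_const; [apply ex_CInt_H_ver; auto|]. intros t Ht. left. apply H.
    eapply Rle_lt_trans; [apply Cmod_le_abs|]. simpl.
    assert (Rabs (t - y0) <= Rabs (y - y0))%R.
    { unfold Rmin, Rmax in Ht. destruct (Rle_dec y0 y); unfold Rabs; repeat destruct Rcase_abs; lra.
      }
    unfold Rminus in *. lra. }
  nra.
Qed.

(** * Mean value estimates along segments *)

Lemma Re_path_derive (F : C -> C) (a v l : C) (s : R) :
  has_cderiv F (a + RtoC s * v) l ->
  derivable_pt_lim (fun s => fst (F (a + RtoC s * v))) s (fst (l * v)).
Proof.
  intros H e He. pose proof (Cmod_ge_0 v) as Hv.
  assert (Hv1 : (0 < Cmod v + 1)%R) by lra.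
  destruct (H (e / (2 * (Cmod v + 1)))%R ltac:(apply Rdiv_lt_0_compat; lra)) as [d [Hd H']].
  assert (Hd' : (0 < d / (Cmod v + 1))%R) by (apply Rdiv_lt_0_compat; lra).
  exists (mkposreal _ Hd'). intros h Hh Hhd. simpl in Hhd.
  assert (E : a + RtoC (s + h) * v - (a + RtoC s * v) = RtoC h * v) by (rewrite RtoC_plus; ring).
  specialize (H' (a + RtoC (s + h) * v)). rewrite E, Cmod_mult, Cmod_R in H'.
  assert (Hlt : (Rabs h * Cmod v < d)%R).
  { apply Rmult_lt_compat_r with (r := (Cmod v + 1)%R) in Hhd; [|lra].
    replace (d / (Cmod v + 1) * (Cmod v + 1))%R with d in Hhd by (field; lra).
    generalize (Rabs_pos h). nra. }
  specialize (H' Hlt).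
  set (D := F (a + RtoC (s + h) * v) - F (a + RtoC s * v) - l * (RtoC h * v)) in *.
  replace ((fst (F (a + RtoC (s + h) * v)%C) - fst (F (a + RtoC s * v)%C))
    / h - fst (l * v)%C)%R with (fst D / h)%R.
  2: { unfold D. destruct (F (a + RtoC (s + h) * v)), (F (a + RtoC s * v)), l, v; simpl. field.
       auto. }
  unfold Rdiv at 1. rewrite Rabs_mult, Rabs_inv. 
  assert (Hh0 : (0 < Rabs h)%R) by now apply Rabs_pos_lt.
  apply Rmult_lt_reg_r with (Rabs h); auto. rewrite Rmult_assoc, Rinv_l, Rmult_1_r by lra.
  eapply Rle_lt_trans; [apply Rabs_fst_le_Cmod|]. eapply Rle_lt_trans; [exact H'|].
  apply Rle_lt_trans with (e / 2 * Rabs h)%R; [|nra].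
  replace (e / (2 * (Cmod v + 1)) * (Rabs h * Cmod v))%R
    with (e / 2 * Rabs h * (Cmod v / (Cmod v + 1)))%R by (field; lra).
  rewrite <- (Rmult_1_r (e / 2 * Rabs h)) at 2. apply Rmult_le_compat_l; [nra|].
  apply Rmult_le_reg_r with (Cmod v + 1)%R; [lra|]. unfold Rdiv. rewrite Rmult_assoc, Rinv_l by lra.
  lra.
Qed.

(** The mean value theorem fails for complex values but holds for the real part of [c * F] along a
    segment; [c] is left free to select the direction that matters. *)
Lemma Re_mean_value (F F' : C -> C) (a b c : C) :
  (forall s, (0 <= s <= 1)%R -> has_cderiv F (a + RtoC s * (b - a)) (F' (a + RtoC s * (b - a)))) ->
  exists s, (0 <= s <= 1)%R /\ fst (c * (F b - F a)) = fst (c * F' (a + RtoC s * (b - a)) * (b - a)).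
Proof.
  intros H.
  destruct (MVT_cor2 (fun s => fst (c * F (a + RtoC s * (b - a))))
    (fun s => fst (c * F' (a + RtoC s * (b - a)) * (b - a))) 0 1 Rlt_0_1) as [s [Hs1 Hs2]].
  - intros s Hs. apply (Re_path_derive (fun z => c * F z)).
    replace (c * F' (a + RtoC s * (b - a))) with (0 * F (a + RtoC s * (b - a))
      + c * F' (a + RtoC s * (b - a))) by ring.
    apply (has_cderiv_mult (fun _ => c)); [apply has_cderiv_const|auto].
  - exists s. split; [lra|].
    replace (a + RtoC 1 * (b - a)) with b in Hs1 by ring.
    replace (a + RtoC 0 * (b - a)) with a in Hs1 by ring.
    rewrite Rminus_0_r, Rmult_1_r in Hs1. rewrite <- Hs1.
    destruct (F a), (F b), c; simpl. ring.
Qed.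

(** The multiplier [c] rotates the whole error [D] onto the positive real axis, so the real mean
    value formula controls its modulus. *)
Lemma mean_value_error (F F' : C -> C) (a b : C) (M : R) :
  (forall s, (0 <= s <= 1)%R -> has_cderiv F (a + RtoC s * (b - a)) (F' (a + RtoC s * (b - a)))) ->
  (forall s, (0 <= s <= 1)%R -> (Cmod (F' (a + RtoC s * (b - a))%C - F' a) <= M)%R) ->
  (Cmod (F b - F a - F' a * (b - a)) <= M * Cmod (b - a))%R.
Proof.
  intros HF HM. set (D := F b - F a - F' a * (b - a)).
  destruct (Ceq_dec D 0) as [E|E].
  - rewrite E, Cmod_0. apply Rmult_le_pos; [|apply Cmod_ge_0].
    eapply Rle_trans; [|apply (HM 0%R); lra]. apply Cmod_ge_0.
  - destruct (Cmod_unit_dir D E) as [c [Hc1 Hc2]].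
    destruct (Re_mean_value F F' a b c HF) as [s [Hs Es]].
    rewrite <- Hc2. 
    assert (E2 : fst (c * D) = fst (c * (F' (a + RtoC s * (b - a)) - F' a) * (b - a))).
    { unfold D.
      replace (c * (F b - F a - F' a * (b - a))) with (c * (F b - F a) - c * F' a * (b - a)) by ring.
      replace (c * (F' (a + RtoC s * (b - a)) - F' a) * (b - a))
        with (c * F' (a + RtoC s * (b - a)) * (b - a) - c * F' a * (b - a)) by ring.
      simpl in Es |- *. lra. }
    rewrite E2. eapply Rle_trans; [apply Rle_abs|]. eapply Rle_trans; [apply Rabs_fst_le_Cmod|].
    rewrite !Cmod_mult, Hc1, Rmult_1_l. apply Rmult_le_compat_r; [apply Cmod_ge_0|auto].
Qed.

(** The Noshiro-Warschawski argument in quantitative form, with the multiplier [la / (b - a)]. It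
    yields both injectivity and the Cauchy property of approximate solutions. *)
Lemma expanding (F F' : C -> C) (a b la : C) (m : R) : Cmod la = 1%R -> 
  (forall s, (0 <= s <= 1)%R -> has_cderiv F (a + RtoC s * (b - a)) (F' (a + RtoC s * (b - a)))) ->
  (forall s, (0 <= s <= 1)%R -> (m <= fst (la * F' (a + RtoC s * (b - a))%C)%C)%R) ->
  (m * Cmod (b - a) <= Cmod (F b - F a))%R.
Proof.
  intros Hla HF Hm.
  destruct (Ceq_dec (b - a) 0) as [E|E].
  - rewrite E, Cmod_0, Rmult_0_r. apply Cmod_ge_0.
  - destruct (Re_mean_value F F' a b (la / (b - a)) HF) as [s [Hs Es]].
    replace (la / (b - a) * F' (a + RtoC s * (b - a)) * (b - a))
      with (la * F' (a + RtoC s * (b - a))) in Es by (field; auto).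
    specialize (Hm s Hs). rewrite <- Es in Hm.
    assert (H : (m <= Cmod (la / (b - a) * (F b - F a)))%R).
    { eapply Rle_trans; [exact Hm|]. eapply Rle_trans; [apply Rle_abs|]. apply Rabs_fst_le_Cmod. }
    rewrite Cmod_mult, Cmod_div, Hla in H by auto. apply Cmod_gt_0 in E.
    apply Rmult_le_compat_r with (r := Cmod (b - a)) in H; [|lra].
    eapply Rle_trans; [exact H|]. apply Req_le. field. lra.
Qed.

(** * Existence of the flow *)

Lemma fst_le_Cmod (z : C) : (fst z <= Cmod z)%R.
Proof. eapply Rle_trans; [apply Rle_abs|apply Rabs_fst_le_Cmod]. Qed.

(** In [Schwarz_Pick_H] the modulus on the left is at least [fst (g w)], and one factor [fst (g w)]
    cancels. *)
Lemma Harnack_lower (g : C -> C) :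
  (forall z, in_H z -> cdiff g z) -> (forall z, in_H z -> (0 < fst (g z))%R) ->
  forall z w, in_H z -> in_H w ->
  (fst (g w) * (fst z * fst w) <= Cmod (z + Cconj w) ^ 2 * fst (g z))%R.
Proof.
  intros Hg Hp z w Hz Hw.
  generalize (Schwarz_Pick_H g Hg (fun z Hz => Rlt_le _ _ (Hp z Hz)) z w Hz Hw).
  pose proof (Hp z Hz) as P1. pose proof (Hp w Hw) as P2. unfold in_H in *.
  assert (HA : (fst (g w) <= Cmod (g z + Cconj (g w)))%R).
  { eapply Rle_trans; [|apply fst_le_Cmod]. simpl. lra. }
  assert (Hk : (0 < fst z * fst w)%R) by (apply Rmult_lt_0_compat; auto).
  set (A := Cmod (g z + Cconj (g w))) in *. set (N := (Cmod (z + Cconj w) ^ 2)%R). intros H.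
  apply Rmult_le_reg_r with (fst (g w)); auto.
  assert ((fst (g w) * fst (g w)) * (fst z * fst w) <= A ^ 2 * (fst z * fst w))%R
    by (apply Rmult_le_compat_r; nra).
  lra.
Qed.

(** In [Schwarz_Pick_H] the factor [fst (g z)] on the right is at most the modulus on the left, and
    one factor of that modulus cancels. *)
Lemma Harnack_upper (g : C -> C) :
  (forall z, in_H z -> cdiff g z) -> (forall z, in_H z -> (0 <= fst (g z))%R) ->
  forall z w, in_H z -> in_H w ->
  (Cmod (g z + Cconj (g w)) * (fst z * fst w) <= Cmod (z + Cconj w) ^ 2 * fst (g w))%R.
Proof.
  intros Hg Hp z w Hz Hw.
  generalize (Schwarz_Pick_H g Hg Hp z w Hz Hw).
  pose proof (Hp z Hz) as P1. pose proof (Hp w Hw) as P2.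
  assert (HA : (fst (g z) <= Cmod (g z + Cconj (g w)))%R).
  { eapply Rle_trans; [|apply fst_le_Cmod]. simpl. lra. }
  set (A := Cmod (g z + Cconj (g w))) in *. set (N := (Cmod (z + Cconj w) ^ 2)%R). intros H.
  assert (HN : (0 <= N)%R) by apply pow2_ge_0.
  destruct (Rle_lt_or_eq_dec 0 A (Cmod_ge_0 _)) as [HA0|HA0].
  - apply Rmult_le_reg_l with A; auto.
    assert (N * (fst (g z) * fst (g w)) <= N * (A * fst (g w)))%R by (apply Rmult_le_compat_l;
      auto; apply Rmult_le_compat_r; auto).
    lra.
  - rewrite <- HA0. rewrite Rmult_0_l. nra.
Qed.

(** For [x > 0] a compact convex piece of the half-plane. Harnack's inequalities are uniform on it,
    and segments between its points stay inside. *)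
Definition H_cell (x A : R) (w0 z : C) : Prop := (x <= fst z)%R /\ (Cmod (z - w0) <= A)%R.

Lemma H_cell_segment x A w0 a b s : H_cell x A w0 a -> H_cell x A w0 b -> (0 <= s <= 1)%R ->
  H_cell x A w0 (a + RtoC s * (b - a)).
Proof.
  intros [Ha1 Ha2] [Hb1 Hb2] Hs. split.
  - destruct a, b; simpl in *. nra.
  - replace (a + RtoC s * (b - a) - w0) with (RtoC (1 - s) * (a - w0) + RtoC s * (b - w0))
    by (rewrite RtoC_minus; ring).
    eapply Rle_trans; [apply Cmod_triangle|]. rewrite !Cmod_mult, !Cmod_R, !Rabs_pos_eq by lra. nra.
Qed.

Lemma H_cell_conj x A w0 z : in_H w0 -> H_cell x A w0 z -> (Cmod (z + Cconj w0) <= A + 2 * fst w0)%R.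
Proof.
  intros Hw [_ Hz]. replace (z + Cconj w0) with ((z - w0) + RtoC (2 * fst w0)).
  2: { destruct z, w0; unfold Cplus, Cminus, Copp, Cconj, RtoC, Cplus; simpl. f_equal; ring. }
  eapply Rle_trans; [apply Cmod_triangle|]. unfold in_H in Hw. rewrite Cmod_R, Rabs_pos_eq by lra.
  lra.
Qed.

Lemma H_cell_bound (g : C -> C) x A w0 :
  (forall z, in_H z -> cdiff g z) -> (forall z, in_H z -> (0 <= fst (g z))%R) ->
  in_H w0 -> (0 < x)%R -> exists M, (0 < M)%R /\ forall z, H_cell x A w0 z -> (Cmod (g z) <= M)%R.
Proof.
  intros Hg Hp Hw Hx.
  set (K := ((A + 2 * fst w0) ^ 2 * Cmod (g w0) / (x * fst w0))%R).
  assert (Hk : (0 < x * fst w0)%R) by (apply Rmult_lt_0_compat; auto).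
  assert (HK : (0 <= K)%R).
  { apply Rmult_le_pos; [|left; now apply Rinv_0_lt_compat].
    apply Rmult_le_pos; [apply pow2_ge_0|apply Cmod_ge_0]. }
  exists (Cmod (g w0) + K + 1)%R. split. { generalize (Cmod_ge_0 (g w0)); lra. }
  intros z Hz. pose proof (H_cell_conj x A w0 z Hw Hz) as Hc. destruct Hz as [Hz1 Hz2].
  assert (Hz : in_H z) by (unfold in_H; lra).
  pose proof (Harnack_upper g Hg Hp z w0 Hz Hw) as HU.
  assert (H : (Cmod (g z + Cconj (g w0)) <= K)%R).
  { apply Rmult_le_reg_r with (x * fst w0)%R; auto.
    unfold K. cancel_div.
    apply Rle_trans with (Cmod (g z + Cconj (g w0)) * (fst z * fst w0))%R.
    - apply Rmult_le_compat_l; [apply Cmod_ge_0|]. apply Rmult_le_compat_r; unfold in_H in Hw; lra.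
    - eapply Rle_trans; [exact HU|]. apply Rmult_le_compat.
      + apply pow2_ge_0. + auto. + apply pow_incr. split; [apply Cmod_ge_0|auto].
        + apply fst_le_Cmod. }
  generalize (Cmod_rev_triangle (g z) (- Cconj (g w0))). rewrite Cmod_opp, Cmod_conj.
  replace (g z - - Cconj (g w0)) with (g z + Cconj (g w0)) by ring. lra.
Qed.

Lemma H_cell_lower (g : C -> C) x A w0 :
  (forall z, in_H z -> cdiff g z) -> (forall z, in_H z -> (0 < fst (g z))%R) ->
  in_H w0 -> (0 < x)%R -> exists m, (0 < m)%R /\ forall z, H_cell x A w0 z -> (m <= fst (g z))%R.
Proof.
  intros Hg Hp Hw Hx. pose proof Hw as Hw'. unfold in_H in Hw'.
  destruct (Rle_dec 0 A) as [HA|HA].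
  (* For [A < 0] the cell is empty. *)
  2: { exists 1%R. split; [lra|]. intros z [_ H]. generalize (Cmod_ge_0 (z - w0)). lra. }
  set (B := ((A + 2 * fst w0) ^ 2)%R). assert (HB : (0 < B)%R) by (apply pow_lt; lra).
  pose proof (Hp w0 Hw) as P0.
  exists (fst (g w0) * (x * fst w0) / B)%R. split.
  { apply Rdiv_lt_0_compat; auto. repeat apply Rmult_lt_0_compat; auto. }
  intros z Hz. pose proof (H_cell_conj x A w0 z Hw Hz) as Hc. destruct Hz as [Hz1 Hz2].
  assert (Hz : in_H z) by (unfold in_H; lra).
  pose proof (Harnack_lower g Hg Hp z w0 Hz Hw) as HL. pose proof (Hp z Hz) as Pz.
  apply Rmult_le_reg_r with B; auto. cancel_div.
  apply Rle_trans with (fst (g w0) * (fst z * fst w0))%R.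
  { apply Rmult_le_compat_l; [lra|]. apply Rmult_le_compat_r; lra. }
  eapply Rle_trans; [exact HL|]. rewrite Rmult_comm. apply Rmult_le_compat_l; [lra|].
  apply pow_incr. split; [apply Cmod_ge_0|auto].
Qed.

(* Small hyperbolic steps cannot escape: the hyperbolic length of a step
   controls the relative growth of the real part, hence the Euclidean length. *)
Lemma hyperbolic_steps (w : nat -> C) (k : R) : (0 <= k <= 1 / 2)%R ->
  (forall n, in_H (w n)) -> (forall n, (fst (w n) <= fst (w (S n)))%R) ->
  (forall n, (Cmod (w (S n) - w n) ^ 2 <= k ^ 2 * (fst (w n) * fst (w (S n))))%R) ->
  (forall n, (fst (w n) <= fst (w O) * exp (2 * (INR n * k)))%R) /\
  (forall n, (Cmod (w (S n) - w n) <= k * fst (w (S n)))%R) /\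
  (forall n, (Cmod (w n - w O) <= INR n * k * (fst (w O) * exp (2 * (INR n * k))))%R).
Proof.
  intros Hk HH Hmono Hstep. unfold in_H in HH.
  assert (H2 : forall n, (Cmod (w (S n) - w n) <= k * fst (w (S n)))%R).
  { intros n. specialize (HH (S n)) as h1. specialize (HH n) as h0. apply Cmod_le_sq; [nra|].
    eapply Rle_trans; [apply Hstep|]. rewrite Rpow_mult_distr. specialize (Hmono n).
    apply Rmult_le_compat_l; [apply pow2_ge_0|]. nra. }
  assert (H1 : forall n, (fst (w n) <= fst (w O) * exp (2 * (INR n * k)))%R).
  { induction n as [|n IH].
    - simpl. rewrite Rmult_0_l, Rmult_0_r, exp_0. lra.
    - assert (Hd : (fst (w (S n)) - fst (w n) <= k * fst (w (S n)))%R).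
      { eapply Rle_trans; [|apply H2]. eapply Rle_trans; [|apply fst_le_Cmod]. simpl. lra. }
      assert (E : (fst (w (S n)) <= fst (w n) * (1 + 2 * k))%R).
      (* [1 <= (1 - k) * (1 + 2 * k)] because [0 <= k <= 1 / 2]. *)
      { specialize (HH (S n)). apply Rle_trans with (fst (w (S n)) * ((1 - k) * (1 + 2 * k)))%R.
        - rewrite <- (Rmult_1_r (fst (w (S n)))) at 1. apply Rmult_le_compat_l; nra.
        - rewrite <- Rmult_assoc. apply Rmult_le_compat_r; nra. }
      rewrite S_INR. replace (2 * ((INR n + 1) * k))%R with (2 * (INR n * k) + 2 * k)%R by ring.
      rewrite exp_plus, <- Rmult_assoc. eapply Rle_trans; [exact E|].
      apply Rmult_le_compat; auto; try lra. specialize (HH n); lra.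
      destruct (Req_dec k 0) as [->|Hk0]. rewrite Rmult_0_r, exp_0. lra.
      left. apply exp_ineq1. lra. }
  split; [auto|split; [auto|]].
  (* The exponent is frozen at a horizon [m], so that the bound is additive in [n]. *)
  assert (H3 : forall m n, (n <= m)%nat -> (Cmod (w n - w O)
    <= INR n * k * (fst (w O) * exp (2 * (INR m * k))))%R).
  { intros m. induction n as [|n IH]; intros Hn.
    - rewrite Cminus_diag. rewrite Cmod_0. simpl. lra.
    - eapply Rle_trans; [apply (Cmod_triangle_minus _ (w n))|].
      rewrite S_INR. replace ((INR n + 1) * k * (fst (w O) * exp (2 * (INR m * k))))%R with
        (k * (fst (w O) * exp (2 * (INR m * k))) + INR n * k * (fst (w O) * exp (2 * (INR m * k))))%R by ring.
      apply Rplus_le_compat; [|apply IH; lia].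
      eapply Rle_trans; [apply H2|]. apply Rmult_le_compat_l; [lra|]. eapply Rle_trans; [apply H1|].
      apply Rmult_le_compat_l; [specialize (HH O); lra|].
      destruct (Req_dec (INR (S n) * k) (INR m * k)) as [->|Hne]; [lra|].
      left. apply exp_increasing. assert (INR (S n) <= INR m)%R by (apply le_INR; auto).
      assert (INR (S n) * k <= INR m * k)%R by (apply Rmult_le_compat_r; lra). lra. }
  intros n. now apply H3.
Qed.

(** [G] maps the half-plane into itself, so by Schwarz-Pick no later step exceeds the hyperbolic
    bound of the first one. For the first, [fst w0 <= fst (G w0)] allows [|G w0 - w0| / fst w0] as a
    measure. *)
Lemma iterate_steps (G : C -> C) (w0 : C) :
  (forall z, in_H z -> cdiff G z) -> (forall z, in_H z -> (fst z <= fst (G z))%R) -> in_H w0 ->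
  (forall n, in_H (Nat.iter n G w0)) /\
  (forall n, (fst (Nat.iter n G w0) <= fst (Nat.iter (S n) G w0))%R) /\
  (forall n, (Cmod (Nat.iter (S n) G w0 - Nat.iter n G w0) ^ 2 <=
    (Cmod (G w0 - w0) / fst w0) ^ 2 * (fst (Nat.iter n G w0) * fst (Nat.iter (S n) G w0)))%R).
Proof.
  intros HGd HGm Hw.
  assert (HGH : forall z, in_H z -> in_H (G z)).
  { intros z Hz. generalize (HGm z Hz). unfold in_H in *. lra. }
  assert (H1 : forall n, in_H (Nat.iter n G w0)).
  { induction n; simpl; auto. }
  split; [auto|split].
  { intros n. apply (HGm (Nat.iter n G w0)). auto. }
  induction n as [|n IH].
  - change (Nat.iter 1 G w0) with (G w0). change (Nat.iter 0 G w0) with w0.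
    pose proof (HGm w0 Hw) as Hm. unfold in_H in Hw.
    set (y := fst (G w0)) in *. set (m := Cmod (G w0 - w0)).
    replace ((m / fst w0) ^ 2 * (fst w0 * y))%R with (m ^ 2 * (y / fst w0))%R by (field; lra).
    rewrite <- (Rmult_1_r (m ^ 2)) at 1. apply Rmult_le_compat_l; [apply pow2_ge_0|].
    apply Rmult_le_reg_r with (fst w0); auto. unfold Rdiv. rewrite Rmult_assoc, Rinv_l; lra.
  - set (a := Nat.iter n G w0) in *. set (b := Nat.iter (S n) G w0) in *.
    set (c := Nat.iter (S (S n)) G w0).
    assert (Ha : in_H a) by apply H1. assert (Hb : in_H b) by apply H1.
    assert (Hc : in_H c) by apply H1.
    assert (HSP : (Cmod (c - b) ^ 2 * (fst b * fst a) <= Cmod (b - a) ^ 2 * (fst c * fst b))%R).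
    { apply (Schwarz_Pick_H_minus G HGd (fun z Hz => Rlt_le _ _ (HGH z Hz)) b a Hb Ha). }
    unfold in_H in *. apply Rmult_le_reg_r with (fst b * fst a)%R; [nra|].
    eapply Rle_trans; [exact HSP|].
    eapply Rle_trans; [apply Rmult_le_compat_r; [nra|exact IH]|].
    apply Req_le. ring.
Qed.

Lemma C_Cauchy_limit (u : nat -> C) :
  (forall e, (0 < e)%R -> exists N, forall n m, (N <= n)%nat -> (N <= m)%nat -> (Cmod (u n - u m) < e)%R) ->
  exists l, forall e, (0 < e)%R -> exists N, forall n, (N <= n)%nat -> (Cmod (u n - l) < e)%R.
Proof.
  intros H.
  assert (Cfst : Cauchy_crit (fun n => fst (u n))).
  { intros e He. destruct (H e He) as [N HN]. exists N. intros n m Hn Hm. unfold Rdist.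
    eapply Rle_lt_trans; [apply (Rabs_fst_le_Cmod (u n - u m))|]. auto. }
  destruct (Rcomplete.R_complete _ Cfst) as [a Ha].
  assert (Csnd : Cauchy_crit (fun n => snd (u n))).
  { intros e He. destruct (H e He) as [N HN]. exists N. intros n m Hn Hm. unfold Rdist.
    eapply Rle_lt_trans; [apply (Rabs_snd_le_Cmod (u n - u m))|]. auto. }
  destruct (Rcomplete.R_complete _ Csnd) as [b Hb].
  exists (a, b). intros e He.
  destruct (Ha (e / 2)%R ltac:(lra)) as [N1 H1]. destruct (Hb (e / 2)%R ltac:(lra)) as [N2 H2].
  exists (max N1 N2). intros n Hn.
  specialize (H1 n ltac:(lia)). specialize (H2 n ltac:(lia)). unfold Rdist, Rminus in *.
  eapply Rle_lt_trans; [apply Cmod_le_abs|]. simpl. lra.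
Qed.

(** The explicit bound on the displacement is part of the conclusion because it later confines
    neighbouring trajectories to one cell, which gives joint continuity. [c] is [t] times the
    initial speed relative to [fst w0]; an Euler polygon with [n] steps has hyperbolic step bound
    [c / n]. *)
Lemma flow_exists (Q sigma : C -> C) (la : C) (w0 : C) (t : R) :
  (forall z, in_H z -> cdiff Q z) -> (forall z, in_H z -> (0 <= fst (Q z))%R) ->
  Cmod la = 1%R -> (forall z, in_H z -> (0 < fst (la * Q z)%C)%R) ->
  (forall z, in_H z -> has_cderiv sigma z (Q z)) ->
  in_H w0 -> (0 <= t)%R ->
  let c := (t * (Cmod (/ Q w0) / fst w0))%R in
  exists w, (fst w0 <= fst w)%R /\ (Cmod (w - w0) <= c * (fst w0 * exp (2 * c)))%R /\ sigma w
    = sigma w0 + RtoC t.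
Proof.
  intros HQ Hp Hla HlaQ Hs Hw Ht c.
  pose proof Hw as Hx0. unfold in_H in Hx0. set (x0 := fst w0) in *.
  assert (HQ0 : forall z, in_H z -> Q z <> 0).
  { intros z Hz E. specialize (HlaQ z Hz). rewrite E, Cmult_0_r in HlaQ. simpl in HlaQ. lra. }
  set (P := fun z => / Q z).
  assert (HP : forall z, in_H z -> cdiff P z) by (intros; apply cdiff_inv; auto).
  assert (HPp : forall z, in_H z -> (0 <= fst (P z))%R).
  { intros z Hz. unfold P. specialize (Hp z Hz). specialize (HQ0 z Hz). apply Cmod_gt_0 in HQ0.
    assert (0 < Cmod (Q z) ^ 2)%R by now apply pow_lt. rewrite Cmod_sq in *.
    destruct (Q z) as [a b]. simpl in *. apply Rmult_le_pos; auto. left. apply Rinv_0_lt_compat.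
    nra. }
  assert (Hc0 : (0 <= c)%R).
  { unfold c. apply Rmult_le_pos; auto. apply Rmult_le_pos; [apply Cmod_ge_0|]. left.
    now apply Rinv_0_lt_compat. }
  set (rho := (c * (x0 * exp (2 * c)))%R).
  assert (HlaQd : forall z, in_H z -> cdiff (fun z => la * Q z) z) by (intros; cdiff_auto; auto).
  destruct (H_cell_bound Q x0 rho w0 HQ Hp Hw Hx0) as [M [HM0 HM]].
  destruct (H_cell_lower (fun z => la * Q z) x0 rho w0 HlaQd HlaQ Hw Hx0) as [m [Hm0 Hm]].
  assert (HcellH : forall z, H_cell x0 rho w0 z -> in_H z) by (intros z [H _]; unfold in_H; lra).
  assert (Hexpand : forall a b, H_cell x0 rho w0 a -> H_cell x0 rho w0 b -> (m * Cmod (b - a)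
    <= Cmod (sigma b - sigma a))%R).
  { intros a b Ha Hb. apply (expanding sigma Q a b la m Hla).
    - intros s Hs'. apply Hs, HcellH, H_cell_segment; auto.
    - intros s Hs'. apply Hm, H_cell_segment; auto. }
  set (X := (x0 * exp (2 * c))%R).
  assert (HX : (0 < X)%R) by (apply Rmult_lt_0_compat; auto; apply exp_pos).
  (* A step has defect at most [(k * X)^2 * M / x0] with [k = c / n]; [n] of them add up to
     [L / n]. *)
  set (L := (c ^ 2 * X ^ 2 * M / x0)%R).
  assert (HL : (0 <= L)%R).
  { unfold L. apply Rmult_le_pos; [|left; now apply Rinv_0_lt_compat].
    apply Rmult_le_pos; [|lra]. apply Rmult_le_pos; apply pow2_ge_0. }
  (* [2 * c <= n] is the condition [k <= 1 / 2] of [hyperbolic_steps]. *)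
  assert (Heul : forall n, (2 * c <= INR n)%R -> (0 < n)%nat -> exists w, H_cell x0 rho w0 w /\
     (Cmod (sigma w - (sigma w0 + RtoC t)) <= L / INR n)%R).
  { intros n Hn Hn0. apply lt_0_INR in Hn0.
    set (eta := (t / INR n)%R).
    assert (Heta : (0 <= eta)%R) by (apply Rmult_le_pos; auto; left; now apply Rinv_0_lt_compat).
    set (G := fun z => z + RtoC eta * P z).
    assert (HGd : forall z, in_H z -> cdiff G z).
    { intros z Hz. unfold G. apply cdiff_plus; [apply cdiff_id|].
      apply cdiff_mult; [apply cdiff_const|auto]. }
    assert (HGm : forall z, in_H z -> (fst z <= fst (G z))%R).
    { intros z Hz. specialize (HPp z Hz). destruct z as [x y]. unfold G. simpl in *. nra. }
    destruct (iterate_steps G w0 HGd HGm Hw) as (E1 & E2 & E3).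
    set (k := (eta * (Cmod (/ Q w0) / x0))%R) in *.
    replace (Cmod (G w0 - w0) / fst w0)%R with k in E3.
    2: { unfold G. replace (w0 + RtoC eta * P w0 - w0) with (RtoC eta * / Q w0) by (unfold P; ring).
         rewrite Cmod_mult, Cmod_R, Rabs_pos_eq by auto. unfold k. fold x0. unfold Rdiv. ring. }
    assert (Hkc : (k = c / INR n)%R) by (unfold k, eta, c; field; lra).
    assert (Hnk : (INR n * k = c)%R) by (rewrite Hkc; field; lra).
    assert (Hk : (0 <= k <= 1 / 2)%R).
    { rewrite Hkc. split.
      - apply Rmult_le_pos; auto; left; now apply Rinv_0_lt_compat.
      - apply Rmult_le_reg_r with (INR n); auto. unfold Rdiv. rewrite Rmult_assoc, Rinv_l; lra. }
    set (w := fun j => Nat.iter j G w0) in *.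
    destruct (hyperbolic_steps w k Hk E1 E2 E3) as (S1 & S2 & S3).
    change (w O) with w0 in S1, S3. fold x0 in S1, S3.
    assert (Hmono : forall j, (x0 <= fst (w j))%R).
    { induction j. apply Rle_refl. eapply Rle_trans; [apply IHj|apply E2]. }
    assert (HjX : forall j, (j <= n)%nat -> (x0 * exp (2 * (INR j * k)) <= X)%R).
    { intros j Hj. apply le_INR in Hj. unfold X. rewrite <- Hnk. apply Rmult_le_compat_l; [lra|].
      assert (INR j * k <= INR n * k)%R by (apply Rmult_le_compat_r; lra).
      destruct (Req_dec (INR j * k) (INR n * k)) as [->|]; [lra|]. left; apply exp_increasing; lra.
      }
    assert (Hcell : forall j, (j <= n)%nat -> H_cell x0 rho w0 (w j)).
    { intros j Hj. split; [apply Hmono|]. eapply Rle_trans; [apply S3|].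
      unfold rho. fold X. apply Rmult_le_compat.
      - apply Rmult_le_pos; [apply pos_INR|lra].
      - left. apply Rmult_lt_0_compat; auto; apply exp_pos.
      - rewrite <- Hnk. apply Rmult_le_compat_r; [lra|]. now apply le_INR.
      - auto. }
    exists (w n). split; [apply Hcell; lia|].
    assert (Herr : forall j, (j < n)%nat -> (Cmod (sigma (w (S j)) - sigma (w j) - RtoC eta)
      <= (k * X) * M / x0 * (k * X))%R).
    { intros j Hj. assert (Cj := Hcell j ltac:(lia)). assert (Cj' := Hcell (S j) ltac:(lia)).
      assert (Hd : w (S j) - w j = RtoC eta * P (w j)) by (unfold w, G; simpl; ring).
      assert (Hdk : (Cmod (w (S j) - w j) <= k * X)%R).
      { eapply Rle_trans; [apply S2|]. apply Rmult_le_compat_l; [lra|].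
        eapply Rle_trans; [apply S1|]. apply HjX. lia. }
      (* For an Euler step [eta] is exactly the linear part of the increment of [sigma]. The defect
         is therefore governed by the variation of [Q] over the step, which Schwarz-Pick bounds by
         [|xi - w j| * M / x0]. *)
      replace (RtoC eta) with (Q (w j) * (w (S j) - w j)).
      2: { rewrite Hd. unfold P. field. apply HQ0, HcellH; auto. }
      assert (HkX : (0 <= k * X)%R) by nra.
      eapply Rle_trans; [apply (mean_value_error sigma Q (w j) (w (S j)) (k * X * M / x0))|].
      - intros s Hs'. apply Hs, HcellH, H_cell_segment; auto.
      - intros s Hs'. pose proof (H_cell_segment _ _ _ _ _ s Cj Cj' Hs') as Cs.
        set (xi := w j + RtoC s * (w (S j) - w j)) in *.
        assert (Hxi : (Cmod (xi - w j) <= k * X)%R).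
        { unfold xi.
          replace (w j + RtoC s * (w (S j) - w j) - w j) with (RtoC s * (w (S j) - w j)) by ring.
          rewrite Cmod_mult, Cmod_R, Rabs_pos_eq by lra. pose proof (Cmod_ge_0 (w (S j) - w j)).
          nra. }
        generalize (Schwarz_Pick_H_minus Q HQ Hp xi (w j) (HcellH _ Cs) (HcellH _ Cj)).
        pose proof (HM _ Cs) as M1. pose proof (HM _ Cj) as M2.
        pose proof (fst_le_Cmod (Q xi)) as F1. pose proof (fst_le_Cmod (Q (w j))) as F2.
        pose proof (Hp _ (HcellH _ Cs)) as G1. pose proof (Hp _ (HcellH _ Cj)) as G2.
        destruct Cs as [Cs _]. destruct Cj as [Cj _]. intros HSP.
        assert (Hbig : (Cmod (Q xi - Q (w j)) ^ 2 * (x0 * x0) <= (k * X) ^ 2 * (M * M))%R).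
        { apply Rle_trans with (Cmod (Q xi - Q (w j)) ^ 2 * (fst xi * fst (w j)))%R.
          - apply Rmult_le_compat_l; [apply pow2_ge_0|]. apply Rmult_le_compat; lra.
          - eapply Rle_trans; [exact HSP|]. apply Rmult_le_compat.
            + apply pow2_ge_0. + nra.
            + apply pow_incr. split; [apply Cmod_ge_0|auto].
            + apply Rmult_le_compat; lra. }
        assert (HMx : (0 <= k * X * M / x0)%R).
        { apply Rmult_le_pos; [nra|]. left. now apply Rinv_0_lt_compat. }
        apply Cmod_le_sq; auto.
        apply Rmult_le_reg_r with (x0 * x0)%R; [nra|].
        eapply Rle_trans; [exact Hbig|]. apply Req_le. field. lra.
      - apply Rmult_le_compat_l; auto. apply Rmult_le_pos; [nra|]. left. now apply Rinv_0_lt_compat.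
        }
    assert (Hsum : forall j, (j <= n)%nat -> (Cmod (sigma (w j) - (sigma w0 + RtoC (INR j * eta)))
      <= INR j * (k * X * M / x0 * (k * X)))%R).
    { induction j as [|j IH]; intros Hj.
      - simpl INR. rewrite !Rmult_0_l. change (w O) with w0.
        replace (sigma w0 - (sigma w0 + 0)) with (RtoC 0) by ring. rewrite Cmod_0; lra.
      - rewrite S_INR.
        replace (sigma (w (S j)) - (sigma w0 + RtoC ((INR j + 1) * eta))) with
          ((sigma (w (S j)) - sigma (w j) - RtoC eta) + (sigma (w j) - (sigma w0 + RtoC (INR j * eta)))).
        2: { rewrite Rmult_plus_distr_r, Rmult_1_l, RtoC_plus. ring. }
        eapply Rle_trans; [apply Cmod_triangle|]. specialize (IH ltac:(lia)).
        specialize (Herr j ltac:(lia)). lra. }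
    specialize (Hsum n ltac:(lia)).
    replace (INR n * eta)%R with t in Hsum by (unfold eta; field; lra).
    eapply Rle_trans; [exact Hsum|]. apply Req_le. unfold L. rewrite Hkc. field. lra. }
  set (n0 := S (Z.to_nat (up (2 * c)))).
  assert (Hn0 : (2 * c <= INR n0)%R).
  { unfold n0. rewrite S_INR, INR_IZR_INZ, Z2Nat.id. destruct (archimed (2 * c)). lra.
    apply le_IZR. destruct (archimed (2 * c)). simpl. lra. }
  assert (Hseq : forall n, exists w, H_cell x0 rho w0 w /\ (Cmod (sigma w - (sigma w0 + RtoC t))
    <= L / INR (n0 + n))%R).
  { intros n. apply Heul; [|unfold n0; lia]. eapply Rle_trans; [exact Hn0|]. apply le_INR. lia. }
  destruct (choice _ Hseq) as [u Hu].
  assert (HLn : forall e, (0 < e)%R -> exists N, forall n, (N <= n)%nat -> (L / INR (n0 + n) < e)%R).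
  { intros e He. exists (S (Z.to_nat (up (L / e)))). intros n Hn.
    assert (Hpos : (0 < INR (n0 + n))%R) by (apply lt_0_INR; unfold n0; lia).
    assert (Hbig : (L / e < INR (n0 + n))%R).
    { apply Rlt_le_trans with (INR (S (Z.to_nat (up (L / e))))); [|apply le_INR; lia].
      rewrite S_INR, INR_IZR_INZ. destruct (archimed (L / e)).
      rewrite Z2Nat.id. lra. apply le_IZR. simpl.
      assert (0 <= L / e)%R by (apply Rmult_le_pos; auto; left; now apply Rinv_0_lt_compat). lra. }
    apply Rmult_lt_reg_r with (INR (n0 + n)); auto. unfold Rdiv at 1.
    rewrite Rmult_assoc, Rinv_l, Rmult_1_r by lra.
    apply Rmult_lt_compat_r with (r := e) in Hbig; auto. unfold Rdiv in Hbig.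
    rewrite Rmult_assoc, Rinv_l in Hbig by lra. lra. }
  (* [sigma] expands distances in the cell by at least [m], so the convergence of [sigma (u n)]
     makes [u] itself a Cauchy sequence. *)
  destruct (C_Cauchy_limit u) as [w Hwl].
  { intros e He. destruct (HLn (e * m / 2)%R ltac:(nra)) as [N HN]. exists N. intros n p Hn Hp'.
    destruct (Hu n) as [U1 U2]. destruct (Hu p) as [U3 U4].
    specialize (HN n Hn) as N1. specialize (HN p Hp') as N2.
    pose proof (Hexpand _ _ U3 U1) as Hex.
    pose proof (Cmod_triangle_minus (sigma (u n)) (sigma w0 + RtoC t) (sigma (u p))) as Ht1.
    rewrite (Cmod_minus_sym (sigma w0 + RtoC t) (sigma (u p))) in Ht1.
    apply Rmult_lt_reg_l with m; auto. lra. }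
  assert (Hcell : H_cell x0 rho w0 w).
  { split.
    - apply le_epsilon. intros e He. destruct (Hwl e He) as [N HN]. specialize (HN N (le_n N)).
      destruct (Hu N) as [[U1 _] _]. generalize (Rabs_fst_le_Cmod (u N - w)). simpl. intros H.
      apply Rabs_le_between in H. lra.
    - apply le_epsilon. intros e He. destruct (Hwl e He) as [N HN]. specialize (HN N (le_n N)).
      destruct (Hu N) as [[_ U1] _]. generalize (Cmod_triangle_minus w (u N) w0).
      rewrite (Cmod_minus_sym w (u N)). lra. }
  exists w. split; [apply Hcell|split; [apply Hcell|]].
  assert (Hd : Cmod (sigma w - (sigma w0 + RtoC t)) = 0%R).
  { apply Rle_antisym; [|apply Cmod_ge_0]. apply le_epsilon. intros e He. rewrite Rplus_0_l.
    destruct (has_cderiv_ccont _ _ _ (Hs w (HcellH _ Hcell)) (e / 2)%R ltac:(lra)) as [d [Hd H]].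
    destruct (Hwl d Hd) as [N1 HN1]. destruct (HLn (e / 2)%R ltac:(lra)) as [N2 HN2].
    set (n := max N1 N2). specialize (HN1 n ltac:(lia)). specialize (HN2 n ltac:(lia)).
    destruct (Hu n) as [_ U]. specialize (H (u n) HN1).
    generalize (Cmod_triangle_minus (sigma w) (sigma (u n)) (sigma w0 + RtoC t)).
    rewrite (Cmod_minus_sym (sigma w) (sigma (u n))). lra. }
  apply Cmod_eq_0 in Hd.
  replace (sigma w) with ((sigma w - (sigma w0 + RtoC t)) + (sigma w0 + RtoC t)) by ring.
  rewrite Hd. ring.
Qed.

(** * Generators from functions with nonnegative real part *)

(** First-order inversion without an inverse function: near [z] one has
    [|S y - S z| >= |q| / 2 * |y - z|], which turns an error relative to [|y - z|] into one relative
    to [|S y - S z|]. *)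
Lemma inverse_increment (S : C -> C) (z q : C) : has_cderiv S z q -> q <> 0 ->
  forall e, (0 < e)%R -> exists d, (0 < d)%R /\ forall y, (Cmod (y - z) < d)%R ->
    (Cmod (y - z - (S y - S z) / q) <= e * Cmod (S y - S z))%R.
Proof.
  intros HS Hq e He. apply Cmod_gt_0 in Hq as Hm. set (m := Cmod q) in *.
  set (e' := (Rmin (m / 2) (e * (m * m) / 2))%R).
  assert (He' : (0 < e')%R) by (apply Rmin_pos; [lra|];
    assert (0 < e * (m * m))%R by (repeat apply Rmult_lt_0_compat; auto); lra).
  assert (E1 : (e' <= m / 2)%R) by apply Rmin_l.
  assert (E2 : (e' <= e * (m * m) / 2)%R) by apply Rmin_r.
  destruct (HS e' He') as [d [Hd H]]. exists d. split; auto. intros y Hy. specialize (H y Hy).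
  set (D := S y - S z) in *. set (v := y - z) in *.
  pose proof (Cmod_ge_0 v) as Hv.
  assert (HD : (m / 2 * Cmod v <= Cmod D)%R).
  { generalize (Cmod_rev_triangle (q * v) D). rewrite Cmod_mult, Cmod_minus_sym. fold m. nra. }
  replace (v - D / q) with (- ((D - q * v) / q)) by (field; auto).
  rewrite Cmod_opp, Cmod_div by auto. fold m.
  apply Rmult_le_reg_r with m; auto. cancel_div.
  eapply Rle_trans; [exact H|].
  apply Rle_trans with (e * (m * m) / 2 * Cmod v)%R. apply Rmult_le_compat_r; auto.
  replace (e * (m * m) / 2 * Cmod v)%R with (e * m * (m / 2 * Cmod v))%R by field.
  replace (e * Cmod D * m)%R with (e * m * Cmod D)%R by ring. apply Rmult_le_compat_l; auto. nra.
Qed.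

(** In the coordinate [S] the flow is translation by [t]. Injectivity of [S] gives the semigroup
    law, and [inverse_increment] gives both the derivative [S' z / S' (F t z)] in [z] and the
    generator; joint continuity supplies the nearness that this lemma requires. *)
Lemma koenigs_generator (S S' : C -> C) (F : R -> C -> C) :
  (forall z, in_disk z -> has_cderiv S z (S' z)) ->
  (forall z, in_disk z -> S' z <> 0) ->
  (forall z w, in_disk z -> in_disk w -> S z = S w -> z = w) ->
  (forall t z, (0 <= t)%R -> in_disk z -> in_disk (F t z)) ->
  (forall t z, (0 <= t)%R -> in_disk z -> S (F t z) = S z + RtoC t) ->
  (forall t z, (0 <= t)%R -> in_disk z -> forall e, (0 < e)%R -> exists d, (0 < d)%R /\
     forall s y, (0 <= s)%R -> in_disk y -> (Rabs (s - t) < d)%R -> (Cmod (y - z) < d)%R ->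
       (Cmod (F s y - F t z) < e)%R) ->
  is_semigroup F /\
  (forall z, in_disk z -> filterlim (fun t : R => (z - F t z) / RtoC t) (at_right 0%R) (locally (- / S' z))).
Proof.
  intros HS HS' Hinj HFd HF Hc.
  assert (HF0 : forall z, in_disk z -> F 0%R z = z).
  { intros z Hz. apply Hinj; auto. apply HFd; auto; lra. rewrite HF by (auto; lra). ring. }
  split; [split|].
  - intros t Ht z Hz. apply cdiff_ex_derive.
    set (q := S' (F t z)). assert (Hq : q <> 0) by (apply HS'; auto).
    exists (S' z / q). intros e He.
    apply Cmod_gt_0 in Hq as Hm. set (m := Cmod q) in *.
    pose proof (Cmod_ge_0 (S' z)) as Hp. set (p := Cmod (S' z)) in *.
    assert (He1 : (0 < e / (2 * (p + 1)))%R) by (apply Rdiv_lt_0_compat; lra).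
    destruct (inverse_increment S (F t z) q (HS _ (HFd t z Ht Hz)) Hq (e / (2 * (p + 1))) He1)
      as [d1 [Hd1 H1]].
    assert (He2 : (0 < Rmin 1 (e * m / 2))%R) by (apply Rmin_pos; nra).
    destruct (HS z Hz _ He2) as [d2 [Hd2 H2]].
    destruct (Hc t z Ht Hz d1 Hd1) as [d3 [Hd3 H3]].
    destruct (disk_open z Hz) as [r [Hr Hr']].
    exists (Rmin (Rmin d2 d3) r). split; [repeat apply Rmin_pos; auto|]. intros y Hy.
    assert (Y2 : (Cmod (y - z) < d2)%R). { lt_Rmin Hy. }
    assert (Y3 : (Cmod (y - z) < d3)%R). { lt_Rmin Hy. }
    assert (Yr : in_disk y). { apply Hr'. lt_Rmin Hy. }
    specialize (H2 y Y2). specialize (H3 t y Ht Yr ltac:(rewrite Rminus_diag, Rabs_R0; auto) Y3).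
    specialize (H1 _ H3). rewrite !HF in H1 by auto.
    replace (S y + RtoC t - (S z + RtoC t)) with (S y - S z) in H1 by ring.
    set (D := S y - S z) in *. set (v := y - z) in *. pose proof (Cmod_ge_0 v) as Hv.
    replace (F t y - F t z - S' z / q * v) with ((F t y - F t z - D / q) + (D - S' z * v) / q)
      by (field; auto).
    eapply Rle_trans; [apply Cmod_triangle|]. rewrite Cmod_div by auto. fold m.
    assert (M1 : (Rmin 1 (e * m / 2) <= 1)%R) by apply Rmin_l.
    assert (M2 : (Rmin 1 (e * m / 2) <= e * m / 2)%R) by apply Rmin_r.
    assert (HD : (Cmod D <= (p + 1) * Cmod v)%R).
    { generalize (Cmod_rev_triangle D (S' z * v)). rewrite Cmod_mult. fold p. nra. }
    assert (B1 : (e / (2 * (p + 1)) * Cmod D <= e / 2 * Cmod v)%R).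
    { replace (e / 2 * Cmod v)%R with (e / (2 * (p + 1)) * ((p + 1) * Cmod v))%R by (field; lra).
      apply Rmult_le_compat_l; [lra|auto]. }
    assert (B2 : (Cmod (D - S' z * v) / m <= e / 2 * Cmod v)%R).
    { apply Rmult_le_reg_r with m; auto. unfold Rdiv at 1.
      rewrite Rmult_assoc, Rinv_l, Rmult_1_r by lra.
      eapply Rle_trans; [exact H2|].
      replace (e / 2 * Cmod v * m)%R with (e * m / 2 * Cmod v)%R by field.
      apply Rmult_le_compat_r; auto. }
    lra.
  - intros t z Ht Hz. now apply HFd.
  - intros s t z Hs Ht Hz. apply Hinj.
    + apply HFd; auto; lra. + apply HFd; auto.
    + rewrite (HF (s + t)%R z), (HF s), (HF t z) by (try apply HFd; auto; lra). rewrite RtoC_plus.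
      ring.
  - exact HF0.
  - intros t z Ht Hz. apply (filterlim_C_Cmod _ _ _). intros e He.
    destruct (Hc t z Ht Hz e He) as [d [Hd H]]. exists (mkposreal d Hd). intros s Hs Hs0.
    apply H; auto. rewrite Cminus_diag. now rewrite Cmod_0.
  - intros z Hz. apply (filterlim_C_Cmod _ _ _). intros e He.
    destruct (inverse_increment S z (S' z) (HS z Hz) (HS' z Hz) (e / 2) ltac:(lra)) as [d1 [Hd1 H1]].
    destruct (Hc 0%R z (Rle_refl 0) Hz d1 Hd1) as [d [Hd H]]. exists (mkposreal d Hd).
    intros t Ht Ht0.
    specialize (H t z ltac:(lra) Hz Ht ltac:(rewrite Cminus_diag; now rewrite Cmod_0)).
    rewrite HF0 in H by auto. specialize (H1 _ H). rewrite HF in H1 by (auto; lra).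
    replace (S z + RtoC t - S z) with (RtoC t) in H1 by ring.
    rewrite Cmod_R, Rabs_pos_eq in H1 by lra.
    assert (Htn : RtoC t <> 0) by (intros X; apply RtoC_inj in X; lra).
    replace ((z - F t z) / RtoC t - - / S' z) with (- ((F t z - z - RtoC t / S' z) / RtoC t))
      by (field; auto).
    rewrite Cmod_opp, Cmod_div, Cmod_R, Rabs_pos_eq by (auto; lra).
    apply Rmult_lt_reg_r with t; auto. unfold Rdiv at 1.
    rewrite Rmult_assoc, Rinv_l, Rmult_1_r by lra. nra.
Qed.

Lemma fst_RtoC_mult (r : R) (z : C) : fst (RtoC r * z) = (r * fst z)%R.
Proof. destruct z; simpl. ring. Qed.

(** The right side of Schwarz-Pick vanishes, so [g z = - Cconj (g z0)], which equals [g z0] since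
    [g z0] is purely imaginary. *)
Lemma Re_zero_const (g : C -> C) (z0 : C) :
  (forall z, in_disk z -> cdiff g z) -> (forall z, in_disk z -> (0 <= fst (g z))%R) ->
  in_disk z0 -> fst (g z0) = 0%R -> forall z, in_disk z -> g z = g z0.
Proof.
  intros Hg Hp Hz0 E z Hz.
  pose proof (Schwarz_Pick_disk g Hg Hp z z0 Hz Hz0) as H. rewrite E, !Rmult_0_r in H.
  apply in_disk_sq in Hz. apply in_disk_sq in Hz0.
  assert (HA : (0 < (1 - Cmod z ^ 2) * (1 - Cmod z0 ^ 2))%R) by (apply Rmult_lt_0_compat; lra).
  assert (H0 : Cmod (g z + Cconj (g z0)) = 0%R).
  { apply Rle_antisym; [|apply Cmod_ge_0]. apply Cmod_le_sq; [lra|].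
    apply Rmult_le_reg_r with (1 := HA). rewrite pow_i, Rmult_0_l by lia. exact H. }
  apply Cmod_eq_0 in H0. destruct (g z) as [a b], (g z0) as [a0 b0]. simpl in E. subst a0.
  unfold Cplus, Cconj in H0; simpl in H0. injection H0 as h1 h2.
  f_equal; lra.
Qed.

Lemma Re_Cinv_ge_0 (z : C) : z <> 0 -> (0 <= fst z)%R -> (0 <= fst (/ z)%C)%R.
Proof.
  intros Hz H. apply Cmod_gt_0 in Hz. assert (0 < Cmod z ^ 2)%R by now apply pow_lt.
  rewrite Cmod_sq in *. destruct z as [a b]. simpl in *. apply Rmult_le_pos; auto.
  left. apply Rinv_0_lt_compat. nra.
Qed.

(** [flow_exists] needs a strictly positive real part. If the real part vanishes somewhere, [q] is a
    nonzero constant and can be rotated; otherwise [la = 1] works. *)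
Lemma rotate_to_positive (q : C -> C) :
  (forall z, in_disk z -> cdiff q z) -> (forall z, in_disk z -> (0 <= fst (q z))%R) ->
  (forall z, in_disk z -> q z <> 0) ->
  exists la, Cmod la = 1%R /\ forall z, in_disk z -> (0 < fst (la * q z)%C)%R.
Proof.
  intros Hq Hp H0.
  destruct (classic (exists z0, in_disk z0 /\ fst (q z0) = 0%R)) as [[z0 [Hz0 E]]|Hn].
  - destruct (Cmod_unit_dir (q z0) (H0 z0 Hz0)) as [la [H1 H2]]. exists la. split; auto.
    intros z Hz. rewrite (Re_zero_const q z0) by auto. rewrite H2. apply Cmod_gt_0. auto.
  - exists 1. split; [apply Cmod_1|]. intros z Hz. rewrite Cmult_1_l.
    destruct (Hp z Hz) as [H|H]; auto. exfalso. apply Hn. exists z. auto.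
Qed.

Lemma has_cderiv_cayley z : in_disk z -> has_cderiv cayley z ((1 + 1) / ((1 - z) * (1 - z))).
Proof.
  intros Hz. pose proof (disk_neq_1 z Hz) as H1.
  assert (Hm : has_cderiv (fun z => 1 - z) z (- (1))).
  { replace (- (1)) with (0 + (0 * z + (- (1)) * 1)) by ring.
    apply has_cderiv_ext with (fun z => 1 + (- (1)) * z). intros; ring.
    apply has_cderiv_plus; [apply has_cderiv_const|].
    apply (has_cderiv_mult (fun _ => - (1))); [apply has_cderiv_const|apply has_cderiv_id]. }
  assert (Hp : has_cderiv (fun z => 1 + z) z (0 + 1)).
  { apply has_cderiv_plus; [apply has_cderiv_const|apply has_cderiv_id]. }
  generalize (has_cderiv_mult _ _ _ _ _ Hp (has_cderiv_inv _ _ _ Hm H1)).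
  replace ((0 + 1) * / (1 - z) + (1 + z) * (- / ((1 - z) * (1 - z)) * - (1)))
    with ((1 + 1) / ((1 - z) * (1 - z))) by (field; auto).
  auto.
Qed.

Lemma generator_of_positive (p : C -> C) :
  (forall z, in_disk z -> cdiff p z) -> (forall z, in_disk z -> (0 <= fst (p z))%R) ->
  (forall z, in_disk z -> p z <> 0) ->
  is_holomorphic_generator (fun z => - ((1 - z) * (1 - z) * p z)).
Proof.
  intros Hpd Hpp Hp0.
  set (q := fun z => / p z).
  assert (Hqd : forall z, in_disk z -> cdiff q z) by (intros; apply cdiff_inv; auto).
  assert (Hqp : forall z, in_disk z -> (0 <= fst (q z))%R) by (intros; apply Re_Cinv_ge_0; auto).
  assert (Hq0 : forall z, in_disk z -> q z <> 0).
  { intros z Hz E. apply C1_nz. rewrite <- (Cinv_r (p z)) by auto. fold (q z). rewrite E. ring. }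
  destruct (rotate_to_positive q Hqd Hqp Hq0) as [la [Hla Hlaq]].
  (* The factor [1 / 2] compensates the 2 in [cayley' z = 2 / (1 - z)^2], so the generator becomes
     [- (1 - z)^2 * p z]. *)
  set (Q := fun w => RtoC (/ 2) * q (cayley_inv w)).
  assert (HQd : forall w, in_H w -> cdiff Q w).
  { intros w Hw. unfold Q. apply cdiff_mult; [apply cdiff_const|].
    apply (cdiff_comp q cayley_inv); [apply Hqd, cayley_inv_in_disk; auto|now apply cdiff_cayley_inv].
    }
  assert (HQp : forall w, in_H w -> (0 <= fst (Q w))%R).
  { intros w Hw. specialize (Hqp _ (cayley_inv_in_disk w Hw)). unfold Q. rewrite fst_RtoC_mult. lra.
    }
  assert (HlaQ : forall w, in_H w -> (0 < fst (la * Q w)%C)%R).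
  { intros w Hw. specialize (Hlaq _ (cayley_inv_in_disk w Hw)). unfold Q.
    replace (la * (RtoC (/ 2) * q (cayley_inv w))) with (RtoC (/ 2) * (la * q (cayley_inv w))) by ring.
    rewrite fst_RtoC_mult. lra. }
  assert (HQ0 : forall w, in_H w -> Q w <> 0).
  { intros w Hw E. specialize (HlaQ w Hw). rewrite E, Cmult_0_r in HlaQ. simpl in HlaQ. lra. }
  set (sigma := primitive_H Q).
  assert (Hs : forall w, in_H w -> has_cderiv sigma w (Q w)) by (intros; now apply primitive_H_deriv).
  assert (HlaQd : forall z, in_H z -> cdiff (fun z => la * Q z) z) by (intros; apply cdiff_mult;
    [apply cdiff_const|auto]).
  assert (Hexp : forall x A w0, (0 < x)%R -> in_H w0 -> exists m, (0 < m)%R /\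
     forall a b, H_cell x A w0 a -> H_cell x A w0 b -> (m * Cmod (b - a) <= Cmod (sigma b - sigma a))%R).
  { intros x A w0 Hx Hw0.
    destruct (H_cell_lower (fun z => la * Q z) x A w0 HlaQd HlaQ Hw0 Hx) as [m [Hm0 Hm]].
    exists m. split; auto. intros a b Ha Hb. apply (expanding sigma Q a b la m Hla).
    - intros s Hs'. apply Hs. destruct (H_cell_segment x A w0 a b s Ha Hb Hs') as [H _].
      unfold in_H. lra.
    - intros s Hs'. apply Hm, H_cell_segment; auto. }
  assert (Hinj : forall a b, in_H a -> in_H b -> sigma a = sigma b -> a = b).
  { intros a b Ha Hb E.
    (* The smallest cell centred at [a] that contains both points. *)
    destruct (Hexp (Rmin (fst a) (fst b)) (Cmod (b - a)) a (Rmin_pos _ _ Ha Hb) Ha) as [m [Hm H]].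
    assert (Hz : (m * Cmod (b - a) <= 0)%R).
    { rewrite <- Cmod_0. replace (RtoC 0) with (sigma b - sigma a) by (rewrite E; ring). apply H.
      - split; [apply Rmin_l|]. rewrite Cminus_diag. rewrite Cmod_0. apply Cmod_ge_0.
      - split; [apply Rmin_r|]. lra. }
    assert (Hz' : Cmod (b - a) = 0%R) by (pose proof (Cmod_ge_0 (b - a)); nra).
    apply Cmod_eq_0 in Hz'. replace b with ((b - a) + a) by ring. rewrite Hz'. ring. }
  pose (c := fun t w => (t * (Cmod (/ Q w) / fst w))%R).
  pose (Phi_spec := fun t w u => (fst w <= fst u)%R /\ (Cmod (u - w)
    <= c t w * (fst w * exp (2 * c t w)))%R /\ sigma u = sigma w + RtoC t).
  (* The flow is selected pointwise; its regularity is recovered afterwards from the estimates kept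
     in [Phi_spec]. *)
  pose (Phi := fun t w => epsilon (inhabits (RtoC 0)) (Phi_spec t w)).
  assert (HPhi : forall t w, (0 <= t)%R -> in_H w -> Phi_spec t w (Phi t w)).
  { intros t w Ht Hw. apply epsilon_spec. apply (flow_exists Q sigma la w t); auto. }
  assert (HPhiH : forall t w, (0 <= t)%R -> in_H w -> in_H (Phi t w)).
  { intros t w Ht Hw. destruct (HPhi t w Ht Hw) as [H _]. unfold in_H in *. lra. }
  assert (HPhic : forall t w, (0 <= t)%R -> in_H w -> forall e, (0 < e)%R -> exists d, (0 < d)%R /\
     forall s y, (0 <= s)%R -> in_H y -> (Rabs (s - t) < d)%R -> (Cmod (y - w) < d)%R ->
       (Cmod (Phi s y - Phi t w) < e)%R).
  { intros t w Ht Hw e He. pose proof Hw as Hx. unfold in_H in Hx. set (x0 := fst w) in *.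
    destruct (H_cell_bound (fun z => / Q z) (x0 / 2) (x0 / 2) w) as [M [HM0 HM]]; auto; try lra.
    { intros; apply cdiff_inv; auto. } { intros; apply Re_Cinv_ge_0; auto. }
    (* [c1] bounds [c s y] for all [s <= t + 1] and [|y - w| <= x0 / 2], and [A] the resulting
       distance from [w]. All these end points share one cell, where expansion by [sigma] turns
       closeness of the images into closeness of the points. *)
    set (c1 := ((t + 1) * (M / (x0 / 2)))%R).
    set (A := (x0 / 2 + c1 * (3 * x0 / 2 * exp (2 * c1)))%R).
    assert (Hstay : forall s y, (0 <= s)%R -> in_H y -> (s <= t + 1)%R -> (Cmod (y - w)
      <= x0 / 2)%R -> H_cell (x0 / 2) A w (Phi s y)).
    { intros s y Hs0 Hy Hst Hyw. destruct (HPhi s y Hs0 Hy) as (P1 & P2 & _).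
      assert (Hyx : (x0 / 2 <= fst y <= 3 * x0 / 2)%R).
      { generalize (Rabs_fst_le_Cmod (y - w)). simpl. intros H. apply Rabs_le_between in H.
        unfold x0 in *. lra. }
      split; [lra|]. eapply Rle_trans; [apply (Cmod_triangle_minus _ y)|]. unfold A.
      assert (Hc0 : (0 <= c s y)%R).
      { unfold c. apply Rmult_le_pos; auto. apply Rmult_le_pos; [apply Cmod_ge_0|].
        left; apply Rinv_0_lt_compat; lra. }
      assert (Hc1 : (c s y <= c1)%R).
      { unfold c, c1. apply Rmult_le_compat; auto. apply Rmult_le_pos; [apply Cmod_ge_0|].
        left; apply Rinv_0_lt_compat; lra.
        apply Rmult_le_compat; [apply Cmod_ge_0| left; apply Rinv_0_lt_compat; lra | apply HM;
          split; lra | apply Rinv_le_contravar; lra].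
        }
      assert (He1 : (exp (2 * c s y) <= exp (2 * c1))%R).
      { destruct (Req_dec (c s y) c1) as [->|]; [lra|]. left. apply exp_increasing. lra. }
      pose proof (exp_pos (2 * c s y)) as Hep.
      assert ((c s y * (fst y * exp (2 * c s y)) <= c1 * (3 * x0 / 2 * exp (2 * c1)))%R).
      { apply Rmult_le_compat; auto. apply Rmult_le_pos; lra. apply Rmult_le_compat; lra. }
      lra. }
    destruct (Hexp (x0 / 2)%R A w ltac:(lra) Hw) as [m [Hm0 Hm]].
    destruct (has_cderiv_ccont _ _ _ (Hs w Hw) (e * m / 2)%R ltac:(nra)) as [d [Hd H]].
    exists (Rmin (Rmin d (x0 / 2)) (Rmin 1 (e * m / 2))). split.
    { apply Rmin_pos; apply Rmin_pos; try lra. nra. }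
    intros s y Hs0 Hy Hst Hyw.
    assert (Y1 : (Cmod (y - w) < d)%R). { lt_Rmin Hyw. }
    assert (Y2 : (Cmod (y - w) < x0 / 2)%R). { lt_Rmin Hyw. }
    assert (Y3 : (Rabs (s - t) < 1)%R). { lt_Rmin Hst. }
    assert (Y4 : (Rabs (s - t) < e * m / 2)%R). { lt_Rmin Hst. }
    apply Rabs_def2 in Y3.
    assert (C1 : H_cell (x0 / 2) A w (Phi t w)).
    { apply Hstay; auto; try lra. rewrite Cminus_diag. rewrite Cmod_0; lra. }
    assert (C2 : H_cell (x0 / 2) A w (Phi s y)) by (apply Hstay; auto; lra).
    specialize (Hm _ _ C1 C2).
    destruct (HPhi s y Hs0 Hy) as (_ & _ & E1). destruct (HPhi t w Ht Hw) as (_ & _ & E2).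
    rewrite E1, E2 in Hm.
    replace (sigma y + RtoC s - (sigma w + RtoC t))
      with ((sigma y - sigma w) + RtoC (s - t)) in Hm by (rewrite RtoC_minus; ring).
    pose proof (Cmod_triangle (sigma y - sigma w) (RtoC (s - t))) as Htri. rewrite Cmod_R in Htri.
    specialize (H y Y1). apply Rmult_lt_reg_l with m; auto. lra. }
  pose (F := fun t z => cayley_inv (Phi t (cayley z))).
  destruct (koenigs_generator (fun z => sigma (cayley z)) (fun z => Q (cayley z) * ((1 + 1)
    / ((1 - z) * (1 - z)))) F) as [HF Hgen].
  - intros z Hz.
    apply (has_cderiv_comp sigma cayley); [apply Hs, cayley_in_H; auto | now apply has_cderiv_cayley].
  - intros z Hz. pose proof (disk_neq_1 z Hz). apply Cmult_neq_0; [apply HQ0, cayley_in_H; auto|].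
    apply Cmult_neq_0. apply Re_pos_nz; simpl; lra. 
    intros E. apply C1_nz. rewrite <- (Cinv_r ((1 - z) * (1 - z))) by (apply Cmult_neq_0; auto).
    rewrite E. ring.
  - intros z w Hz Hw E. rewrite <- (cayley_inv_cayley z), <- (cayley_inv_cayley w) by auto. f_equal.
    apply Hinj; auto using cayley_in_H.
  - intros t z Ht Hz. apply cayley_inv_in_disk, HPhiH; auto using cayley_in_H.
  - intros t z Ht Hz. unfold F. rewrite cayley_cayley_inv by (apply HPhiH; auto using cayley_in_H).
    apply (HPhi t (cayley z)); auto using cayley_in_H.
  - intros t z Ht Hz e He.
    pose proof (HPhiH t (cayley z) Ht (cayley_in_H z Hz)) as HP.
    destruct (cdiff_ccont _ _ (cdiff_cayley_inv _ HP) e He) as [d1 [Hd1 H1]].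
    destruct (HPhic t (cayley z) Ht (cayley_in_H z Hz) d1 Hd1) as [d2 [Hd2 H2]].
    destruct (cdiff_ccont _ _ (cdiff_cayley z Hz) d2 Hd2) as [d3 [Hd3 H3]].
    exists (Rmin d2 d3). split; [now apply Rmin_pos|]. intros s y Hs0 Hy Hst Hyz.
    apply H1, H2; auto using cayley_in_H.
    + lt_Rmin Hst.
    + apply H3. lt_Rmin Hyz.
  - exists F. split; auto. split.
    + intros z Hz. apply cdiff_ex_derive. cdiff_auto. auto.
    + intros z Hz. specialize (Hgen z Hz). cbv beta in Hgen.
      replace (- ((1 - z) * (1 - z) * p z)) with (- / (Q (cayley z) * ((1 + 1) / ((1 - z) * (1 - z))))); auto.
      unfold Q. rewrite cayley_inv_cayley by auto. unfold q. pose proof (disk_neq_1 z Hz).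
      pose proof (Hp0 z Hz).
      assert (H2 : RtoC 2 <> 0) by (apply Re_pos_nz; simpl; lra).
      rewrite RtoC_inv by lra. field. repeat split; auto; exact H2.
Qed.

(** * Wolff's lemma *)

(** Closes the arguments with a vanishing error [e]. Differentiability serves as a criterion for
    continuity at 0 that [auto_derive] settles for explicit expressions. *)
Lemma le_limit_0 (phi psi : R -> R) (r : R) : (0 < r)%R -> ex_derive phi 0 -> ex_derive psi 0 ->
  (forall e, (0 < e < r)%R -> (phi e <= psi e)%R) -> (phi 0 <= psi 0)%R.
Proof.
  intros Hr Hf Hg H.
  assert (Hc : forall g : R -> R, ex_derive g 0 -> forall e, (0 < e)%R ->
    exists d, (0 < d)%R /\ forall x, (0 < x < d)%R -> (Rabs (g x - g 0) < e)%R).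
  { intros g Hd e He. apply (ex_derive_continuous (K := R_AbsRing) (V := R_NormedModule)) in Hd.
    destruct (proj1 (filterlim_locally (U := R_UniformSpace) g (g 0%R)) Hd (mkposreal e He)) as [d H'].
    exists d. split; [apply cond_pos|]. intros x Hx. apply (H' x).
    change (Rabs (x - 0) < d)%R. rewrite Rminus_0_r, Rabs_pos_eq; lra. }
  apply Rnot_lt_le. intros Hlt. set (e := ((phi 0 - psi 0) / 2)%R).
  destruct (Hc phi Hf e ltac:(unfold e; lra)) as [d1 [Hd1 H1]].
  destruct (Hc psi Hg e ltac:(unfold e; lra)) as [d2 [Hd2 H2]].
  set (x := (Rmin (Rmin d1 d2) r / 2)%R).
  assert (Hx : (0 < x /\ x < d1 /\ x < d2 /\ x < r)%R).
  { unfold x. assert (0 < Rmin (Rmin d1 d2) r)%R by (repeat apply Rmin_pos; auto).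
    pose proof (Rmin_l (Rmin d1 d2) r). pose proof (Rmin_r (Rmin d1 d2) r).
    pose proof (Rmin_l d1 d2). pose proof (Rmin_r d1 d2). lra. }
  specialize (H1 x ltac:(lra)). specialize (H2 x ltac:(lra)). specialize (H x ltac:(lra)).
  apply Rabs_def2 in H1. apply Rabs_def2 in H2. unfold e in *. lra.
Qed.

Lemma disk_0 : in_disk 0.
Proof. unfold in_disk. rewrite Cmod_0. lra. Qed.

Lemma cayley_0 : cayley 0 = 1.
Proof. unfold cayley. field. Qed.

(* Julia's inequality at the Denjoy-Wolff point.  The heights
   [Re (1 / cayley (F (k t) 0))] are positive and tend to 0, so infinitely
   often they do not increase; for such [k] the Schwarz-Pick inequality between
   [z] and [F (k t) 0] passes to the limit. *)
Lemma Wolff_horodisks (F : R -> C -> C) : is_semigroup F -> is_Denjoy_Wolff_point F 1 ->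
  forall t z, (0 <= t)%R -> in_disk z -> (fst (cayley z) <= fst (cayley (F t z)))%R.
Proof.
  intros HF [_ HDW] t z Ht Hz.
  destruct (Rle_lt_or_eq_dec 0 t Ht) as [Htp|E0].
  2: { subst t. rewrite (semigroup_zero F HF z Hz). lra. }
  clear Ht.
  pose (b := fun k : nat => F (INR k * t)%R 0).
  assert (Hkt : forall k, (0 <= INR k * t)%R) by (intros k; apply Rmult_le_pos; [apply pos_INR|lra]).
  assert (Hb : forall k, in_disk (b k)) by (intros k; apply (semigroup_self_map F HF); [auto|apply disk_0]).
  assert (HbS : forall k, b (S k) = F t (b k)).
  { intros k. unfold b. rewrite S_INR. replace ((INR k + 1) * t)%R with (t + INR k * t)%R by ring.
    apply (semigroup_add F HF); [lra|auto|apply disk_0]. }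
  assert (Hlim : forall e, (0 < e)%R -> exists K, forall k, (K <= k)%nat -> (Cmod (b k - 1) < e)%R).
  { intros e He. destruct (proj1 (filterlim_C_Cmod _ _ _) (HDW 0 disk_0) e He) as [M HM].
    exists (S (Z.to_nat (up (M / t)))). intros k Hk. apply HM.
    apply Rlt_le_trans with (IZR (up (M / t)) * t)%R.
    - destruct (archimed (M / t)) as [h _]. apply Rmult_lt_compat_r with (r := t) in h; auto.
      unfold Rdiv in h. rewrite Rmult_assoc, Rinv_l in h by lra. lra.
    - apply Rmult_le_compat_r; [lra|]. apply Rle_trans with (INR (Z.to_nat (up (M / t)))).
      + rewrite INR_IZR_INZ. apply IZR_le. lia.
      + apply le_INR. lia. }
  (* The height [Re ((1 - b k) / (1 + b k))], written with moduli. *)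
  pose (c := fun k => ((1 - Cmod (b k) ^ 2) / Cmod (1 + b k) ^ 2)%R).
  assert (Hplus : forall w, in_disk w -> 1 + w <> 0).
  { intros w Hw. replace (1 + w) with (1 - - w) by ring. apply disk_neq_1. now apply in_disk_opp. }
  assert (Hcpos : forall k, (0 < c k)%R).
  { intros k. specialize (Hb k). pose proof (Hplus _ Hb) as H1. apply Cmod_gt_0 in H1.
    apply in_disk_sq in Hb.
    apply Rdiv_lt_0_compat; [lra|now apply pow_lt]. }
  assert (Hclim : forall e, (0 < e)%R -> exists K, forall k, (K <= k)%nat -> (c k < e)%R).
  { intros e He. destruct (Hlim (Rmin 1 (e / 4))) as [K HK]; [apply Rmin_pos; lra|].
    exists K. intros k Hk. specialize (HK k Hk). specialize (Hb k). unfold in_disk in Hb.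
    assert (G1 : (Cmod (b k - 1) < 1)%R) by (lt_Rmin HK).
    assert (G2 : (Cmod (b k - 1) < e / 4)%R) by (lt_Rmin HK).
    assert (G3 : (1 < Cmod (1 + b k))%R).
    { generalize (Cmod_rev_triangle (1 + 1) (1 - b k)).
      replace (1 + 1 - (1 - b k)) with (1 + b k) by ring.
      rewrite (Cmod_minus_sym 1 (b k)). replace (Cmod (1 + 1)) with 2%R; [lra|].
      rewrite <- RtoC_plus, Cmod_R, Rabs_pos_eq; lra. }
    assert (G4 : (1 - Cmod (b k) <= Cmod (b k - 1))%R).
    { rewrite Cmod_minus_sym. generalize (Cmod_rev_triangle 1 (b k)). rewrite Cmod_1. auto. }
    pose proof (Cmod_ge_0 (b k)) as G0.
    unfold c. apply Rmult_lt_reg_r with (Cmod (1 + b k) ^ 2)%R; [apply pow_lt; lra|].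
    unfold Rdiv. rewrite Rmult_assoc, Rinv_l, Rmult_1_r by (apply pow_nonzero; lra).
    assert (1 < Cmod (1 + b k) ^ 2)%R by nra. nra. }
  (* If [c] increased at every index from [K] on, it would stay above [c K > 0], against its limit
     0. *)
  assert (Hinf : forall K, exists k, (K <= k)%nat /\ (c (S k) <= c k)%R).
  { intros K. apply NNPP. intros Hn.
    assert (Hinc : forall j, (c K <= c (K + j)%nat)%R).
    { induction j; [rewrite Nat.add_0_r; lra|]. rewrite Nat.add_succ_r.
      destruct (Rle_dec (c (S (K + j))) (c (K + j)%nat)) as [H|H]; [|lra].
      exfalso. apply Hn. exists (K + j)%nat. split; [lia|auto]. }
    destruct (Hclim (c K) (Hcpos K)) as [K' HK']. specialize (HK' (K + K')%nat ltac:(lia)).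
    specialize (Hinc K'). lra. }
  set (u := F t z). assert (Hu : in_disk u) by (apply (semigroup_self_map F HF); auto; lra).
  set (g := fun x => cayley (F t x)).
  assert (Hgd : forall x, in_disk x -> cdiff g x).
  { intros x Hx. apply (cdiff_comp cayley (F t)).
    - apply cdiff_cayley, (semigroup_self_map F HF); auto; lra.
    - apply cdiff_ex_derive, (semigroup_holomorphic F HF); auto; lra. }
  assert (Hgp : forall x, in_disk x -> (0 <= fst (g x))%R).
  { intros x Hx. left. apply cayley_in_H, (semigroup_self_map F HF); auto; lra. }
  set (G := Cmod (cayley u)). pose proof (Cmod_ge_0 (cayley u)) as HG. fold G in HG.
  (* Schwarz-Pick multiplied by [|1 - b (S k)|^2], since [cayley (b (S k))] is unbounded. The factor
     [1 - G * e] accounts for [cayley u], which is negligible beside it; the bound on [e] keeps this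
     factor positive. *)
  assert (Hkey : forall e, (0 < e < Rmin 1 (/ (G + 1)))%R ->
    ((1 - G * e) ^ 2 * ((2 - e) ^ 2 * (1 - Cmod z ^ 2)) <= 4 * (Cmod (1 - z) + e) ^ 2 * fst (cayley u))%R).
  { intros e [He0 He].
    assert (He1 : (e < 1)%R) by (lt_Rmin He).
    assert (HeG : (e * (G + 1) < 1)%R).
    { assert (H : (e < / (G + 1))%R) by (lt_Rmin He).
      apply Rmult_lt_compat_r with (r := (G + 1)%R) in H; [|lra]. rewrite Rinv_l in H; lra. }
    destruct (Hlim e He0) as [K HK]. destruct (Hinf K) as [k [Hk Hck]].
    pose proof (HK k Hk) as B1. pose proof (HK (S k) ltac:(lia)) as B2.
    pose proof (Schwarz_Pick_disk g Hgd Hgp z (b k) Hz (Hb k)) as SP.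
    assert (Egb : g (b k) = cayley (b (S k))) by (unfold g; now rewrite <- HbS).
    rewrite Egb in SP. change (g z) with (cayley u) in SP.
    pose proof (Hb k) as D0. pose proof (Hb (S k)) as D1.
    pose proof (disk_neq_1 _ D1) as N1. pose proof (Hplus _ D1) as N2.
    pose proof (Hplus _ D0) as N3.
    (* Here [c (S k)] is split off, in [E1] it is [c k]; the choice of [k] lets the two cancel in
       the right direction. *)
    assert (Efst : (fst (cayley (b (S k))) = c (S k) * (Cmod (1 + b (S k)) ^ 2 / Cmod (1 - b (S k)) ^ 2))%R).
    { rewrite fst_cayley by auto. unfold c. apply Cmod_gt_0 in N1. apply Cmod_gt_0 in N2. field.
      lra. }
    assert (E1 : (1 - Cmod (b k) ^ 2 = c k * Cmod (1 + b k) ^ 2)%R).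
    { unfold c. apply Cmod_gt_0 in N3. field. lra. }
    assert (Efac : (Cmod (cayley u + Cconj (cayley (b (S k)))) * Cmod (1 - b (S k))
      = Cmod (Cconj (cayley u) * (1 - b (S k)) + (1 + b (S k))))%R).
    { rewrite <- (Cmod_conj (cayley u + Cconj (cayley (b (S k))))), <- Cmod_mult. f_equal.
      rewrite Cplus_conj, Cconj_conj. unfold cayley at 2. field. auto. }
    set (m1 := Cmod (1 - b (S k))) in *. set (p1 := Cmod (1 + b (S k))) in *.
    set (p0 := Cmod (1 + b k)) in *.
    assert (Hm1 : (0 < m1)%R) by now apply Cmod_gt_0.
    assert (Hp1 : (0 < p1)%R) by now apply Cmod_gt_0.
    assert (Hp1' : (p1 < 2)%R).
    { unfold p1. eapply Rle_lt_trans; [apply Cmod_triangle|]. rewrite Cmod_1. unfold in_disk in D1.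
      lra. }
    assert (Hm1e : (m1 < e)%R) by (unfold m1; now rewrite Cmod_minus_sym).
    assert (Hp0 : (2 - e <= p0)%R).
    { unfold p0. generalize (Cmod_rev_triangle (1 + 1) (1 - b k)).
      replace (1 + 1 - (1 - b k)) with (1 + b k) by ring.
      rewrite (Cmod_minus_sym 1 (b k)). replace (Cmod (1 + 1)) with 2%R; [lra|].
      rewrite <- RtoC_plus, Cmod_R, Rabs_pos_eq; lra. }
    rewrite Efst, E1 in SP.
    set (A := Cmod (cayley u + Cconj (cayley (b (S k))))) in *.
    assert (HAm : (p1 * (1 - G * e) <= A * m1)%R).
    { rewrite Efac.
      generalize (Cmod_rev_triangle (1 + b (S k)) (- (Cconj (cayley u) * (1 - b (S k))))).
      rewrite Cmod_opp, Cmod_mult, Cmod_conj. fold G m1 p1.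
      replace (1 + b (S k) - - (Cconj (cayley u) * (1 - b (S k))))
        with (Cconj (cayley u) * (1 - b (S k)) + (1 + b (S k))) by ring.
      intros HR.
      (* [m1 < e] and [1 <= p1] give [m1 <= p1 * e]. *)
      assert (Hp11 : (2 - e <= p1)%R).
      { unfold p1. generalize (Cmod_rev_triangle (1 + 1) (1 - b (S k))).
        replace (1 + 1 - (1 - b (S k))) with (1 + b (S k)) by ring.
        rewrite (Cmod_minus_sym 1 (b (S k))). replace (Cmod (1 + 1)) with 2%R; [lra|].
        rewrite <- RtoC_plus, Cmod_R, Rabs_pos_eq; lra. }
      assert (m1 <= p1 * e)%R by nra. nra. }
    assert (HBz : (Cmod (1 - Cconj (b k) * z) <= Cmod (1 - z) + e)%R).
    { replace (1 - Cconj (b k) * z) with ((1 - z) + (Cconj (1 - b k)) * z).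
      2: { rewrite Cminus_conj. rewrite (Cconj_RtoC 1). ring. }
      eapply Rle_trans; [apply Cmod_triangle|].
      rewrite Cmod_mult, Cmod_conj, (Cmod_minus_sym 1 (b k)).
      unfold in_disk in Hz. pose proof (Cmod_ge_0 z). pose proof (Cmod_ge_0 (b k - 1)). nra. }
    assert (Hu0 : (0 < fst (cayley u))%R) by now apply cayley_in_H.
    pose proof (Hcpos k) as Hck0. 
    assert (Hz1 : (0 < 1 - Cmod z ^ 2)%R) by (apply in_disk_sq in Hz; lra).
    assert (SP2 : (A ^ 2 * ((1 - Cmod z ^ 2) * p0 ^ 2) * m1 ^ 2
      <= 4 * Cmod (1 - Cconj (b k) * z) ^ 2 * fst (cayley u) * p1 ^ 2)%R).
    { apply Rmult_le_reg_l with (c k); auto.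
      apply Rle_trans with (4 * Cmod (1 - Cconj (b k) * z) ^ 2 * (fst (cayley u) * (c (S k)
        * (p1 ^ 2 / m1 ^ 2))) * m1 ^ 2)%R.
      - replace (c k * (A ^ 2 * ((1 - Cmod z ^ 2) * p0 ^ 2) * m1 ^ 2))%R
        with (A ^ 2 * ((1 - Cmod z ^ 2) * (c k * p0 ^ 2)) * m1 ^ 2)%R by ring.
        apply Rmult_le_compat_r; [apply pow2_ge_0|exact SP].
      - replace (4 * Cmod (1 - Cconj (b k) * z) ^ 2 * (fst (cayley u) * (c (S k)
        * (p1 ^ 2 / m1 ^ 2))) * m1 ^ 2)%R with
          (c (S k) * (4 * Cmod (1 - Cconj (b k) * z) ^ 2 * fst (cayley u) * p1 ^ 2))%R by (field; lra).
        apply Rmult_le_compat_r; auto.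
        apply Rmult_le_pos; [|apply pow2_ge_0]. apply Rmult_le_pos; [|lra].
        apply Rmult_le_pos; [lra|apply pow2_ge_0]. }
    assert (HGe : (0 <= 1 - G * e)%R) by nra.
    apply Rmult_le_reg_r with (p1 ^ 2)%R; [now apply pow_lt|].
    apply Rle_trans with (4 * Cmod (1 - Cconj (b k) * z) ^ 2 * fst (cayley u) * p1 ^ 2)%R.
    - eapply Rle_trans; [|exact SP2].
      replace ((1 - G * e) ^ 2 * ((2 - e) ^ 2 * (1 - Cmod z ^ 2)) * p1 ^ 2)%R
        with ((p1 * (1 - G * e)) ^ 2 * ((2 - e) ^ 2 * (1 - Cmod z ^ 2)))%R by ring.
      replace (A ^ 2 * ((1 - Cmod z ^ 2) * p0 ^ 2) * m1 ^ 2)%R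
        with ((A * m1) ^ 2 * (p0 ^ 2 * (1 - Cmod z ^ 2)))%R by ring.
      apply Rmult_le_compat.
      + apply pow2_ge_0.
      + apply Rmult_le_pos; [apply pow2_ge_0|lra].
      + apply pow_incr. split; auto. apply Rmult_le_pos; lra.
      + apply Rmult_le_compat_r; [lra|]. apply pow_incr. lra.
    - apply Rmult_le_compat_r; [apply pow2_ge_0|]. apply Rmult_le_compat_r; [lra|].
      apply Rmult_le_compat_l; [lra|].
      apply pow_incr. split; [apply Cmod_ge_0|auto]. }
  assert (HR : (0 < Rmin 1 (/ (G + 1)))%R) by (apply Rmin_pos; [lra|]; apply Rinv_0_lt_compat; lra).
  pose proof (le_limit_0 (fun e => (1 - G * e) ^ 2 * ((2 - e) ^ 2 * (1 - Cmod z ^ 2)))%R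
    (fun e => 4 * (Cmod (1 - z) + e) ^ 2 * fst (cayley u))%R _ HR ltac:(auto_derive;
      auto) ltac:(auto_derive; auto) Hkey) as HL.
  cbv beta in HL. rewrite Rmult_0_r, !Rminus_0_r, Rplus_0_r, pow1, Rmult_1_l in HL.
  rewrite (fst_cayley z) by now apply disk_neq_1.
  pose proof (disk_neq_1 z Hz) as Nz. apply Cmod_gt_0 in Nz.
  apply Rmult_le_reg_r with (Cmod (1 - z) ^ 2)%R; [now apply pow_lt|].
  unfold Rdiv. rewrite Rmult_assoc, Rinv_l, Rmult_1_r by (apply pow_nonzero; lra). fold u. lra.
Qed.

(** * Berkson-Porta, Julia-Wolff-Caratheodory, Julia *)

Lemma fst_Cplus (a b : C) : fst (a + b) = (fst a + fst b)%R.
Proof. reflexivity. Qed.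

Lemma generator_increment (F : R -> C -> C) (f : C -> C) (z : C) :
  is_generator_of f F -> in_disk z -> forall e, (0 < e)%R -> exists d, (0 < d)%R /\
  forall t, (0 < t < d)%R -> (Cmod (F t z - z + RtoC t * f z) <= e * t)%R.
Proof.
  intros [_ Hg] Hz e He. destruct (proj1 (filterlim_C_Cmod _ _ _) (Hg z Hz) e He) as [d H].
  exists d. split; [apply cond_pos|]. intros t Ht.
  assert (Htb : ball 0%R d t) by (change (Rabs (t - 0) < d)%R; rewrite Rminus_0_r, Rabs_pos_eq; lra).
  specialize (H t Htb (proj1 Ht)).
  assert (Htn : RtoC t <> 0) by (intros X; apply RtoC_inj in X; lra).
  replace (F t z - z + RtoC t * f z) with (- RtoC t * ((z - F t z) / RtoC t - f z)) by (field; auto).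
  rewrite Cmod_mult, Cmod_opp, Cmod_R, Rabs_pos_eq by lra. nra.
Qed.

(** By [Wolff_horodisks] the real part of [cayley (F t z)] has a nonnegative right derivative at
    [t = 0]. That derivative is the real part of [- cayley' z * f z], twice the quantity claimed. *)
Lemma generator_Re_pos (F : R -> C -> C) (f : C -> C) :
  is_semigroup F -> is_generator_of f F -> is_Denjoy_Wolff_point F 1 ->
  forall z, in_disk z -> (0 <= fst (- f z / ((1 - z) * (1 - z)))%C)%R.
Proof.
  intros HF Hg HDW z Hz. pose proof (disk_neq_1 z Hz) as N.
  assert (NN : (1 - z) * (1 - z) <> 0) by now apply Cmult_neq_0.
  pose proof (has_cderiv_cayley z Hz) as HL. set (l := (1 + 1) / ((1 - z) * (1 - z))) in *.
  replace (- f z / ((1 - z) * (1 - z))) with (RtoC (/ 2) * (l * - f z)).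
  2: { unfold l. rewrite RtoC_inv by lra. field. repeat split; auto. }
  rewrite fst_RtoC_mult. set (x := fst (l * - f z)).
  set (m := Cmod (f z)). pose proof (Cmod_ge_0 (f z)) as Hm. fold m in Hm.
  pose proof (Cmod_ge_0 l) as Hl. set (L := Cmod l) in *.
  assert (H : (0 <= x)%R); [|lra].
  assert (Hkey : forall e, (0 < e < 1)%R -> (0 <= x + e * (m + 1) + L * e)%R).
  { intros e [He0 He1].
    destruct (HL e He0) as [d1 [Hd1 H1]].
    destruct (generator_increment F f z Hg Hz e He0) as [d2 [Hd2 H2]].
    (* In time [t] the point moves by at most [t * (m + 1) < d1], so both expansions apply. *)
    set (t := (Rmin (d1 / (m + 1)) d2 / 2)%R).
    assert (Hq : (0 < d1 / (m + 1))%R) by (apply Rdiv_lt_0_compat; lra).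
    assert (Ht : (0 < t /\ t < d1 / (m + 1) /\ t < d2)%R).
    { unfold t. assert (0 < Rmin (d1 / (m + 1)) d2)%R by (apply Rmin_pos; auto).
      pose proof (Rmin_l (d1 / (m + 1)) d2). pose proof (Rmin_r (d1 / (m + 1)) d2). lra. }
    destruct Ht as (Ht0 & Ht1 & Ht2). specialize (H2 t ltac:(lra)).
    set (v := F t z - z) in *.
    assert (Hv : (Cmod v <= t * (m + 1))%R).
    { replace v with ((v + RtoC t * f z) + - (RtoC t * f z)) by ring.
      eapply Rle_trans; [apply Cmod_triangle|].
      rewrite Cmod_opp, Cmod_mult, Cmod_R, Rabs_pos_eq by lra. fold m. nra. }
    assert (Htm : (t * (m + 1) < d1)%R).
    { apply Rmult_lt_compat_r with (r := (m + 1)%R) in Ht1; [|lra].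
      unfold Rdiv in Ht1. rewrite Rmult_assoc, Rinv_l in Ht1; lra. }
    specialize (H1 (F t z)). fold v in H1. specialize (H1 ltac:(lra)).
    pose proof (Wolff_horodisks F HF HDW t z ltac:(lra) Hz) as HW.
    set (D := cayley (F t z) - cayley z) in *.
    assert (HD : (0 <= fst D)%R) by (change (0 <= fst (cayley (F t z)) + - fst (cayley z))%R; lra).
    assert (E : D = (D - l * v) + (l * (v + RtoC t * f z) + RtoC t * (l * - f z))) by ring.
    assert (HD2 : (fst D <= e * (t * (m + 1)) + (L * (e * t) + t * x))%R).
    { rewrite E, fst_Cplus. apply Rplus_le_compat.
      - eapply Rle_trans; [apply fst_le_Cmod|]. eapply Rle_trans; [exact H1|].
        apply Rmult_le_compat_l; lra.
      - rewrite fst_Cplus. apply Rplus_le_compat.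
        + eapply Rle_trans; [apply fst_le_Cmod|]. rewrite Cmod_mult. apply Rmult_le_compat_l; auto.
        + rewrite fst_RtoC_mult. fold x. lra. }
    apply Rmult_le_reg_l with t; auto. rewrite Rmult_0_r. lra. }
  pose proof (le_limit_0 (fun _ => 0%R) (fun e => x + e * (m + 1)
    + L * e)%R 1 Rlt_0_1 ltac:(auto_derive; auto) ltac:(auto_derive; auto) Hkey) as HH.
  cbv beta in HH. lra.
Qed.

(** Cut [[0, T]] into [n] steps of length [s]. As [f] vanishes at 0, the first step is small
    compared with [s], and by Schwarz-Pick the later ones obey the same hyperbolic bound; their
    total tends to 0, so [F T 0 = 0], against convergence to 1. *)
Lemma generator_not_zero (F : R -> C -> C) (f : C -> C) :
  is_semigroup F -> is_generator_of f F -> is_Denjoy_Wolff_point F 1 ->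
  ~ (forall z, in_disk z -> f z = 0).
Proof.
  intros HF Hg HDW H0.
  assert (Hfix : forall T, (0 <= T)%R -> F T 0 = 0).
  { intros T HT.
    assert (HFT : in_disk (F T 0)) by (apply (semigroup_self_map F HF); auto; apply disk_0).
    apply eq_trans with (cayley_inv (cayley (F T 0))); [now rewrite cayley_inv_cayley|].
    apply eq_trans with (cayley_inv (cayley 0)); [|apply cayley_inv_cayley, disk_0]. f_equal.
    assert (Hz : Cmod (cayley (F T 0) - cayley 0) = 0%R).
    { apply Rle_antisym; [|apply Cmod_ge_0].
      pose proof (has_cderiv_cayley 0 disk_0) as HL.
      replace ((1 + 1) / ((1 - 0) * (1 - 0))) with (RtoC 2) in HL by field.
      assert (Hkey : forall e, (0 < e < 1)%R ->
         (Cmod (cayley (F T 0) - cayley 0) <= (3 * T * e) * exp (2 * (3 * T * e)))%R).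
      { intros e [He0 He1].
        destruct (HL e He0) as [d1 [Hd1 H1]].
        destruct (generator_increment F f 0 Hg disk_0 e He0) as [d2 [Hd2 H2]].
        (* With [e < 1], the bound [1 / 6] gives [3 * e * s <= 1 / 2] as [hyperbolic_steps]
           requires; the 3 is [cayley' 0 = 2] plus an error below 1. *)
        set (s0 := Rmin (Rmin d1 d2) (/ 6)).
        assert (Hs0 : (0 < s0)%R) by (repeat apply Rmin_pos; lra).
        set (n := S (Z.to_nat (up (T / s0)))).
        assert (Hn : (0 < INR n)%R) by (apply lt_0_INR; unfold n; lia).
        assert (Hns : (T < INR n * s0)%R).
        { destruct (archimed (T / s0)) as [h _]. apply Rmult_lt_compat_r with (r := s0) in h; auto.
          replace (T / s0 * s0)%R with T in h by (field; lra).
          eapply Rlt_le_trans; [exact h|]. apply Rmult_le_compat_r; [lra|].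
          apply Rle_trans with (INR (Z.to_nat (up (T / s0)))); [|apply le_INR; unfold n; lia].
          rewrite INR_IZR_INZ. apply IZR_le. lia. }
        set (s := (T / INR n)%R).
        assert (Hs : (0 <= s)%R) by (apply Rmult_le_pos; auto; left; now apply Rinv_0_lt_compat).
        assert (Hs1 : (s < s0)%R).
        { unfold s. apply Rmult_lt_reg_r with (INR n); auto. unfold Rdiv.
          rewrite Rmult_assoc, Rinv_l; lra. }
        assert (Hss : (s < d1 /\ s < d2 /\ s < / 6)%R).
        { pose proof (Rmin_l (Rmin d1 d2) (/ 6)). pose proof (Rmin_r (Rmin d1 d2) (/ 6)).
          pose proof (Rmin_l d1 d2). pose proof (Rmin_r d1 d2). unfold s0 in Hs1. lra. }
        set (G := fun w => cayley (F s (cayley_inv w))).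
        assert (HFs : forall z, in_disk z -> in_disk (F s z)) by (intros;
          apply (semigroup_self_map F HF); auto).
        assert (HGd : forall w, in_H w -> cdiff G w).
        { intros w Hw. apply (cdiff_comp cayley (fun w => F s (cayley_inv w))).
          - apply cdiff_cayley, HFs, cayley_inv_in_disk; auto.
          - apply (cdiff_comp (F s) cayley_inv); [|now apply cdiff_cayley_inv].
            apply cdiff_ex_derive, (semigroup_holomorphic F HF); auto. now apply cayley_inv_in_disk.
            }
        assert (HGm : forall w, in_H w -> (fst w <= fst (G w))%R).
        { intros w Hw. rewrite <- (cayley_cayley_inv w) at 1 by auto.
          apply (Wolff_horodisks F HF HDW); auto. now apply cayley_inv_in_disk. }
        assert (Hw0 : in_H (cayley 0)) by (apply cayley_in_H, disk_0).
        destruct (iterate_steps G (cayley 0) HGd HGm Hw0) as (E1 & E2 & E3).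
        assert (Hit : forall k, Nat.iter k G (cayley 0) = cayley (F (INR k * s)%R 0)).
        { induction k as [|k IH].
          - simpl. rewrite Rmult_0_l, (semigroup_zero F HF); auto using disk_0.
          - simpl Nat.iter. rewrite IH. unfold G. rewrite cayley_inv_cayley.
            + f_equal. rewrite S_INR. replace ((INR k + 1) * s)%R with (s + INR k * s)%R by ring.
              symmetry. apply (semigroup_add F HF); auto using disk_0.
              apply Rmult_le_pos; auto using pos_INR.
            + apply (semigroup_self_map F HF); auto using disk_0.
              apply Rmult_le_pos; auto using pos_INR. }
        assert (Hx0 : fst (cayley 0) = 1%R) by (rewrite cayley_0; reflexivity).
        rewrite Hx0, Rdiv_1_r in E3.
        assert (Hk : (Cmod (G (cayley 0) - cayley 0) <= 3 * e * s)%R).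
        { unfold G. rewrite cayley_inv_cayley by apply disk_0.
          destruct (Rle_lt_or_eq_dec 0 s Hs) as [Hs'|Hs'].
          2: { rewrite <- Hs', (semigroup_zero F HF) by apply disk_0.
               replace (cayley 0 - cayley 0) with (RtoC 0) by ring. rewrite Cmod_0. lra. }
          specialize (H2 s ltac:(lra)). rewrite (H0 0 disk_0), Cmult_0_r, Cplus_0_r in H2.
          specialize (H1 (F s 0)).
          assert (Hv : (Cmod (F s 0 - 0) < d1)%R) by nra.
          specialize (H1 Hv). set (v := F s 0 - 0) in *.
          replace (cayley (F s 0) - cayley 0) with ((cayley (F s 0) - cayley 0 - RtoC 2 * v)
            + RtoC 2 * v) by ring.
          eapply Rle_trans; [apply Cmod_triangle|]. rewrite Cmod_mult, Cmod_R, Rabs_pos_eq by lra.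
          pose proof (Cmod_ge_0 v). nra. }
        set (k := (3 * e * s)%R) in *.
        assert (Hk0 : (0 <= k <= 1 / 2)%R) by (unfold k; split; nra).
        destruct (hyperbolic_steps (fun j => Nat.iter j G (cayley 0)) k Hk0 E1 E2) as (_ & _ & S3).
        { intros j. eapply Rle_trans; [apply E3|]. apply Rmult_le_compat_r.
          - left. apply Rmult_lt_0_compat; apply E1.
          - apply pow_incr. split; [apply Cmod_ge_0|auto]. }
        specialize (S3 n). cbv beta in S3. change (Nat.iter 0 G (cayley 0)) with (cayley 0) in S3.
        rewrite Hit, Hx0, Rmult_1_l in S3.
        replace (INR n * s)%R with T in S3 by (unfold s; field; lra).
        replace (INR n * k)%R with (3 * T * e)%R in S3 by (unfold k, s; field; lra). exact S3. }
      pose proof (le_limit_0 (fun _ => Cmod (cayley (F T 0) - cayley 0)) (fun e => (3 * T * e)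
        * exp (2 * (3 * T * e)))%R 1 Rlt_0_1 ltac:(auto_derive; auto) ltac:(auto_derive; auto) Hkey) as HH.
      cbv beta in HH. rewrite !Rmult_0_r, Rmult_0_l in HH. exact HH. }
    apply Cmod_eq_0 in Hz.
    replace (cayley (F T 0)) with ((cayley (F T 0) - cayley 0) + cayley 0) by ring.
    rewrite Hz. ring. }
  destruct HDW as [_ HDW].
  destruct (proj1 (filterlim_C_Cmod _ _ _) (HDW 0 disk_0) 1%R Rlt_0_1) as [M HM].
  specialize (HM (Rmax 0 M + 1)%R). rewrite Hfix in HM.
  - replace (0 - 1) with (- (1)) in HM by ring. rewrite Cmod_m1 in HM.
    generalize (Rmax_r 0 M). intros. specialize (HM ltac:(lra)). lra.
  - generalize (Rmax_l 0 M). lra.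
Qed.

(** At a zero of [f] the function [p] attains real part 0, hence is constant by [Re_zero_const], and
    [f] would vanish identically. *)
Lemma generator_nonzero (F : R -> C -> C) (f : C -> C) :
  is_semigroup F -> is_generator_of f F -> is_Denjoy_Wolff_point F 1 ->
  forall z, in_disk z -> f z <> 0.
Proof.
  intros HF Hg HDW z0 Hz0 E.
  apply (generator_not_zero F f HF Hg HDW). intros z Hz.
  set (p := fun z => - f z / ((1 - z) * (1 - z))).
  assert (NN : forall z, in_disk z -> (1 - z) * (1 - z) <> 0) by (intros x Hx; apply Cmult_neq_0;
    now apply disk_neq_1).
  assert (Ep : p z0 = 0) by (unfold p; rewrite E; field; now apply disk_neq_1).
  assert (H : p z = p z0).
  { apply Re_zero_const; auto.
    - intros x Hx. unfold p. apply cdiff_div; [|cdiff_auto|auto].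
      apply cdiff_opp, cdiff_ex_derive. now apply (proj1 Hg).
    - apply (generator_Re_pos F f HF Hg HDW).
    - rewrite Ep. reflexivity. }
  rewrite Ep in H.
  replace (f z) with (- p z * ((1 - z) * (1 - z))) by (unfold p; field; now apply disk_neq_1).
  rewrite H. ring.
Qed.

(** The same cancellation as in [Harnack_upper]. *)
Lemma Harnack_disk (g : C -> C) :
  (forall z, in_disk z -> cdiff g z) -> (forall z, in_disk z -> (0 <= fst (g z))%R) ->
  forall z w, in_disk z -> in_disk w ->
  (Cmod (g z + Cconj (g w)) * ((1 - Cmod z ^ 2) * (1 - Cmod w ^ 2))
    <= 4 * Cmod (1 - Cconj w * z) ^ 2 * fst (g w))%R.
Proof.
  intros Hg Hp z w Hz Hw.
  generalize (Schwarz_Pick_disk g Hg Hp z w Hz Hw).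
  pose proof (Hp z Hz) as P1. pose proof (Hp w Hw) as P2.
  assert (HA : (fst (g z) <= Cmod (g z + Cconj (g w)))%R).
  { eapply Rle_trans; [|apply fst_le_Cmod]. simpl. lra. }
  set (A := Cmod (g z + Cconj (g w))) in *. set (N := (4 * Cmod (1 - Cconj w * z) ^ 2)%R). intros H.
  assert (HN : (0 <= N)%R) by (unfold N; generalize (pow2_ge_0 (Cmod (1 - Cconj w * z))); lra).
  destruct (Rle_lt_or_eq_dec 0 A (Cmod_ge_0 _)) as [HA0|HA0].
  - apply Rmult_le_reg_l with A; auto.
    assert (N * (fst (g z) * fst (g w)) <= N * (A * fst (g w)))%R by (apply Rmult_le_compat_l;
      auto; apply Rmult_le_compat_r; auto).
    lra.
  - rewrite <- HA0. rewrite Rmult_0_l. nra.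
Qed.

(* Subtracting the largest admissible multiple of the Poisson kernel at 1
   leaves a function whose quotient by that kernel has infimum 0; Harnack's
   inequality at a near-minimiser then forces the angular limit 0. *)
Lemma Julia_Wolff_Caratheodory (p : C -> C) :
  (forall z, in_disk z -> cdiff p z) -> (forall z, in_disk z -> (0 <= fst (p z))%R) ->
  exists b : R, (0 <= b)%R /\ forall K, (1 < K)%R -> forall e, (0 < e)%R -> exists d, (0 < d)%R /\
    forall z, Stolz_region 1 K z -> (Cmod (z - 1) < d)%R -> (Cmod ((1 - z) * p z - RtoC b) < e)%R.
Proof.
  intros Hpd Hpp.
  set (ratio := fun z => (fst (p z) / fst (cayley z))%R).
  assert (Hcay : forall z, in_disk z -> (0 < fst (cayley z))%R) by apply cayley_in_H.
  assert (Hr0 : forall z, in_disk z -> (0 <= ratio z)%R).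
  { intros z Hz. apply Rmult_le_pos; auto. left. apply Rinv_0_lt_compat. auto. }
  destruct (completeness (fun x => exists z, in_disk z /\ x = (- ratio z)%R)) as [m [Hm1 Hm2]].
  { exists 0%R. intros x [z [Hz ->]]. specialize (Hr0 z Hz). lra. }
  { exists (- ratio 0)%R. exists 0. split; [apply disk_0|reflexivity]. }
  set (c := (- m)%R).
  assert (Hc0 : (0 <= c)%R).
  { assert (m <= 0)%R; [|unfold c; lra]. apply Hm2. intros x [z [Hz ->]]. specialize (Hr0 z Hz).
    lra. }
  assert (Hc1 : forall z, in_disk z -> (c <= ratio z)%R).
  { intros z Hz. assert (- ratio z <= m)%R; [|unfold c; lra]. apply Hm1. exists z; auto. }
  assert (Hc2 : forall e, (0 < e)%R -> exists z, in_disk z /\ (ratio z < c + e)%R).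
  { intros e He. apply NNPP. intros Hn. assert (m <= m - e)%R; [|lra]. apply Hm2.
    intros x [z [Hz ->]].
    destruct (Rle_dec (c + e) (ratio z)) as [H|H]; [unfold c in H; lra|]. exfalso. apply Hn.
    exists z. split; auto. lra. }
  set (p1 := fun z => p z - RtoC c * cayley z).
  assert (Hp1d : forall z, in_disk z -> cdiff p1 z).
  { intros z Hz. apply cdiff_minus; auto.
    apply cdiff_mult; [apply cdiff_const|now apply cdiff_cayley]. }
  assert (Hp1f : forall z, in_disk z -> (fst (p1 z) = (ratio z - c) * fst (cayley z))%R).
  { intros z Hz. unfold p1, ratio.
    change (fst (p z) + - fst (RtoC c * cayley z)%C = (fst (p z) / fst (cayley z) - c) * fst (cayley z))%R.
    rewrite fst_RtoC_mult. field. specialize (Hcay z Hz). lra. }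
  assert (Hp1p : forall z, in_disk z -> (0 <= fst (p1 z))%R).
  { intros z Hz. rewrite Hp1f by auto. specialize (Hc1 z Hz). specialize (Hcay z Hz).
    apply Rmult_le_pos; lra. }
  (* [(1 - z) * cayley z = 1 + z] tends to 2, hence the limit [2 * c]. *)
  exists (2 * c)%R. split; [lra|]. intros K HK e He.
  (* The error is split into three thirds of [e]; in the Harnack term this tolerance is multiplied
     by [16 * K]. *)
  destruct (Hc2 (e / (48 * K))%R ltac:(apply Rdiv_lt_0_compat; lra)) as [z0 [Hz0 Hrat]].
  pose proof (disk_neq_1 z0 Hz0) as N0. apply Cmod_gt_0 in N0. set (a0 := Cmod (1 - z0)) in *.
  pose proof (Cmod_ge_0 (p1 z0)) as Hg0. set (G := Cmod (p1 z0)) in *.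
  set (d := Rmin a0 (Rmin (e / (3 * (G + 1))) (e / (3 * (c + 1))))).
  assert (Hd : (0 < d)%R).
  { unfold d. repeat apply Rmin_pos; auto; apply Rdiv_lt_0_compat; lra. }
  exists d. split; auto. intros z [Hz HS] Hzd.
  rewrite Cmod_minus_sym in HS. rewrite Cmod_minus_sym in Hzd. set (s := Cmod (1 - z)) in *.
  assert (D1 : (s < a0)%R) by (lt_Rmin Hzd).
  assert (D2 : (s < e / (3 * (G + 1)))%R) by (lt_Rmin Hzd).
  assert (D3 : (s < e / (3 * (c + 1)))%R) by (lt_Rmin Hzd).
  assert (Hs0 : (0 <= s)%R) by apply Cmod_ge_0.
  assert (D2' : (s * G < e / 3)%R).
  { apply Rmult_lt_compat_r with (r := (G + 1)%R) in D2; [|lra].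
    replace (e / (3 * (G + 1)) * (G + 1))%R with (e / 3)%R in D2 by (field; lra). nra. }
  assert (D3' : (s * c < e / 3)%R).
  { apply Rmult_lt_compat_r with (r := (c + 1)%R) in D3; [|lra].
    replace (e / (3 * (c + 1)) * (c + 1))%R with (e / 3)%R in D3 by (field; lra). nra. }
  pose proof (Harnack_disk p1 Hp1d Hp1p z z0 Hz Hz0) as HH.
  set (A := Cmod (p1 z + Cconj (p1 z0))) in *. assert (HA : (0 <= A)%R) by apply Cmod_ge_0.
  assert (Hz1 : (s < K * (1 - Cmod z ^ 2))%R).
  { unfold in_disk in Hz. pose proof (Cmod_ge_0 z). eapply Rlt_le_trans; [exact HS|].
    apply Rmult_le_compat_l; nra. }
  assert (Hw : (0 < 1 - Cmod z0 ^ 2)%R) by (apply in_disk_sq in Hz0; lra).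
  set (W := (1 - Cmod z0 ^ 2)%R) in *.
  assert (Hden : (Cmod (1 - Cconj z0 * z) <= 2 * a0)%R).
  { replace (1 - Cconj z0 * z) with ((1 - z) + (Cconj (1 - z0)) * z).
    2: { rewrite Cminus_conj. rewrite (Cconj_RtoC 1). ring. }
    eapply Rle_trans; [apply Cmod_triangle|]. rewrite Cmod_mult, Cmod_conj. fold s a0.
    unfold in_disk in Hz. pose proof (Cmod_ge_0 z). nra. }
  assert (Hfz : (fst (p1 z0) * a0 ^ 2 <= e / (48 * K) * W)%R).
  { rewrite Hp1f by auto. rewrite fst_cayley by now apply disk_neq_1. fold a0 W.
    replace ((ratio z0 - c) * (W / a0 ^ 2) * a0 ^ 2)%R with ((ratio z0 - c) * W)%R by (field; lra).
    apply Rmult_le_compat_r; lra. }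
  pose proof (Hp1p z0 Hz0) as Pz0.
  assert (HAs : (s * A <= e / 3)%R).
  { apply Rmult_le_reg_r with W; auto.
    apply Rle_trans with (K * (A * ((1 - Cmod z ^ 2) * W)))%R.
    - replace (K * (A * ((1 - Cmod z ^ 2) * W)))%R with ((K * (1 - Cmod z ^ 2)) * A * W)%R by ring.
      apply Rmult_le_compat_r; [lra|]. apply Rmult_le_compat_r; lra.
    - apply Rle_trans with (K * (4 * (2 * a0) ^ 2 * fst (p1 z0)))%R.
      + apply Rmult_le_compat_l; [lra|]. eapply Rle_trans; [exact HH|].
        apply Rmult_le_compat_r; auto.
        apply Rmult_le_compat_l; [lra|]. apply pow_incr. split; [apply Cmod_ge_0|auto].
      + replace (K * (4 * (2 * a0) ^ 2 * fst (p1 z0)))%R with (16 * K * (fst (p1 z0) * a0 ^ 2))%R by ring.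
        apply Rle_trans with (16 * K * (e / (48 * K) * W))%R; [apply Rmult_le_compat_l; lra|].
        apply Req_le. field. lra. }
  pose proof (disk_neq_1 z Hz) as Nz.
  replace ((1 - z) * p z - RtoC (2 * c)) with ((1 - z) * (p1 z + Cconj (p1 z0)) + (- ((1 - z)
    * Cconj (p1 z0)) + - (RtoC c * (1 - z)))).
  2: { unfold p1, cayley. rewrite RtoC_mult. field. auto. }
  eapply Rle_lt_trans; [apply Cmod_triangle|].
  rewrite Cmod_mult. fold s A.
  assert (Hrest : (Cmod (- ((1 - z) * Cconj (p1 z0)) + - (RtoC c * (1 - z))) <= s * G + c * s)%R).
  { eapply Rle_trans; [apply Cmod_triangle|].
    rewrite !Cmod_opp, !Cmod_mult, Cmod_conj, Cmod_R, Rabs_pos_eq by auto. fold s G. lra. }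
  lra.
Qed.

(** Schwarz-Pick between [z] and the radial point [w = (1 - s) * zeta], multiplied by [s]: there
    [s * q w] is close to [m], and [1 - |w|^2 = s * (2 - s)]. Radial points arbitrarily close to
    [zeta] suffice for the limit. *)
Lemma Julia_atom (q : C -> C) (zeta : C) (m : R) :
  (forall z, in_disk z -> cdiff q z) -> (forall z, in_disk z -> (0 <= fst (q z))%R) ->
  Cmod zeta = 1%R -> (0 < m)%R ->
  (forall e, (0 < e)%R -> exists s, (0 < s < e)%R /\ (Cmod (RtoC s * q (RtoC (1 - s)
    * zeta)%C - RtoC m) < e)%R) ->
  forall z, in_disk z -> (m * (1 - Cmod z ^ 2) <= 2 * Cmod (z - zeta) ^ 2 * fst (q z))%R.
Proof.
  intros Hqd Hqp Hze Hm Hlim z Hz.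
  set (G := Cmod (q z)). assert (HG : (0 <= G)%R) by apply Cmod_ge_0.
  set (x := fst (q z)). pose proof (Hqp z Hz) as Hx. fold x in Hx.
  set (a := Cmod (z - zeta)). assert (Ha : (0 <= a)%R) by apply Cmod_ge_0.
  set (W := (1 - Cmod z ^ 2)%R). assert (HW : (0 < W)%R) by (apply in_disk_sq in Hz; unfold W; lra).
  assert (Hkey : forall e, (0 < e < Rmin 1 (m / (G + 1)))%R ->
    ((m - e * (G + 1)) ^ 2 * ((2 - e) * W) <= 4 * (a + e) ^ 2 * (x * (m + e)))%R).
  { intros e [He0 He].
    assert (He1 : (e < 1)%R) by (lt_Rmin He).
    assert (HeG : (e * (G + 1) < m)%R).
    { assert (H : (e < m / (G + 1))%R) by (lt_Rmin He).
      apply Rmult_lt_compat_r with (r := (G + 1)%R) in H; [|lra]. unfold Rdiv in H.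
      rewrite Rmult_assoc, Rinv_l in H; lra. }
    destruct (Hlim e He0) as [s [[Hs0 Hs] Hsq]]. set (w := RtoC (1 - s) * zeta) in *.
    assert (Hwm : Cmod w = (1 - s)%R) by (unfold w; rewrite Cmod_mult, Hze, Cmod_R, Rabs_pos_eq; lra).
    assert (Hw : in_disk w) by (unfold in_disk; lra).
    pose proof (Schwarz_Pick_disk q Hqd Hqp z w Hz Hw) as SP. rewrite Hwm in SP. fold W x in SP.
    set (Y := RtoC s * q w) in *.
    assert (HYf : (fst Y <= m + e)%R).
    { pose proof (fst_le_Cmod (Y - RtoC m)) as H.
      change (fst (Y - RtoC m)) with (fst Y + - m)%R in H. lra. }
    assert (HYf2 : fst Y = (s * fst (q w))%R) by apply fst_RtoC_mult.
    assert (HYm : (m - e <= Cmod Y)%R).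
    { generalize (Cmod_rev_triangle (RtoC m) Y). rewrite Cmod_minus_sym, Cmod_R, Rabs_pos_eq by lra.
      lra. }
    set (A := Cmod (q z + Cconj (q w))) in *.
    assert (HsA : (m - e * (G + 1) <= s * A)%R).
    { replace (s * A)%R with (Cmod (RtoC s * (q z + Cconj (q w))))
      by (rewrite Cmod_mult, Cmod_R, Rabs_pos_eq; auto; lra).
      replace (RtoC s * (q z + Cconj (q w))) with (Cconj Y - (- (RtoC s * q z))).
      2: { unfold Y. rewrite Cmult_conj. rewrite Cconj_RtoC. ring. }
      generalize (Cmod_rev_triangle (Cconj Y) (- (RtoC s * q z))).
      rewrite Cmod_opp, Cmod_conj, Cmod_mult, Cmod_R, Rabs_pos_eq by lra.
      fold G. nra. }
    assert (HB : (Cmod (1 - Cconj w * z) <= a + e)%R).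
    { assert (Hzz : zeta * Cconj zeta = 1) by (rewrite <- Cmod2_conj, Hze, pow1; reflexivity).
      replace (Cmod (1 - Cconj w * z)) with (Cmod (zeta * (1 - Cconj w * z)))
        by (rewrite Cmod_mult, Hze; ring).
      replace (zeta * (1 - Cconj w * z)) with (- (z - zeta) + RtoC s * z).
      2: { unfold w. rewrite Cmult_conj. rewrite Cconj_RtoC.
           replace (zeta * (1 - RtoC (1 - s) * Cconj zeta * z))
             with (zeta - RtoC (1 - s) * (zeta * Cconj zeta) * z) by ring.
           rewrite Hzz, RtoC_minus. ring. }
      eapply Rle_trans; [apply Cmod_triangle|].
      rewrite Cmod_opp, Cmod_mult, Cmod_R, Rabs_pos_eq by lra. fold a.
      unfold in_disk in Hz. pose proof (Cmod_ge_0 z). nra. }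
    apply Rle_trans with ((s * A) ^ 2 * ((2 - s) * W))%R.
    - apply Rmult_le_compat.
      + apply pow2_ge_0. + apply Rmult_le_pos; lra.
      + apply pow_incr. lra. + apply Rmult_le_compat_r; lra.
    - apply Rle_trans with (4 * Cmod (1 - Cconj w * z) ^ 2 * (x * fst Y))%R.
      + rewrite HYf2.
        replace (4 * Cmod (1 - Cconj w * z) ^ 2 * (x * (s * fst (q w))))%R
          with (s * (4 * Cmod (1 - Cconj w * z) ^ 2 * (x * fst (q w))))%R by ring.
        replace ((s * A) ^ 2 * ((2 - s) * W))%R with (s * (A ^ 2 * (W * (1 - (1 - s) ^ 2))))%R by ring.
        apply Rmult_le_compat_l; [lra|exact SP].
      + apply Rle_trans with (4 * Cmod (1 - Cconj w * z) ^ 2 * (x * (m + e)))%R.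
        * apply Rmult_le_compat_l; [generalize (pow2_ge_0 (Cmod (1 - Cconj w * z))); lra|].
          apply Rmult_le_compat_l; lra.
        * apply Rmult_le_compat_r; [apply Rmult_le_pos; lra|]. apply Rmult_le_compat_l; [lra|].
          apply pow_incr. split; [apply Cmod_ge_0|auto]. }
  assert (HR : (0 < Rmin 1 (m / (G + 1)))%R) by (apply Rmin_pos; [lra|]; apply Rdiv_lt_0_compat; lra).
  pose proof (le_limit_0 (fun e => (m - e * (G + 1)) ^ 2 * ((2 - e) * W))%R (fun e => 4 * (a + e)
    ^ 2 * (x * (m + e)))%R _ HR ltac:(auto_derive; auto) ltac:(auto_derive; auto) Hkey) as HL.
  cbv beta in HL. rewrite Rmult_0_l, !Rminus_0_r, !Rplus_0_r in HL.
  (* At [e = 0] the inequality is [2 * m^2 * W <= 4 * a^2 * x * m]. *)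
  apply Rmult_le_reg_l with (2 * m)%R; lra.
Qed.

(** * Angular limits and removal of atoms *)

Lemma angular_lim_Cmod (f : C -> C) (zeta l : C) :
  angular_lim f zeta l <-> forall K, (1 < K)%R -> forall e, (0 < e)%R -> exists d, (0 < d)%R /\
    forall z, Stolz_region zeta K z -> (Cmod (z - zeta) < d)%R -> (Cmod (f z - l) < e)%R.
Proof.
  split.
  - intros H K HK e He. pose proof (proj1 (filterlim_C_Cmod _ _ _) (H K HK) e He) as H'.
    apply (locally_C_Cmod zeta) in H'. destruct H' as [d [Hd H']]. exists d; split; auto.
  - intros H K HK. apply (filterlim_C_Cmod _ _ _). intros e He. apply (locally_C_Cmod zeta).
    destruct (H K HK e He) as [d [Hd H']]. exists d; split; auto.
Qed.

Lemma angular_lim_const (c zeta : C) : angular_lim (fun _ => c) zeta c.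
Proof. intros K HK. apply filterlim_const. Qed.

Lemma angular_lim_id (zeta : C) : angular_lim (fun z => z) zeta zeta.
Proof. apply angular_lim_Cmod. intros K HK e He. exists e. auto. Qed.

Lemma angular_lim_ext (f g : C -> C) (zeta l : C) :
  (forall z, in_disk z -> f z = g z) -> angular_lim f zeta l -> angular_lim g zeta l.
Proof.
  intros E H. apply angular_lim_Cmod. intros K HK e He.
  destruct (proj1 (angular_lim_Cmod f zeta l) H K HK e He) as [d [Hd H']]. exists d; split; auto.
  intros z Hz. rewrite <- E by apply Hz. auto.
Qed.

Lemma angular_lim_plus (f g : C -> C) (zeta l m : C) :
  angular_lim f zeta l -> angular_lim g zeta m -> angular_lim (fun z => f z + g z) zeta (l + m).
Proof.
  rewrite !angular_lim_Cmod. intros Hf Hg K HK e He.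
  destruct (Hf K HK (e / 2)%R ltac:(lra)) as [d1 [Hd1 H1]].
  destruct (Hg K HK (e / 2)%R ltac:(lra)) as [d2 [Hd2 H2]].
  exists (Rmin d1 d2). split; [now apply Rmin_pos|]. intros z Hz Hd.
  specialize (H1 z Hz ltac:(lt_Rmin Hd)).
  specialize (H2 z Hz ltac:(lt_Rmin Hd)).
  replace (f z + g z - (l + m)) with ((f z - l) + (g z - m)) by ring.
  eapply Rle_lt_trans; [apply Cmod_triangle|]. lra.
Qed.

Lemma angular_lim_mult (f g : C -> C) (zeta l m : C) :
  angular_lim f zeta l -> angular_lim g zeta m -> angular_lim (fun z => f z * g z) zeta (l * m).
Proof.
  rewrite !angular_lim_Cmod. intros Hf Hg K HK e He.
  pose proof (Cmod_ge_0 l) as Hl. pose proof (Cmod_ge_0 m) as Hm.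
  destruct (Hf K HK (Rmin 1 (e / (2 * (Cmod m + 1)))) ltac:(apply Rmin_pos;
    [lra|apply Rdiv_lt_0_compat; lra])) as [d1 [Hd1 H1]].
  destruct (Hg K HK (e / (2 * (Cmod l + 1)))%R ltac:(apply Rdiv_lt_0_compat; lra)) as [d2 [Hd2 H2]].
  exists (Rmin d1 d2). split; [now apply Rmin_pos|]. intros z Hz Hd.
  specialize (H1 z Hz ltac:(lt_Rmin Hd)).
  specialize (H2 z Hz ltac:(lt_Rmin Hd)).
  assert (G1 : (Cmod (f z - l) < 1)%R) by (lt_Rmin H1).
  assert (G2 : (Cmod (f z - l) < e / (2 * (Cmod m + 1)))%R) by (lt_Rmin H1).
  replace (f z * g z - l * m) with (f z * (g z - m) + (f z - l) * m) by ring.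
  eapply Rle_lt_trans; [apply Cmod_triangle|]. rewrite !Cmod_mult.
  assert (G3 : (Cmod (f z) <= Cmod l + 1)%R) by (generalize (Cmod_rev_triangle (f z) l); lra).
  pose proof (Cmod_ge_0 (g z - m)) as P1. pose proof (Cmod_ge_0 (f z - l)) as P2.
  apply Rmult_lt_compat_r with (r := (Cmod l + 1)%R) in H2; [|lra].
  replace (e / (2 * (Cmod l + 1)) * (Cmod l + 1))%R with (e / 2)%R in H2 by (field; lra).
  apply Rmult_lt_compat_r with (r := (Cmod m + 1)%R) in G2; [|lra].
  replace (e / (2 * (Cmod m + 1)) * (Cmod m + 1))%R with (e / 2)%R in G2 by (field; lra). nra.
Qed.

Lemma angular_lim_opp (f : C -> C) (zeta l : C) :
  angular_lim f zeta l -> angular_lim (fun z => - f z) zeta (- l).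
Proof.
  intros H. apply angular_lim_ext with (fun z => (- (1)) * f z); [intros; ring|].
  replace (- l) with ((- (1)) * l) by ring. apply angular_lim_mult; auto. apply angular_lim_const.
Qed.

Lemma angular_lim_minus (f g : C -> C) (zeta l m : C) :
  angular_lim f zeta l -> angular_lim g zeta m -> angular_lim (fun z => f z - g z) zeta (l - m).
Proof. intros. apply angular_lim_plus; auto. now apply angular_lim_opp. Qed.

Lemma angular_lim_inv (f : C -> C) (zeta l : C) : l <> 0 ->
  angular_lim f zeta l -> angular_lim (fun z => / f z) zeta (/ l).
Proof.
  rewrite !angular_lim_Cmod. intros Hl Hf K HK e He.
  destruct (has_cderiv_ccont _ _ _ (has_cderiv_Cinv l Hl) e He) as [d1 [Hd1 H1]].
  destruct (Hf K HK d1 Hd1) as [d [Hd H]]. exists d; split; auto.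
Qed.

Lemma angular_lim_div (f g : C -> C) (zeta l m : C) : m <> 0 ->
  angular_lim f zeta l -> angular_lim g zeta m -> angular_lim (fun z => f z / g z) zeta (l / m).
Proof. intros. apply angular_lim_mult; auto. now apply angular_lim_inv. Qed.

(** The radius lies in every Stolz region, so angular limits are unique and can be tested
    radially. *)
Lemma Stolz_radial (zeta : C) (K s : R) : Cmod zeta = 1%R -> (1 < K)%R -> (0 < s < 1)%R ->
  Stolz_region zeta K (RtoC (1 - s) * zeta) /\ Cmod (RtoC (1 - s) * zeta - zeta) = s.
Proof.
  intros Hz HK Hs.
  assert (E : Cmod (RtoC (1 - s) * zeta - zeta) = s).
  { replace (RtoC (1 - s) * zeta - zeta) with (- (RtoC s * zeta)) by (rewrite RtoC_minus; ring).
    rewrite Cmod_opp, Cmod_mult, Hz, Cmod_R, Rabs_pos_eq; lra. }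
  split; auto. unfold Stolz_region, in_disk. rewrite E, Cmod_mult, Hz, Cmod_R, Rabs_pos_eq by lra.
  nra.
Qed.

Lemma angular_lim_radial (f : C -> C) (zeta l : C) : Cmod zeta = 1%R -> angular_lim f zeta l ->
  forall e, (0 < e)%R -> exists s, (0 < s < e)%R /\ (s < 1)%R /\ (Cmod (f (RtoC (1 - s) * zeta)%C - l) < e)%R.
Proof.
  intros Hz H e He. destruct (proj1 (angular_lim_Cmod _ _ _) H 2%R ltac:(lra) e He) as [d [Hd H']].
  set (s := (Rmin (Rmin d e) 1 / 2)%R).
  assert (Hs : (0 < s /\ s < d /\ s < e /\ s < 1)%R).
  { unfold s. assert (0 < Rmin (Rmin d e) 1)%R by (repeat apply Rmin_pos; lra).
    pose proof (Rmin_l (Rmin d e) 1). pose proof (Rmin_r (Rmin d e) 1). pose proof (Rmin_l d e).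
    pose proof (Rmin_r d e). lra. }
  destruct (Stolz_radial zeta 2 s Hz ltac:(lra) ltac:(lra)) as [S1 S2].
  exists s. split; [lra|split; [lra|]]. apply H'; auto. rewrite S2. lra.
Qed.

Lemma angular_lim_unique (f : C -> C) (zeta l m : C) : Cmod zeta = 1%R ->
  angular_lim f zeta l -> angular_lim f zeta m -> l = m.
Proof.
  intros Hz Hl Hm. pose proof (angular_lim_minus _ _ _ _ _ Hl Hm) as H.
  assert (E : Cmod (l - m) = 0%R).
  { apply Rle_antisym; [|apply Cmod_ge_0]. apply le_epsilon. intros e He.
    destruct (angular_lim_radial _ _ _ Hz H e He) as (s & _ & _ & Hs).
    replace (f (RtoC (1 - s) * zeta) - f (RtoC (1 - s) * zeta) - (l - m)) with (- (l - m)) in Hs by ring.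
    rewrite Cmod_opp in Hs. lra. }
  apply Cmod_eq_0 in E. replace l with ((l - m) + m) by ring. rewrite E. ring.
Qed.

Lemma angular_lim_infty_div (f g : C -> C) (zeta l : C) : l <> 0 ->
  angular_lim f zeta l -> angular_lim g zeta 0 -> (forall z, in_disk z -> g z <> 0) ->
  angular_lim_infty (fun z => f z / g z) zeta.
Proof.
  intros Hl Hf Hg Hg0 K HK. apply Cmod_gt_0 in Hl.
  intros P [M HM]. unfold filtermap, within. apply (locally_C_Cmod zeta).
  (* Near [zeta] one has [|f| > |l| / 2] and [|g| < e]; [|M| + 1] is positive for every sign of
     [M]. *)
  set (e := (Cmod l / (2 * (Rabs M + 1)))%R). pose proof (Rabs_pos M) as PM.
  destruct (proj1 (angular_lim_Cmod _ _ _) Hf K HK (Cmod l / 2)%R ltac:(lra)) as [d1 [Hd1 H1]].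
  destruct (proj1 (angular_lim_Cmod _ _ _) Hg K HK e ltac:(apply Rdiv_lt_0_compat; lra)) as [d2 [Hd2 H2]].
  exists (Rmin d1 d2). split; [now apply Rmin_pos|]. intros z Hd Hz.
  specialize (H1 z Hz ltac:(lt_Rmin Hd)).
  specialize (H2 z Hz ltac:(lt_Rmin Hd)).
  apply HM. pose proof (Hg0 z (proj1 Hz)) as Hgz. rewrite Cmod_div by auto.
  apply Cmod_gt_0 in Hgz. rewrite Cminus_0_r in H2.
  assert (H3 : (Cmod l / 2 < Cmod (f z))%R).
  { rewrite Cmod_minus_sym in H1. generalize (Cmod_rev_triangle l (f z)). lra. }
  apply Rle_lt_trans with (Rabs M); [apply Rle_abs|].
  apply Rmult_lt_reg_r with (Cmod (g z)); auto. cancel_div.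
  apply Rmult_lt_compat_r with (r := (Rabs M + 1)%R) in H2; [|lra].
  unfold e in H2.
  replace (Cmod l / (2 * (Rabs M + 1)) * (Rabs M + 1))%R with (Cmod l / 2)%R in H2 by (field; lra).
  nra.
Qed.

Lemma angular_lim_infty_ext (f g : C -> C) (zeta : C) :
  (forall z, in_disk z -> f z = g z) -> angular_lim_infty f zeta -> angular_lim_infty g zeta.
Proof.
  intros E H K HK. apply filterlim_ext_loc with (fun z => Cmod (f z)); [|exact (H K HK)].
  unfold within. apply filter_forall. intros z [Hz _]. now rewrite E.
Qed.

Lemma disk_neq_boundary z zeta : in_disk z -> Cmod zeta = 1%R -> z - zeta <> 0.
Proof.
  intros Hz H E. assert (z = zeta) by (replace z with ((z - zeta) + zeta) by ring; rewrite E; ring).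
  subst. unfold in_disk in Hz. lra.
Qed.

(* Up to an imaginary constant this is [|1 - zeta|^2 / 2] times the Herglotz
   kernel [(zeta + z) / (zeta - z)]. *)
Definition atom (zeta z : C) : C := (1 - z) * (1 - zeta) / (z - zeta).

(** The real part is a multiple of the Poisson kernel at [zeta], exactly the quantity that
    [Julia_atom] compares with [fst (q z)]. *)
Lemma atom_fst zeta z : Cmod zeta = 1%R -> z - zeta <> 0 ->
  (2 * Cmod (z - zeta) ^ 2 * fst (atom zeta z) = Cmod (1 - zeta) ^ 2 * (1 - Cmod z ^ 2))%R.
Proof.
  intros Hz H.
  assert (H1 : (Cmod zeta ^ 2 = 1)%R) by (rewrite Hz; ring).
  rewrite Rmult_assoc, <- fst_RtoC_mult.
  replace (RtoC (Cmod (z - zeta) ^ 2) * atom zeta z) with ((1 - z) * (1 - zeta) * Cconj (z - zeta)).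
  2: { rewrite Cmod2_conj. unfold atom. field. auto. }
  rewrite !Cmod_sq in *. destruct z as [x y], zeta as [a b]. simpl in *.
  assert (Hb : (b * b = 1 - a * a)%R) by lra. ring [Hb].
Qed.

Lemma cdiff_atom zeta z : z - zeta <> 0 -> cdiff (atom zeta) z.
Proof.
  intros H. unfold atom.
  apply cdiff_div; auto; [apply cdiff_mult|]; try apply cdiff_minus; first [apply cdiff_id|apply cdiff_const].
Qed.

Lemma angular_lim_1_minus zeta : angular_lim (fun z => 1 - z) zeta (1 - zeta).
Proof. apply angular_lim_minus; [apply angular_lim_const|apply angular_lim_id]. Qed.

(** The atoms fit the representation because [- atom zeta z / (1 - z)^2 = 1 / (z - 1) - 1 / (z -
    zeta)]. Numbering starts at 1, as in the sum of the theorem. *)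
Fixpoint remove_atoms (q : C -> C) (zeta : nat -> C) (d : nat -> R) (j : nat) (z : C) : C :=
  match j with
  | O => q z
  | S k => remove_atoms q zeta d k z - RtoC (/ Rabs (d (S k))) * atom (zeta (S k)) z
  end.

(** The angular limit of [q z * (z - zeta)], by [q z = - (1 - z)^2 / f z] and
    [f z / (z - zeta) -> d < 0]. The weighted atom has the same limit, so subtracting it leaves
    0. *)
Definition atom_coef (zeta : C) (d : R) : C := RtoC (/ Rabs d) * ((1 - zeta) * (1 - zeta)).

(** On the radius [z - zeta = - s * zeta], so [s * q z = - Cconj zeta * (q z * (z - zeta))]; this
    turns the complex coefficient into the real mass of [Julia_atom]. *)
Lemma atom_coef_radial (zeta : C) (d : R) : Cmod zeta = 1%R ->
  - Cconj zeta * atom_coef zeta d = RtoC (Cmod (1 - zeta) ^ 2 / Rabs d).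
Proof.
  intros Hz. unfold Rdiv. rewrite RtoC_mult, Cmod2_conj, Cminus_conj.
  rewrite (Cconj_RtoC 1).
  assert (Hzz : zeta * Cconj zeta = 1) by (rewrite <- Cmod2_conj, Hz, pow1; reflexivity).
  unfold atom_coef.
  replace (- Cconj zeta * (RtoC (/ Rabs d) * ((1 - zeta) * (1 - zeta)))) with
    (RtoC (/ Rabs d) * (1 - zeta) * (zeta * Cconj zeta - Cconj zeta)) by ring.
  rewrite Hzz. ring.
Qed.

(** Removing one atom does not disturb the limits at the other points, where it is regular by
    distinctness. So [Julia_atom] still finds the full mass at the next point and keeps the real
    part nonnegative. *)
Lemma remove_atoms_spec (q : C -> C) (zeta : nat -> C) (d : nat -> R) (N : nat) :
  (forall z, in_disk z -> cdiff q z) -> (forall z, in_disk z -> (0 <= fst (q z))%R) ->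
  (forall n, (1 <= n <= N)%nat -> Cmod (zeta n) = 1%R /\ zeta n <> 1 /\ (d n < 0)%R) ->
  (forall m n, (1 <= m <= N)%nat -> (1 <= n <= N)%nat -> zeta m = zeta n -> m = n) ->
  (forall n, (1 <= n <= N)%nat -> angular_lim (fun z => q z * (z - zeta n)) (zeta n)
    (atom_coef (zeta n) (d n))) ->
  forall j, (j <= N)%nat ->
  (forall z, in_disk z -> cdiff (remove_atoms q zeta d j) z) /\
  (forall z, in_disk z -> (0 <= fst (remove_atoms q zeta d j z))%R) /\
  (forall n, (1 <= n <= N)%nat -> angular_lim (fun z => remove_atoms q zeta d j z * (z - zeta n)) (zeta n)
     (if (n <=? j)%nat then 0 else atom_coef (zeta n) (d n))).
Proof.
  intros Hqd Hqp Hz Hinj Hlim. induction j as [|j IH]; intros Hj.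
  { split; [auto|split; [auto|]]. intros n Hn.
    replace (n <=? 0)%nat with false by (symmetry; apply Nat.leb_gt; lia). auto. }
  destruct (IH ltac:(lia)) as (I1 & I2 & I3).
  destruct (Hz (S j) ltac:(lia)) as (Z1 & Z2 & Z3).
  set (R0 := remove_atoms q zeta d j) in *. set (ze := zeta (S j)) in *.
  set (mu := (/ Rabs (d (S j)))%R).
  assert (Hmu : (0 < mu)%R) by (apply Rinv_0_lt_compat, Rabs_pos_lt; lra).
  assert (Hne : forall z, in_disk z -> z - ze <> 0) by (intros; now apply disk_neq_boundary).
  assert (H1z : (0 < Cmod (1 - ze))%R).
  { apply Cmod_gt_0. intros E. apply Z2. replace ze with (1 - (1 - ze)) by ring. rewrite E. ring. }
  split; [|split].
  - intros z Hzd. simpl. apply cdiff_minus; [apply I1; auto|].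
    apply cdiff_mult; [apply cdiff_const|]. apply cdiff_atom, Hne, Hzd.
  - intros z Hzd. change (0 <= fst (R0 z) + - fst (RtoC mu * atom ze z)%C)%R. rewrite fst_RtoC_mult.
    pose proof (I3 (S j) ltac:(lia)) as L. rewrite (proj2 (Nat.leb_gt (S j) j)) in L by lia.
    fold ze in L.
    assert (HJ : (Cmod (1 - ze) ^ 2 * mu * (1 - Cmod z ^ 2) <= 2 * Cmod (z - ze) ^ 2 * fst (R0 z))%R).
    { apply (Julia_atom R0 ze); auto.
      - apply Rmult_lt_0_compat; auto. now apply pow_lt.
      - intros e He. destruct (angular_lim_radial _ _ _ Z1 L e He) as (s & Hs1 & Hs2 & Hs3).
        exists s. split; auto.
        change (Cmod (1 - ze) ^ 2 * mu)%R with (Cmod (1 - ze) ^ 2 / Rabs (d (S j)))%R.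
        rewrite <- atom_coef_radial by auto.
        assert (Hzz : ze * Cconj ze = 1) by (rewrite <- Cmod2_conj, Z1, pow1; reflexivity).
        replace (RtoC s * R0 (RtoC (1 - s) * ze))
          with (- Cconj ze * (R0 (RtoC (1 - s) * ze) * (RtoC (1 - s) * ze - ze))).
        2: { rewrite RtoC_minus at 2.
             replace ((RtoC 1 - RtoC s) * ze - ze) with (- (RtoC s * ze)) by ring.
             replace (- Cconj ze * (R0 (RtoC (1 - s) * ze) * - (RtoC s * ze)))
               with ((ze * Cconj ze) * (RtoC s * R0 (RtoC (1 - s) * ze))) by ring.
             rewrite Hzz. ring. }
        replace (- Cconj ze * (R0 (RtoC (1 - s) * ze) * (RtoC (1 - s) * ze - ze))
          - - Cconj ze * atom_coef ze (d (S j))) with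
          (- Cconj ze * (R0 (RtoC (1 - s) * ze) * (RtoC (1 - s) * ze - ze) - atom_coef ze (d (S j)))) by ring.
        rewrite Cmod_mult, Cmod_opp, Cmod_conj, Z1, Rmult_1_l. exact Hs3. }
    pose proof (atom_fst ze z Z1 (Hne z Hzd)) as E. pose proof (Hne z Hzd) as Hp.
    apply Cmod_gt_0 in Hp.
    apply Rmult_le_reg_l with (2 * Cmod (z - ze) ^ 2)%R.
    { assert (0 < Cmod (z - ze) ^ 2)%R by now apply pow_lt. lra. }
    rewrite Rmult_0_r. nra.
  - intros n Hn. pose proof (I3 n Hn) as L.
    (* At its own point the new atom contributes the whole coefficient; elsewhere the factor
       [z - zeta n] makes the limit 0. *)
    assert (HA : angular_lim (fun z => RtoC mu * ((1 - z) * (1 - ze)) * ((z - zeta n) / (z - ze))) (zeta n)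
       (if (n =? S j)%nat then atom_coef (zeta n) (d n) else 0)).
    { destruct (Nat.eqb_spec n (S j)) as [En|En].
      - subst n. fold ze. unfold atom_coef. fold mu.
        apply angular_lim_ext with (fun z => RtoC mu * ((1 - z) * (1 - ze))).
        + intros z Hzd. field. now apply Hne.
        + apply angular_lim_mult; [apply angular_lim_const|].
          apply angular_lim_mult; [apply angular_lim_1_minus|apply angular_lim_const].
      - replace (RtoC 0) with (RtoC mu * ((1 - zeta n) * (1 - ze)) * ((zeta n - zeta n) / (zeta n - ze))).
        2: { replace (zeta n - zeta n) with (RtoC 0) by ring. unfold Cdiv. ring. }
        apply angular_lim_mult.
        + apply angular_lim_mult; [apply angular_lim_const|].
          apply angular_lim_mult; [apply angular_lim_1_minus|apply angular_lim_const].
        + apply angular_lim_div.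
          * intros E. apply En, Hinj; auto; [lia|]. fold ze.
            replace (zeta n) with ((zeta n - ze) + ze) by ring. rewrite E. ring.
          * apply angular_lim_minus; [apply angular_lim_id|apply angular_lim_const].
          * apply angular_lim_minus; [apply angular_lim_id|apply angular_lim_const]. }
    pose proof (angular_lim_minus _ _ _ _ _ L HA) as LL.
    replace (if (n <=? S j)%nat then RtoC 0 else atom_coef (zeta n) (d n)) with
      ((if (n <=? j)%nat then RtoC 0 else atom_coef (zeta n) (d n))
        - (if (n =? S j)%nat then atom_coef (zeta n) (d n) else 0)).
    2: { destruct (Nat.leb_spec n j), (Nat.leb_spec n (S j)), (Nat.eqb_spec n (S j)); try lia; ring.
         }
    apply angular_lim_ext with (2 := LL). intros z Hzd. simpl. fold R0 ze mu. unfold atom, Cdiv.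
    ring.
Qed.

Lemma remove_atoms_sum (q : C -> C) (zeta : nat -> C) (d : nat -> R) (N : nat) (z : C) :
  z - 1 <> 0 -> (forall n, (1 <= n <= N)%nat -> z - zeta n <> 0 /\ (d n < 0)%R) ->
  sum_n_m (G := C_AbelianMonoid)
    (fun n : nat => 1 / RtoC (Rabs (d n)) * (1 / (z - 1) - 1 / (z - zeta n))) 1 N
  = (remove_atoms q zeta d N z - q z) / ((1 - z) * (1 - z)).
Proof.
  intros Hz1. assert (Hz1' : 1 - z <> 0).
  { intros E. apply Hz1. replace (z - 1) with (- (1 - z)) by ring. rewrite E. ring. }
  induction N as [|N IH]; intros H.
  - rewrite sum_n_m_zero by lia. simpl. change zero with (RtoC 0). field. auto.
  - rewrite sum_n_Sm by lia. rewrite IH by (intros; apply H; lia).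
    destruct (H (S N) ltac:(lia)) as [H1 H2].
    assert (Hd : (Rabs (d (S N)) <> 0)%R) by (apply Rgt_not_eq, Rabs_pos_lt; lra).
    assert (Hd' : RtoC (Rabs (d (S N))) <> 0) by (intros E; apply RtoC_inj in E; auto).
    simpl remove_atoms. rewrite RtoC_inv by auto. unfold atom.
    set (a := RtoC (Rabs (d (S N)))) in *. set (Rm := remove_atoms q zeta d N z).
    match goal with |- plus ?x ?y = ?w => change (@eq C (x + y) w) end. field. repeat split; auto.
Qed.

(** Each weighted atom has a simple zero at 1, and its quotient by [1 - z] tends to [1 / |d n|];
    thus [s] is the sum of these numbers, which enters [r]. *)
Lemma remove_atoms_at_1 (q : C -> C) (zeta : nat -> C) (d : nat -> R) (N : nat) :
  (forall n, (1 <= n <= N)%nat -> zeta n <> 1) ->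
  exists (T : C -> C) (s : R), angular_lim T 1 (RtoC s) /\
    forall z, in_disk z -> remove_atoms q zeta d N z = q z - T z * (1 - z).
Proof.
  induction N as [|N IH]; intros H.
  - exists (fun _ => 0), 0%R. split; [apply angular_lim_const|]. intros z _. simpl. ring.
  - destruct IH as (T & s & HT & E); [intros; apply H; lia|].
    exists (fun z => T z + RtoC (/ Rabs (d (S N))) * ((1 - zeta (S N)) / (z - zeta (S N)))),
      (s + / Rabs (d (S N)))%R.
    assert (Hz : 1 - zeta (S N) <> 0).
    { intros E0. apply (H (S N)); [lia|]. replace (zeta (S N)) with (1 - (1 - zeta (S N))) by ring.
      rewrite E0. ring. }
    split.
    + replace (RtoC (s + / Rabs (d (S N)))) with (RtoC s + RtoC (/ Rabs (d (S N)))
      * ((1 - zeta (S N)) / (1 - zeta (S N)))) by (rewrite RtoC_plus; field; auto).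
      apply angular_lim_plus; auto. apply angular_lim_mult; [apply angular_lim_const|].
      apply angular_lim_div; [auto|apply angular_lim_const|].
      apply angular_lim_minus; [apply angular_lim_id|apply angular_lim_const].
    + intros z Hzd. simpl. rewrite E by auto. unfold atom, Cdiv. ring.
Qed.

(** * The representation *)

Lemma angular_derivative_at_1 (h p : C -> C) (b : C) :
  (forall z, in_disk z -> h z = - ((1 - z) * (1 - z) * p z)) ->
  angular_lim (fun z => (1 - z) * p z) 1 b -> is_angular_derivative h 1 b.
Proof.
  intros Hh Hb. split.
  - replace (RtoC 0) with ((1 - 1) * - b) by ring.
    apply angular_lim_ext with (fun z => (1 - z) * - ((1 - z) * p z)).
    + intros z Hz. rewrite Hh by auto. ring.
    + apply angular_lim_mult; [apply angular_lim_1_minus|]. now apply angular_lim_opp.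
  - apply angular_lim_ext with (2 := Hb). intros z Hz. rewrite Hh by auto.
    assert (z - 1 <> 0) by (apply disk_neq_boundary; auto; apply Cmod_1). field. auto.
Qed.

Lemma Re_Cinv_1_minus (z : C) : in_disk z -> (0 <= fst (/ (1 - z))%C)%R.
Proof.
  intros Hz. apply Re_Cinv_ge_0; [now apply disk_neq_1|].
  unfold in_disk in Hz. pose proof (fst_le_Cmod z). change (0 <= 1 + - fst z)%R. lra.
Qed.

Lemma Cinv_neq_0 (z : C) : z <> 0 -> / z <> 0.
Proof. intros H E. apply C1_nz. rewrite <- (Cinv_r z) by auto. rewrite E. ring. Qed.

Theorem theorem4p1
  (F : R -> C -> C) (f : C -> C)
  (F_semigroup : is_semigroup F)
  (f_generator : is_generator_of f F)
  (F_DW : is_Denjoy_Wolff_point F 1)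
  (N : nat) (zeta : nat -> C) (d : nat -> R)
  (zeta_null : forall n : nat, (1 <= n <= N)%nat ->
     boundary_regular_null_point f (zeta n) /\ zeta n <> 1)
  (zeta_distinct : forall m n : nat, (1 <= m <= N)%nat -> (1 <= n <= N)%nat ->
     zeta m = zeta n -> m = n)
  (zeta_deriv : forall n : nat, (1 <= n <= N)%nat ->
     is_angular_derivative f (zeta n) (RtoC (d n)) /\ (d n < 0)%R) :
  exists (r : R) (h : C -> C),
    (0 <= r)%R /\
    is_holomorphic_generator h /\
    (forall z : C, in_disk z ->
       f z <> 0 /\ h z <> 0 /\
       1 / f z =
         sum_n_m (G := C_AbelianMonoid)
           (fun n : nat =>
              1 / RtoC (Rabs (d n)) * (1 / (z - 1) - 1 / (z - zeta n))) 1 N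
         + RtoC r / h z) /\
    (exists b : C, is_angular_derivative f 1 b /\ is_angular_derivative h 1 b) /\
    (forall n : nat, (1 <= n <= N)%nat ->
       angular_lim_infty (fun z : C => h z / (z - zeta n)) (zeta n)).
Proof.
  pose proof (generator_nonzero F f F_semigroup f_generator F_DW) as Hf0.
  pose proof (generator_Re_pos F f F_semigroup f_generator F_DW) as Hpp.
  set (p := fun z => - f z / ((1 - z) * (1 - z))).
  set (q := fun z => / p z).
  assert (Nz : forall z, in_disk z -> 1 - z <> 0) by apply disk_neq_1.
  assert (Nz1 : forall z, in_disk z -> z - 1 <> 0) by (intros; apply disk_neq_boundary; auto; apply Cmod_1).
  assert (Hfp : forall z, in_disk z -> f z = - ((1 - z) * (1 - z) * p z)).
  { intros z Hz. unfold p. field. auto. }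
  assert (Hp0 : forall z, in_disk z -> p z <> 0).
  { intros z Hz E. apply (Hf0 z Hz). rewrite Hfp, E by auto. ring. }
  assert (Hpd : forall z, in_disk z -> cdiff p z).
  { intros z Hz. unfold p. apply cdiff_div; [|cdiff_auto|apply Cmult_neq_0; auto].
    apply cdiff_opp, cdiff_ex_derive. now apply (proj1 f_generator). }
  assert (Hqd : forall z, in_disk z -> cdiff q z) by (intros; apply cdiff_inv; auto).
  assert (Hqp : forall z, in_disk z -> (0 <= fst (q z))%R) by (intros; apply Re_Cinv_ge_0; auto;
    now apply Hpp).
  assert (Hpq : forall z, in_disk z -> p z * q z = 1) by (intros; unfold q; apply Cinv_r; auto).
  (* [b] is the angular derivative of [f] at 1, since [f z / (z - 1) = (1 - z) * p z]. *)
  destruct (Julia_Wolff_Caratheodory p Hpd Hpp) as [b [Hb0 Hb']].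
  assert (Hb : angular_lim (fun z => (1 - z) * p z) 1 (RtoC b)) by now apply angular_lim_Cmod.
  clear Hb'.
  assert (Hze : forall n, (1 <= n <= N)%nat -> Cmod (zeta n) = 1%R /\ zeta n <> 1 /\ (d n < 0)%R).
  { intros n Hn. destruct (zeta_null n Hn) as [[? _] ?]. destruct (zeta_deriv n Hn). auto. }
  assert (Nzn : forall n z, (1 <= n <= N)%nat -> in_disk z -> z - zeta n <> 0).
  { intros n z Hn Hz. apply disk_neq_boundary; auto. apply Hze; auto. }
  assert (Nzeta : forall n, (1 <= n <= N)%nat -> 1 - zeta n <> 0).
  { intros n Hn E. apply (Hze n Hn). replace (zeta n) with (1 - (1 - zeta n)) by ring. rewrite E.
    ring. }
  assert (Hatoms : forall n, (1 <= n <= N)%nat ->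
    angular_lim (fun z => q z * (z - zeta n)) (zeta n) (atom_coef (zeta n) (d n))).
  { intros n Hn. destruct (zeta_deriv n Hn) as [[_ Hd] Hneg].
    assert (Hdn : RtoC (d n) <> 0) by (intros E; apply RtoC_inj in E; lra).
    replace (atom_coef (zeta n) (d n)) with (- ((1 - zeta n) * (1 - zeta n)) / RtoC (d n)).
    2: { unfold atom_coef. rewrite Rabs_left, RtoC_inv, RtoC_opp by lra. field. auto. }
    apply angular_lim_ext with (fun z => - ((1 - z) * (1 - z)) / (f z / (z - zeta n))).
    - intros z Hz. unfold q, p. field. repeat split; auto.
    - apply angular_lim_div; auto.
      apply angular_lim_opp, angular_lim_mult; apply angular_lim_1_minus. }
  destruct (remove_atoms_spec q zeta d N Hqd Hqp Hze zeta_distinct Hatoms N (Nat.le_refl N))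
    as (HRd & HRp & HRlim).
  destruct (remove_atoms_at_1 q zeta d N (fun n Hn => proj1 (proj2 (Hze n Hn)))) as (T & s & HT & HRT).
  assert (Hsum : forall z, in_disk z -> sum_n_m (G := C_AbelianMonoid)
           (fun n : nat => 1 / RtoC (Rabs (d n)) * (1 / (z - 1) - 1 / (z - zeta n))) 1 N
           = (remove_atoms q zeta d N z - q z) / ((1 - z) * (1 - z))).
  { intros z Hz. apply remove_atoms_sum; auto. intros n Hn. split; [auto|apply Hze; auto]. }
  set (R0 := remove_atoms q zeta d N) in *.
  assert (Hf_inv : forall z, in_disk z -> 1 / f z = - q z / ((1 - z) * (1 - z))).
  { intros z Hz. rewrite Hfp by auto. unfold q. field. auto. }
  (* This limit is the later [r]; it links the behaviour of [R0] at 1 with that of [p]. *)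
  assert (Hratio : angular_lim (fun z => R0 z * p z) 1 (1 - RtoC s * RtoC b)).
  { apply angular_lim_ext with (fun z => 1 - T z * ((1 - z) * p z)).
    - intros z Hz. rewrite HRT by auto. replace (RtoC 1) with (p z * q z) at 1 by auto. ring.
    - apply angular_lim_minus; [apply angular_lim_const|]. now apply angular_lim_mult. }
  destruct (classic (exists z0, in_disk z0 /\ R0 z0 = 0)) as [[z0 [Hz0 ER]]|HRn].
  - assert (HR0 : forall z, in_disk z -> R0 z = 0).
    { intros z Hz. rewrite <- ER. apply Re_zero_const; auto. rewrite ER. reflexivity. }
    (* With [R0] identically 0 the limit [1 - s * b] is 0. This gives [b <> 0], without which the
       linear [h] would vanish. *)
    assert (Esb : RtoC s * RtoC b = 1).
    { assert (E : 1 - RtoC s * RtoC b = 0).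
      { apply (angular_lim_unique _ _ _ _ Cmod_1 Hratio).
        apply angular_lim_ext with (fun _ => 0); [|apply angular_lim_const]. intros z Hz.
        rewrite HR0 by auto. ring. }
      replace (RtoC s * RtoC b) with (1 - (1 - RtoC s * RtoC b)) by ring. rewrite E. ring. }
    assert (Hbn : RtoC b <> 0) by (intros E; rewrite E, Cmult_0_r in Esb; apply RtoC_inj in Esb; lra).
    set (p1 := fun z => RtoC b * / (1 - z)).
    set (h := fun z => - ((1 - z) * (1 - z) * p1 z)).
    assert (Hh : forall z, in_disk z -> h z = - RtoC b * (1 - z)).
    { intros z Hz. unfold h, p1. field. auto. }
    exists 0%R, h. split; [lra|split; [|split; [|split]]].
    + apply generator_of_positive.
      * intros z Hz. unfold p1. apply cdiff_mult; [apply cdiff_const|].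
        apply cdiff_inv; [cdiff_auto|auto].
      * intros z Hz. unfold p1. rewrite fst_RtoC_mult. apply Rmult_le_pos; auto.
        now apply Re_Cinv_1_minus.
      * intros z Hz. apply Cmult_neq_0; auto. apply Cinv_neq_0; auto.
    + intros z Hz. split; [auto|]. assert (Hhz : h z <> 0).
      { rewrite Hh by auto. apply Cmult_neq_0; auto. intros E. apply Hbn.
        replace (RtoC b) with (- - RtoC b) by ring. rewrite E. ring. }
      split; auto. rewrite Hf_inv, Hsum, HR0 by auto. field. auto.
    + exists (RtoC b). split; [now apply angular_derivative_at_1 with p|].
      apply angular_derivative_at_1 with p1; [reflexivity|].
      apply angular_lim_ext with (fun _ => RtoC b); [|apply angular_lim_const]. intros z Hz.
      unfold p1. field. auto.
    + intros n Hn. apply angular_lim_infty_div with (- ((1 - zeta n) * (RtoC b))).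
      * intros E. apply (Cmult_neq_0 _ _ (Nzeta n Hn) Hbn).
        replace ((1 - zeta n) * RtoC b) with (- - ((1 - zeta n) * RtoC b)) by ring. rewrite E. ring.
      * apply angular_lim_ext with (fun z => - ((1 - z) * RtoC b)).
        { intros z Hz. rewrite Hh by auto. ring. }
        apply angular_lim_opp, angular_lim_mult; [apply angular_lim_1_minus|apply angular_lim_const].
      * replace (RtoC 0) with (zeta n - zeta n) by ring.
        apply angular_lim_minus; [apply angular_lim_id|apply angular_lim_const].
      * intros z Hz. auto.
  - assert (HR0 : forall z, in_disk z -> R0 z <> 0) by (intros z Hz E; apply HRn; eauto).
    assert (HRi : forall z, in_disk z -> cdiff (fun z => / R0 z) z) by (intros; apply cdiff_inv; auto).
    assert (HRip : forall z, in_disk z -> (0 <= fst (/ R0 z)%C)%R) by (intros; apply Re_Cinv_ge_0; auto).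
    destruct (Julia_Wolff_Caratheodory (fun z => / R0 z) HRi HRip) as [B [HB0 HB']].
    assert (HB : angular_lim (fun z => (1 - z) * / R0 z) 1 (RtoC B)) by now apply angular_lim_Cmod.
    clear HB'.
    set (r := (1 - s * b)%R).
    assert (Er : RtoC r = 1 - RtoC s * RtoC b) by (unfold r; rewrite RtoC_minus, RtoC_mult; reflexivity).
    (* The product of [(1 - z) / R0 z] and [R0 z * p z] is [(1 - z) * p z]; compare angular limits
       at 1. *)
    assert (EB : (B * r = b)%R).
    { apply RtoC_inj. rewrite RtoC_mult, Er.
      apply (angular_lim_unique (fun z => (1 - z) * p z) 1); auto. apply Cmod_1.
      apply angular_lim_ext with (fun z => ((1 - z) * / R0 z) * (R0 z * p z)).
      - intros z Hz. field. auto.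
      - now apply angular_lim_mult. }
    (* For [b = 0] this is [r = 1]; otherwise [B * r = b > 0] with [B >= 0] excludes [r <= 0]. *)
    assert (Hr : (0 < r)%R).
    { destruct (Req_dec b 0) as [E|E]; [unfold r; rewrite E; lra|].
      apply Rnot_le_lt. intros Hr. assert (B * r <= 0)%R by nra. lra. }
    assert (Hrn : RtoC r <> 0) by (intros E; apply RtoC_inj in E; lra).
    set (p1 := fun z => RtoC r * / R0 z).
    set (h := fun z => - ((1 - z) * (1 - z) * p1 z)).
    exists r, h. split; [lra|split; [|split; [|split]]].
    + apply generator_of_positive.
      * intros z Hz. unfold p1. apply cdiff_mult; [apply cdiff_const|auto].
      * intros z Hz. unfold p1. rewrite fst_RtoC_mult. apply Rmult_le_pos; [lra|auto].
      * intros z Hz. apply Cmult_neq_0; auto. apply Cinv_neq_0; auto.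
    + intros z Hz. split; [auto|]. assert (Hp1 : p1 z <> 0).
      { apply Cmult_neq_0; auto. apply Cinv_neq_0; auto. }
      split.
      * intros E. apply (Cmult_neq_0 _ _ (Cmult_neq_0 _ _ (Nz z Hz) (Nz z Hz)) Hp1).
        unfold h in E.
        replace ((1 - z) * (1 - z) * p1 z) with (- - ((1 - z) * (1 - z) * p1 z)) by ring. rewrite E.
        ring.
      * rewrite Hf_inv, Hsum by auto. unfold h, p1. field. auto.
    + exists (RtoC b). split; [now apply angular_derivative_at_1 with p|].
      apply angular_derivative_at_1 with p1; [reflexivity|].
      rewrite <- EB, Rmult_comm, RtoC_mult.
      apply angular_lim_ext with (fun z => RtoC r * ((1 - z) * / R0 z)); [intros; unfold p1; ring|].
      apply angular_lim_mult; [apply angular_lim_const|auto].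
    + intros n Hn. pose proof (HRlim n Hn) as L. rewrite (proj2 (Nat.leb_le n N)) in L by lia.
      (* The denominator tends to 0 because the atom at [zeta n] has been removed, while the
         numerator has a nonzero limit. *)
      assert (LI : angular_lim_infty (fun z => - ((1 - z) * (1 - z) * RtoC r)
        / (R0 z * (z - zeta n))) (zeta n)).
      { apply angular_lim_infty_div with (- ((1 - zeta n) * (1 - zeta n) * RtoC r)); auto.
        - intros E. apply (Cmult_neq_0 _ _ (Cmult_neq_0 _ _ (Nzeta n Hn) (Nzeta n Hn)) Hrn).
          replace ((1 - zeta n) * (1 - zeta n) * RtoC r)
            with (- - ((1 - zeta n) * (1 - zeta n) * RtoC r)) by ring.
          rewrite E. ring.
        - apply angular_lim_opp, angular_lim_mult; [|apply angular_lim_const].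
          apply angular_lim_mult; apply angular_lim_1_minus.
        - intros z Hz. apply Cmult_neq_0; auto. }
      apply angular_lim_infty_ext with (2 := LI). intros z Hz. unfold h, p1. field. auto.
Qed.
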